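(* The 2-category $\mathsf{Fib}$ of (cloven) fibrations admits the construction of vector fields. In particular, the tangentad of vector fields of a tangent fibration $\Pi:(\mathbb X',\mathbb T')\to(\mathbb X,\mathbb T)$ is the tangent fibration $\mathrm{VF}(\Pi):\mathrm{VF}(\mathbb X',\mathbb T')\to\mathrm{VF}(\mathbb X,\mathbb T)$ which sends a vector field $(E,w)$ of $(\mathbb X',\mathbb T')$ to $(\Pi(E),\Pi(w))$.
   Context: Let $\mathbf K$ be a 2-category. For a 2-morphism $\varphi$ and a 1-morphism $H$, write $H\varphi$ and $\varphi_H$ for the whiskerings (post- and precomposition with $H$). A pullback in $\mathbf K(\mathbb X,\mathbb Y)$ is pointwise if it is preserved by $\mathbf K(F,\mathbb Y)$ for every 1-morphism $F:\mathbb X'\to\mathbb X$. Tangentad: a tangentad $(\mathbb X,\mathbb T)$ in $\mathbf K$ is an object $\mathbb X$ with a tangent structure $\mathbb T=(T,p,z,s,l,c)$: a 1-morphism $T:\mathbb X\to\mathbb X$ and 2-morphisms $p:T\Rightarrow\mathrm{id}$, $z:\mathrm{id}\Rightarrow T$, $s:T_2\Rightarrow T$, $l:T\Rightarrow T^2$, $c:T^2\Rightarrow T^2$ such that: (1) for each $n\ge1$ the $n$-fold pullback $T_n$ of $p$ along itself (projections $\pi_k:T_n\Rightarrow T$) exists in $\mathbf K(\mathbb X,\mathbb X)$, is pointwise, and is preserved by postcomposition with all iterates $T^m$; (2) $pz=\mathrm{id}$, $ps=p\pi_1$, and $s$ is associative, commutative and unital with unit $z$; (3) $Tp\circ l=z\circ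 p$, $l\circ z=Tz\circ z$, $l\circ s=Ts\circ\langle l\pi_1,l\pi_2\rangle$; (4) $p_T\circ c=Tp$, $c\circ Tz=z_T$, $c\circ Ts=s_T\circ\langle c\circ T\pi_1,c\circ T\pi_2\rangle$; (5) $Tl\circ l=l_T\circ l$, $c\circ l=l$, $c_T\circ Tc\circ l_T=Tl\circ c$, $c\circ c=\mathrm{id}$, $Tc\circ c_T\circ Tc=c_T\circ Tc\circ c_T$; (6) the square with top $Ts\circ\langle l\pi_1,z_T\pi_2\rangle:T_2\Rightarrow T^2$, left side $p\pi_1:T_2\Rightarrow\mathrm{id}$, right side $Tp:T^2\Rightarrow T$ and bottom $z:\mathrm{id}\Rightarrow T$ is a pointwise pullback. A tangent category is a tangentad in the 2-category $\mathsf{Cat}$. Morphisms: a lax tangent morphism $(F,\alpha):(\mathbb X,\mathbb T)\to(\mathbb X',\mathbb T')$ is a 1-morphism $F:\mathbb X\to\mathbb X'$ with a 2-morphism $\alpha:F\circ T\Rightarrow T'\circ F$ such that $p'_F\circ\alpha=Fp$, $\alpha\circ Fz=z'_F$, $\alpha\circ Fs=s'_F\circ\langle\alpha\circ F\pi_1,\alpha\circ F\pi_2\rangle$, $l'_F\circ\alpha=T'\alpha\circ\alpha_T\circ Fl$, $c'_F\circ T'\alpha\circ\alpha_T=T'\alpha\circ\alpha_T\circ Fc$. It is strong if $\alpha$ is invertible, strict if $\alpha$ is an identity. A tangent 2-morphism $\varphi:(F,\alpha)\Rightarrow(G,\beta)$ is a 2-morphism $\varphi:F\Rightarrow G$ with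 $T'\varphi\circ\alpha=\beta\circ\varphi_T$. $\mathsf{Tng}(\mathbf K)$ is the 2-category of tangentads of $\mathbf K$, lax tangent morphisms and tangent 2-morphisms. Hom-tangent category: $[\mathbb X',\mathbb T'\mid\mathbb X,\mathbb T]$ is the category $\mathsf{Tng}(\mathbf K)((\mathbb X',\mathbb T'),(\mathbb X,\mathbb T))$ with the pointwise tangent structure: $\bar T(F,\alpha)=(T,c)\circ(F,\alpha)=(T\circ F,c_F\circ T\alpha)$, $\bar T\varphi=T\varphi$, structural transformations $p_F,z_F,s_F,l_F,c_F$. Vector fields: a vector field on an object $M$ of a tangent category is $v:M\to TM$ with $p_M\circ v=\mathrm{id}_M$. For a tangent category $(\mathbb Y,\mathbb T)$, $\mathrm{VF}(\mathbb Y,\mathbb T)$ is the tangent category of pairs $(M,v)$, $v$ a vector field on $M$; morphisms $f:(M,v)\to(N,u)$ are $f:M\to N$ with $Tf\circ v=u\circ f$; tangent bundle functor $(M,v)\mapsto(TM,c_M\circ Tv)$, $f\mapsto Tf$; structural transformations as in $(\mathbb Y,\mathbb T)$. $\mathrm{VF}[\mathbb X',\mathbb T'\mid\mathbb X,\mathbb T]$ is this construction applied to the Hom-tangent category. Construction of vector fields: for a strict tangent morphism $U:(\mathbb V,\mathbb T^{\mathbb V})\to(\mathbb X,\mathbb T)$ and a vector field $\mathbf v:U\Rightarrow\bar TU$ on $U$ in $[\mathbb V,\mathbb T^{\mathbb V}\mid\mathbb X,\mathbb T]$, for each tangentad $(\mathbb X',\mathbb T')$ let $\Gamma_{\mathbf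 v}:[\mathbb X',\mathbb T'\mid\mathbb V,\mathbb T^{\mathbb V}]\to\mathrm{VF}[\mathbb X',\mathbb T'\mid\mathbb X,\mathbb T]$ be the strict tangent morphism $(H,\gamma)\mapsto(U\circ(H,\gamma),\mathbf v_H)$, $\varphi\mapsto U\varphi$. A tangentad $(\mathbb X,\mathbb T)$ admits the construction of vector fields if there are a tangentad $\mathrm{VF}(\mathbb X,\mathbb T)$ (the tangentad of vector fields), a strict tangent morphism $U:\mathrm{VF}(\mathbb X,\mathbb T)\to(\mathbb X,\mathbb T)$ and a vector field $\mathbf v$ on $U$ in $[\mathrm{VF}(\mathbb X,\mathbb T)\mid\mathbb X,\mathbb T]$ (the universal vector field) such that $\Gamma_{\mathbf v}$ is invertible for every $(\mathbb X',\mathbb T')$. $\mathbf K$ admits the construction of vector fields if every tangentad of $\mathbf K$ does. Fibrations: objects of $\mathsf{Fib}$ are triples $(\mathbb X,\mathbb X';\Pi)$ with $\Pi:\mathbb X'\to\mathbb X$ a cloven (Grothendieck) fibration over an arbitrary base. 1-morphisms $(F,F'):(\mathbb X_1,\mathbb X_1';\Pi_1)\to(\mathbb X_2,\mathbb X'_2;\Pi_2)$ are pairs of functors $F:\mathbb X_1\to\mathbb X_2$, $F':\mathbb X_1'\to\mathbb X_2'$ with $\Pi_2\circ F'=F\circ\Pi_1$ such that $F'$ sends each Cartesian lift $\varphi_f:f^*E\to E$ of a morphism $f$ of $\mathbb X_1$ to a Cartesian lift of $Ff$. 2-morphisms $(F,F')\Rightarrow(G,G')$ are pairs of natural transformations $\varphi:F\Rightarrow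 G$, $\varphi':F'\Rightarrow G'$ with $\Pi_2\varphi'=\varphi_{\Pi_1}$. A tangent fibration is a cloven fibration $\Pi:(\mathbb X',\mathbb T')\to(\mathbb X,\mathbb T)$ between tangent categories which is a strict tangent morphism and such that $T'$ sends each Cartesian lift of $f$ to a Cartesian lift of $Tf$. Tangentads in $\mathsf{Fib}$ are exactly tangent fibrations. *)

(* Defs.v *)
From mathcomp Require Import all_boot.
From Stdlib Require Import FunctionalExtensionality ProofIrrelevance.

Set Implicit Arguments.
Unset Strict Implicit.
Unset Printing Implicit Defensive.

Reserved Notation "a ~> b" (at level 55, no associativity).
Reserved Notation "g ∘ f" (at level 40, left associativity).
Reserved Notation "f ≈ g" (at level 70, no associativity).
Reserved Notation "G ⊚ F" (at level 37, right associativity).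
Reserved Notation "H ◃ φ" (at level 38, no associativity).
Reserved Notation "φ ▹ F" (at level 38, no associativity).

Record Category := {
  Ob :> Type;
  Hom : Ob -> Ob -> Type;
  idm : forall a, Hom a a;
  comp : forall x y z, Hom y z -> Hom x y -> Hom x z;
  comp_idl : forall a b (f : Hom a b), comp (idm b) f = f;
  comp_idr : forall a b (f : Hom a b), comp f (idm a) = f;
  compA : forall a b c d (h : Hom c d) (g : Hom b c) (f : Hom a b),
    comp h (comp g f) = comp (comp h g) f
}.
Arguments Hom {_} a b.
Arguments idm {_} a.
Arguments comp {_ _ _ _} g f.

Notation "a ~> b" := (Hom a b).
Notation "g ∘ f" := (comp g f).

(** [f ≈ g]: the sources are equal, the targets are equal, and [f] equals [g]
    under this identification. *)
Inductive heq {C : Category} {a b : C} (f : a ~> b) :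
    forall {c d : C}, c ~> d -> Prop :=
  heq_refl : heq f f.
Notation "f ≈ g" := (heq f g).
#[global] Hint Resolve heq_refl : core.

(** The identity, seen as an arrow between two equal objects. *)
Definition eq_hom {C : Category} {a b : C} (e : a = b) : a ~> b :=
  match e in _ = b' return a ~> b' with erefl => idm a end.

Section Heq.
Variable C : Category.
Implicit Types a b c d : C.

Lemma heq_sym a b c d (f : a ~> b) (g : c ~> d) : f ≈ g -> g ≈ f.
Proof. by move=> H; destruct H. Qed.

Lemma heq_trans a b c d a' b' (f : a ~> b) (g : c ~> d) (h : a' ~> b') :
  f ≈ g -> g ≈ h -> f ≈ h.
Proof. by move=> H; destruct H. Qed.

Lemma heq_of_eq a b (f g : a ~> b) : f = g -> f ≈ g.
Proof. by move->. Qed.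

Lemma heq_pack a b c d (f : a ~> b) (g : c ~> d) : f ≈ g ->
  existT (fun x => {y : C & x ~> y}) a (existT (fun y => a ~> y) b f)
  = existT (fun x => {y : C & x ~> y}) c (existT (fun y => c ~> y) d g).
Proof. by move=> H; destruct H. Qed.

Lemma heq_eq a b (f g : a ~> b) : f ≈ g -> f = g.
Proof.
move=> H; apply: (@inj_pair2 C (fun y => a ~> y)).
exact: (@inj_pair2 C (fun x => {y : C & x ~> y})) (heq_pack H).
Qed.

Lemma heq_dom a b c d (f : a ~> b) (g : c ~> d) : f ≈ g -> a = c.
Proof. by move=> H; destruct H. Qed.

Lemma heq_cod a b c d (f : a ~> b) (g : c ~> d) : f ≈ g -> b = d.
Proof. by move=> H; destruct H. Qed.

Lemma heq_comp a b c a' b' c' (g : b ~> c) (f : a ~> b) (g' : b' ~> c')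
  (f' : a' ~> b') : g ≈ g' -> f ≈ f' -> g ∘ f ≈ g' ∘ f'.
Proof.
move=> Hg Hf.
have ea := heq_dom Hf; have eb := heq_cod Hf; have ec := heq_cod Hg.
by subst; rewrite (heq_eq Hg) (heq_eq Hf).
Qed.

Lemma eq_hom_id a (e : a = a) : eq_hom e = idm a.
Proof. by rewrite (proof_irrelevance _ e erefl). Qed.

Lemma eq_homK a b (e e' : a = b) : eq_hom e = eq_hom e'.
Proof. by rewrite (proof_irrelevance _ e e'). Qed.

Lemma eq_hom_comp a b c (e : a = b) (e' : b = c) :
  eq_hom e' ∘ eq_hom e = eq_hom (etrans e e').
Proof. by subst; rewrite /= comp_idl. Qed.

Lemma eq_hom_comp3 a b c d (f : d ~> a) (e : a = b) (e' : b = c) :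
  eq_hom e' ∘ (eq_hom e ∘ f) = eq_hom (etrans e e') ∘ f.
Proof. by rewrite compA eq_hom_comp. Qed.

Lemma heq_eq_hom_l a b c (e : b = c) (f : a ~> b) : eq_hom e ∘ f ≈ f.
Proof. by subst; rewrite /= comp_idl. Qed.

Lemma heq_eq_hom_r a b c (e : a = b) (f : b ~> c) : f ∘ eq_hom e ≈ f.
Proof. by subst; rewrite /= comp_idr. Qed.

Lemma heq_conj a b a' b' (f : a ~> b) (f' : a' ~> b') (ea : a = a')
  (eb : b' = b) : f ≈ f' -> f = eq_hom eb ∘ (f' ∘ eq_hom ea).
Proof.
move=> H; apply: heq_eq; apply: heq_trans H _; apply: heq_sym.
by apply: heq_trans (heq_eq_hom_l _ _) (heq_eq_hom_r _ _).
Qed.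
End Heq.

Record Functor (C D : Category) := {
  fob :> C -> D;
  fmap : forall a b : C, a ~> b -> fob a ~> fob b;
  fmap_id : forall a, fmap (idm a) = idm (fob a);
  fmap_comp : forall a b c (g : b ~> c) (f : a ~> b),
    fmap (g ∘ f) = fmap g ∘ fmap f
}.
Arguments fmap {C D} F {a b} f : rename.
Arguments fmap_id {C D} F a : rename.
Arguments fmap_comp {C D} F {a b c} g f : rename.

Definition fid (C : Category) : Functor C C.
Proof. by refine {| fob := id; fmap := fun a b f => f |}. Defined.

Definition fcomp (C D E : Category) (G : Functor D E) (F : Functor C D) :
  Functor C E.
Proof.
refine {| fob := fun a => G (F a); fmap := fun a b f => fmap G (fmap F f) |}.
- by move=> a; rewrite !fmap_id.
- by move=> a b c g f; rewrite !fmap_comp.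
Defined.

Definition invertible (C D : Category) (F : Functor C D) : Prop :=
  exists G : Functor D C, fcomp G F = fid C /\ fcomp F G = fid D.

Record NatTrans (C D : Category) (F G : Functor C D) := {
  nt :> forall a, F a ~> G a;
  nt_nat : forall a b (f : a ~> b), fmap G f ∘ nt a = nt b ∘ fmap F f
}.

Lemma heq_fmap (C D : Category) (F : Functor C D) (a b c d : C)
  (f : a ~> b) (g : c ~> d) : f ≈ g -> fmap F f ≈ fmap F g.
Proof. by move=> H; destruct H. Qed.

Lemma fmap_eq_hom (C D : Category) (F : Functor C D) (a b : C) (e : a = b) :
  fmap F (eq_hom e) = eq_hom (f_equal F e).
Proof. by subst; rewrite /= fmap_id. Qed.

Lemma functor_eq (C D : Category) (F G : Functor C D)
  (H : forall a b (f : a ~> b), fmap F f ≈ fmap G f) : F = G.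
Proof.
case: F G H => [F0 F1 F2 F3] [G0 G1 G2 G3] /= H.
have e0 : F0 = G0.
  by apply: functional_extensionality => a; exact: heq_dom (H _ _ (idm a)).
subst G0.
have e1 : F1 = G1.
  do 3 (apply: functional_extensionality_dep => ?); exact: heq_eq.
by subst G1; rewrite (proof_irrelevance _ F2 G2) (proof_irrelevance _ F3 G3).
Qed.

Lemma functor_eq_heq (C D : Category) (F G : Functor C D) (a b : C)
  (f : a ~> b) : F = G -> fmap F f ≈ fmap G f.
Proof. by move->. Qed.

Lemma functor_eq_ob (C D : Category) (F G : Functor C D) (a : C) :
  F = G -> F a = G a.
Proof. by move->. Qed.

Lemma nat_eq (C D : Category) (F G : Functor C D) (s t : NatTrans F G) :
  (forall a, s a = t a) -> s = t.
Proof.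
case: s t => [s Hs] [t Ht] /= H.
have e : s = t by apply: functional_extensionality_dep.
by subst t; rewrite (proof_irrelevance _ Hs Ht).
Qed.

(** [L], with projections [pr], is the [n]-fold pullback of [f] along itself. *)
Definition is_nfold_pullback (C : Category) (n : nat) (A B L : C) (f : A ~> B)
    (pr : 'I_n -> L ~> A) : Prop :=
  (forall i j, f ∘ pr i = f ∘ pr j) /\
  forall (S : C) (q : 'I_n -> S ~> A), (forall i j, f ∘ q i = f ∘ q j) ->
    exists! h : S ~> L, forall i, pr i ∘ h = q i.

(** The square with top [a], left side [b], right side [f], bottom [g]. *)
Definition is_pullback (C : Category) (L A B D : C) (a : L ~> A) (b : L ~> B)
    (f : A ~> D) (g : B ~> D) : Prop :=
  f ∘ a = g ∘ b /\
  forall (S : C) (a' : S ~> A) (b' : S ~> B), f ∘ a' = g ∘ b' ->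
    exists! h : S ~> L, a ∘ h = a' /\ b ∘ h = b'.

(** Strict 2-categories: composition of 1-morphisms is associative and unital
    up to Leibniz equality, and the corresponding laws for whiskerings are
    stated with [≈] in the hom-categories. *)
Record TwoCategory := {
  Ob1 :> Type;
  Hom1 : Ob1 -> Ob1 -> Category;
  id1 : forall X, Hom1 X X;
  comp1 : forall X Y Z, Hom1 Y Z -> Hom1 X Y -> Hom1 X Z;
  lwhisk : forall X Y Z (H : Hom1 Y Z) (F G : Hom1 X Y),
    F ~> G -> comp1 H F ~> comp1 H G;
  rwhisk : forall X Y Z (F G : Hom1 Y Z) (H : Hom1 X Y),
    F ~> G -> comp1 F H ~> comp1 G H;
  lwhisk_id : forall X Y Z (H : Hom1 Y Z) (F : Hom1 X Y),
    lwhisk H (idm F) = idm (comp1 H F);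
  lwhisk_comp : forall X Y Z (H : Hom1 Y Z) (F G K : Hom1 X Y) (ψ : G ~> K)
    (φ : F ~> G), lwhisk H (ψ ∘ φ) = lwhisk H ψ ∘ lwhisk H φ;
  rwhisk_id : forall X Y Z (F : Hom1 Y Z) (H : Hom1 X Y),
    rwhisk H (idm F) = idm (comp1 F H);
  rwhisk_comp : forall X Y Z (F G K : Hom1 Y Z) (H : Hom1 X Y) (ψ : G ~> K)
    (φ : F ~> G), rwhisk H (ψ ∘ φ) = rwhisk H ψ ∘ rwhisk H φ;
  interchange : forall X Y Z (H K : Hom1 Y Z) (F G : Hom1 X Y) (ψ : H ~> K)
    (φ : F ~> G), lwhisk K φ ∘ rwhisk F ψ = rwhisk G ψ ∘ lwhisk H φ;
  comp1A : forall X Y Z W (H : Hom1 Z W) (G : Hom1 Y Z) (F : Hom1 X Y),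
    comp1 (comp1 H G) F = comp1 H (comp1 G F);
  comp1_idl : forall X Y (F : Hom1 X Y), comp1 (id1 Y) F = F;
  comp1_idr : forall X Y (F : Hom1 X Y), comp1 F (id1 X) = F;
  lwhisk_comp1 : forall X Y Z W (H : Hom1 Z W) (G : Hom1 Y Z)
    (F F' : Hom1 X Y) (φ : F ~> F'),
    lwhisk (comp1 H G) φ ≈ lwhisk H (lwhisk G φ);
  rwhisk_comp1 : forall X Y Z W (H H' : Hom1 Z W) (G : Hom1 Y Z)
    (F : Hom1 X Y) (φ : H ~> H'),
    rwhisk F (rwhisk G φ) ≈ rwhisk (comp1 G F) φ;
  lrwhisk : forall X Y Z W (H : Hom1 Z W) (G G' : Hom1 Y Z) (F : Hom1 X Y)
    (φ : G ~> G'), rwhisk F (lwhisk H φ) ≈ lwhisk H (rwhisk F φ);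
  lwhisk_id1 : forall X Y (F G : Hom1 X Y) (φ : F ~> G),
    lwhisk (id1 Y) φ ≈ φ;
  rwhisk_id1 : forall X Y (F G : Hom1 X Y) (φ : F ~> G),
    rwhisk (id1 X) φ ≈ φ
}.
Arguments Hom1 {t} _ _.
Arguments id1 {t} X : rename.
Arguments comp1 {t X Y Z} G F : rename.
Arguments lwhisk {t X Y Z} H {F G} φ : rename.
Arguments rwhisk {t X Y Z F G} H φ : rename.

Notation "G ⊚ F" := (comp1 G F).
Notation "H ◃ φ" := (lwhisk H φ).
Notation "φ ▹ F" := (rwhisk F φ).

Section TwoCategoryTheory.
Variable K : TwoCategory.

Definition postcomp (X Y Z : K) (H : Hom1 Y Z) :
  Functor (Hom1 X Y) (Hom1 X Z).
Proof.
refine {| fob := fun F : Hom1 X Y => H ⊚ F; fmap := fun F G φ => H ◃ φ |}.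
- by move=> F; exact: lwhisk_id.
- by move=> F G L ψ φ; exact: lwhisk_comp.
Defined.

Definition precomp (X Y Z : K) (F : Hom1 X Y) :
  Functor (Hom1 Y Z) (Hom1 X Z).
Proof.
refine {| fob := fun H : Hom1 Y Z => H ⊚ F; fmap := fun G H φ => φ ▹ F |}.
- by move=> G; exact: rwhisk_id.
- by move=> G H L ψ φ; exact: rwhisk_comp.
Defined.

Definition is_pointwise_nfold_pullback (X Y : K) (n : nat) (A B L : Hom1 X Y)
    (f : A ~> B) (pr : 'I_n -> L ~> A) : Prop :=
  is_nfold_pullback f pr /\
  forall (X' : K) (F : Hom1 X' X),
    is_nfold_pullback (fmap (precomp Y F) f) (fun i => fmap (precomp Y F) (pr i)).

Definition is_pointwise_pullback (X Y : K) (L A B D : Hom1 X Y)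
    (a : L ~> A) (b : L ~> B) (f : A ~> D) (g : B ~> D) : Prop :=
  is_pullback a b f g /\
  forall (X' : K) (F : Hom1 X' X),
    is_pullback (fmap (precomp Y F) a) (fmap (precomp Y F) b)
                (fmap (precomp Y F) f) (fmap (precomp Y F) g).

Fixpoint iter1 (X : K) (T : Hom1 X X) (m : nat) : Hom1 X X :=
  if m is m'.+1 then T ⊚ iter1 T m' else id1 X.

(** Whiskerings of 2-morphisms whose source or target is an identity or a
    composite, with the equal 1-morphisms [F ⊚ id1 _], [id1 _ ⊚ F] and [F]
    (resp. [(H ⊚ G) ⊚ F] and [H ⊚ (G ⊚ F)]) identified. *)
Definition lw_to_id (X Y : K) (F : Hom1 X Y) (G : Hom1 X X) (φ : G ~> id1 X) :
  F ⊚ G ~> F := eq_hom (comp1_idr F) ∘ (F ◃ φ).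
Definition lw_of_id (X Y : K) (F : Hom1 X Y) (G : Hom1 X X) (φ : id1 X ~> G) :
  F ~> F ⊚ G := (F ◃ φ) ∘ eq_hom (esym (comp1_idr F)).
Definition rw_to_id (X Y : K) (G : Hom1 Y Y) (φ : G ~> id1 Y) (F : Hom1 X Y) :
  G ⊚ F ~> F := eq_hom (comp1_idl F) ∘ (φ ▹ F).
Definition rw_of_id (X Y : K) (G : Hom1 Y Y) (φ : id1 Y ~> G) (F : Hom1 X Y) :
  F ~> G ⊚ F := (φ ▹ F) ∘ eq_hom (esym (comp1_idl F)).
Definition rw_to_comp (X Y Y' Z : K) (G : Hom1 Y Z) (H : Hom1 Y' Z)
    (L : Hom1 Y Y') (φ : G ~> H ⊚ L) (F : Hom1 X Y) : G ⊚ F ~> H ⊚ L ⊚ F :=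
  eq_hom (comp1A H L F) ∘ (φ ▹ F).
Definition rw_of_comp (X Y Y' Z : K) (G : Hom1 Y Z) (H : Hom1 Y' Z)
    (L : Hom1 Y Y') (φ : H ⊚ L ~> G) (F : Hom1 X Y) : H ⊚ L ⊚ F ~> G ⊚ F :=
  (φ ▹ F) ∘ eq_hom (esym (comp1A H L F)).
Definition rw_comp (X Y Y' Y'' Z : K) (H : Hom1 Y' Z) (L : Hom1 Y Y')
    (H' : Hom1 Y'' Z) (L' : Hom1 Y Y'') (φ : H ⊚ L ~> H' ⊚ L')
    (F : Hom1 X Y) : H ⊚ L ⊚ F ~> H' ⊚ L' ⊚ F :=
  eq_hom (comp1A H' L' F) ∘ (φ ▹ F) ∘ eq_hom (esym (comp1A H L F)).

Lemma lwhisk_eq_hom (X Y Z : K) (H : Hom1 Y Z) (F G : Hom1 X Y) (e : F = G) :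
  H ◃ eq_hom e = eq_hom (f_equal (comp1 H) e).
Proof. exact: (fmap_eq_hom (postcomp X H)). Qed.

Lemma rwhisk_eq_hom (X Y Z : K) (F G : Hom1 Y Z) (H : Hom1 X Y) (e : F = G) :
  eq_hom e ▹ H = eq_hom (f_equal (fun L => comp1 L H) e).
Proof. exact: (fmap_eq_hom (precomp Z H)). Qed.

Lemma lwhisk_comp1E (X Y Z W : K) (H : Hom1 Z W) (G : Hom1 Y Z)
  (F F' : Hom1 X Y) (φ : F ~> F') : (H ⊚ G) ◃ φ =
  eq_hom (esym (comp1A H G F')) ∘ ((H ◃ (G ◃ φ)) ∘ eq_hom (comp1A H G F)).
Proof. by apply: heq_conj; exact: lwhisk_comp1. Qed.

Lemma rwhisk_comp1E (X Y Z W : K) (H H' : Hom1 Z W) (G : Hom1 Y Z)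
  (F : Hom1 X Y) (φ : H ~> H') : (φ ▹ G) ▹ F =
  eq_hom (esym (comp1A H' G F)) ∘ ((φ ▹ (G ⊚ F)) ∘ eq_hom (comp1A H G F)).
Proof. by apply: heq_conj; exact: rwhisk_comp1. Qed.

Lemma lrwhiskE (X Y Z W : K) (H : Hom1 Z W) (G G' : Hom1 Y Z) (F : Hom1 X Y)
  (φ : G ~> G') : (H ◃ φ) ▹ F =
  eq_hom (esym (comp1A H G' F)) ∘ ((H ◃ (φ ▹ F)) ∘ eq_hom (comp1A H G F)).
Proof. by apply: heq_conj; exact: lrwhisk. Qed.

Lemma lwhisk_id1E (X Y : K) (F G : Hom1 X Y) (φ : F ~> G) : id1 Y ◃ φ =
  eq_hom (esym (comp1_idl G)) ∘ (φ ∘ eq_hom (comp1_idl F)).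
Proof. by apply: heq_conj; exact: lwhisk_id1. Qed.

End TwoCategoryTheory.

Ltac two_cell_norm :=
  rewrite /lw_to_id /lw_of_id /rw_to_id /rw_of_id /rw_to_comp /rw_of_comp
    /rw_comp;
  repeat progress rewrite ?lwhisk_comp ?rwhisk_comp ?lwhisk_id ?rwhisk_id
    ?lwhisk_eq_hom ?rwhisk_eq_hom ?lwhisk_comp1E ?rwhisk_comp1E ?lrwhiskE;
  repeat progress rewrite -?compA ?eq_hom_comp ?eq_hom_comp3 ?eq_hom_id
    ?comp_idl ?comp_idr.

(** Proves an equation between composites of 2-morphisms which only differ by
    the identifications of equal 1-morphisms. *)
Ltac two_cell_coh :=
  two_cell_norm;
  repeat first [reflexivity | exact: eq_homK | apply: f_equal2].

Record TangentStructure (K : TwoCategory) (X : K) := {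
  tT : Hom1 X X;
  tp : tT ~> id1 X;
  tz : id1 X ~> tT;
  (* [tn n] is the [n]-fold pullback of [tp] along itself, for [n >= 1]; the
     value at [n = 0] is unconstrained. *)
  tn : nat -> Hom1 X X;
  tπ : forall n, 'I_n -> tn n ~> tT;
  ts : tn 2 ~> tT;
  tl : tT ~> tT ⊚ tT;
  tc : tT ⊚ tT ~> tT ⊚ tT;

  tn_pullback : forall n, 0 < n -> is_pointwise_nfold_pullback tp (tπ (n := n));
  tn_preserved : forall n m, 0 < n ->
    is_nfold_pullback (fmap (postcomp X (iter1 tT m)) tp)
      (fun i : 'I_n => fmap (postcomp X (iter1 tT m)) (tπ i));

  tpz : tp ∘ tz = idm (id1 X);
  tps : tp ∘ ts = tp ∘ tπ (@Ordinal 2 0 isT);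
  (* Here and below, an equation involving a pairing [⟨f, g⟩] is stated for
     every 2-morphism [u] with [π_1 ∘ u = f] and [π_2 ∘ u = g]; such a [u]
     exists and is unique by [tn_pullback] and [tn_preserved]. *)
  tsA : forall u12 u23 v w : tn 3 ~> tn 2,
    tπ (@Ordinal 2 0 isT) ∘ u12 = tπ (@Ordinal 3 0 isT) ->
    tπ (@Ordinal 2 1 isT) ∘ u12 = tπ (@Ordinal 3 1 isT) ->
    tπ (@Ordinal 2 0 isT) ∘ u23 = tπ (@Ordinal 3 1 isT) ->
    tπ (@Ordinal 2 1 isT) ∘ u23 = tπ (@Ordinal 3 2 isT) ->
    tπ (@Ordinal 2 0 isT) ∘ v = ts ∘ u12 ->
    tπ (@Ordinal 2 1 isT) ∘ v = tπ (@Ordinal 3 2 isT) ->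
    tπ (@Ordinal 2 0 isT) ∘ w = tπ (@Ordinal 3 0 isT) ->
    tπ (@Ordinal 2 1 isT) ∘ w = ts ∘ u23 ->
    ts ∘ v = ts ∘ w;
  tsC : forall u : tn 2 ~> tn 2,
    tπ (@Ordinal 2 0 isT) ∘ u = tπ (@Ordinal 2 1 isT) ->
    tπ (@Ordinal 2 1 isT) ∘ u = tπ (@Ordinal 2 0 isT) ->
    ts ∘ u = ts;
  tsz : forall u : tT ~> tn 2,
    tπ (@Ordinal 2 0 isT) ∘ u = tz ∘ tp ->
    tπ (@Ordinal 2 1 isT) ∘ u = idm tT ->
    ts ∘ u = idm tT;

  tpl : lw_to_id tT tp ∘ tl = tz ∘ tp;
  tlz : tl ∘ tz = lw_of_id tT tz ∘ tz;
  tls : forall u : tn 2 ~> tT ⊚ tn 2,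
    (forall i, (tT ◃ tπ i) ∘ u = tl ∘ tπ i) ->
    tl ∘ ts = (tT ◃ ts) ∘ u;

  tpc : rw_to_id tp tT ∘ tc = lw_to_id tT tp;
  tcz : tc ∘ lw_of_id tT tz = rw_of_id tz tT;
  tcs : forall u : tT ⊚ tn 2 ~> tn 2 ⊚ tT,
    (forall i, (tπ i ▹ tT) ∘ u = tc ∘ (tT ◃ tπ i)) ->
    tc ∘ (tT ◃ ts) = (ts ▹ tT) ∘ u;

  tll : (tT ◃ tl) ∘ tl = rw_to_comp tl tT ∘ tl;
  tcl : tc ∘ tl = tl;
  tccl : rw_comp tc tT ∘ (tT ◃ tc) ∘ rw_to_comp tl tT = (tT ◃ tl) ∘ tc;
  tcc : tc ∘ tc = idm (tT ⊚ tT);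
  tccc : (tT ◃ tc) ∘ rw_comp tc tT ∘ (tT ◃ tc)
         = rw_comp tc tT ∘ (tT ◃ tc) ∘ rw_comp tc tT;

  tlift : forall u : tn 2 ~> tT ⊚ tn 2,
    (tT ◃ tπ (@Ordinal 2 0 isT)) ∘ u = tl ∘ tπ (@Ordinal 2 0 isT) ->
    (tT ◃ tπ (@Ordinal 2 1 isT)) ∘ u
      = rw_of_id tz tT ∘ tπ (@Ordinal 2 1 isT) ->
    is_pointwise_pullback ((tT ◃ ts) ∘ u) (tp ∘ tπ (@Ordinal 2 0 isT))
      (lw_to_id tT tp) tz
}.

Record Tangentad (K : TwoCategory) := {
  td_ob :> K;
  td_str : TangentStructure td_ob
}.

Notation T_ A := (tT (td_str A)).
Notation p_ A := (tp (td_str A)).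
Notation z_ A := (tz (td_str A)).
Notation s_ A := (ts (td_str A)).
Notation l_ A := (tl (td_str A)).
Notation c_ A := (tc (td_str A)).

Section TangentMorphisms.
Variable K : TwoCategory.
Implicit Types A B C D : Tangentad K.

(** [T'α ∘ α_T : F ∘ T² ⇒ T'² ∘ F] *)
Definition twice_cell (X Y : K) (T : Hom1 X X) (T' : Hom1 Y Y) (F : Hom1 X Y)
    (α : F ⊚ T ~> T' ⊚ F) : F ⊚ T ⊚ T ~> T' ⊚ T' ⊚ F :=
  (T' ◃ α) ∘ rw_comp α T.

Record LaxMor A B := {
  lm :> Hom1 A B;
  lm_cell : lm ⊚ T_ A ~> T_ B ⊚ lm;
  lm_p : rw_to_id (p_ B) lm ∘ lm_cell = lw_to_id lm (p_ A);
  lm_z : lm_cell ∘ lw_of_id lm (z_ A) = rw_of_id (z_ B) lm;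
  lm_s : forall u : lm ⊚ tn (td_str A) 2 ~> tn (td_str B) 2 ⊚ lm,
    (forall i, (tπ (td_str B) i ▹ lm) ∘ u
               = lm_cell ∘ (lm ◃ tπ (td_str A) i)) ->
    lm_cell ∘ (lm ◃ s_ A) = (s_ B ▹ lm) ∘ u;
  lm_l : rw_to_comp (l_ B) lm ∘ lm_cell
         = twice_cell lm_cell ∘ (lm ◃ l_ A);
  lm_c : rw_comp (c_ B) lm ∘ twice_cell lm_cell
         = twice_cell lm_cell ∘ (lm ◃ c_ A)
}.

Definition is_strict A B (F : LaxMor A B) : Prop :=
  exists e : F ⊚ T_ A = T_ B ⊚ F, lm_cell F = eq_hom e.

Record TanHom A B (F G : LaxMor A B) := {
  th :> (F : Hom1 A B) ~> G;
  thP : (T_ B ◃ th) ∘ lm_cell F = lm_cell G ∘ (th ▹ T_ A)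
}.

Lemma tanhom_eq A B (F G : LaxMor A B) (φ ψ : TanHom F G) :
  th φ = th ψ -> φ = ψ.
Proof.
case: φ ψ => [φ Hφ] [ψ Hψ] /= e.
by subst ψ; rewrite (proof_irrelevance _ Hφ Hψ).
Qed.

Definition tanhom_id A B (F : LaxMor A B) : TanHom F F.
Proof.
refine {| th := idm (F : Hom1 A B) |}.
by rewrite lwhisk_id rwhisk_id comp_idl comp_idr.
Defined.

Definition tanhom_comp A B (F G H : LaxMor A B) (ψ : TanHom G H)
  (φ : TanHom F G) : TanHom F H.
Proof.
refine {| th := th ψ ∘ th φ |}.
by rewrite lwhisk_comp rwhisk_comp -compA thP compA thP compA.
Defined.

(** The hom-category of the 2-category of tangentads. *)
Definition TngHom A B : Category.
Proof.
refine {| Ob := LaxMor A B; Hom := @TanHom A B; idm := @tanhom_id A B;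
          comp := @tanhom_comp A B |}.
- by move=> F G φ; apply: tanhom_eq; exact: comp_idl.
- by move=> F G φ; apply: tanhom_eq; exact: comp_idr.
- by move=> F G H L χ ψ φ; apply: tanhom_eq; exact: compA.
Defined.


(** The pairing occurring in [lm_s] exists. *)
Lemma lm_pair A B (F : LaxMor A B) :
  exists u : F ⊚ tn (td_str A) 2 ~> tn (td_str B) 2 ⊚ F,
    forall i, (tπ (td_str B) i ▹ F) ∘ u = lm_cell F ∘ (F ◃ tπ (td_str A) i).
Proof.
have [_ /(_ _ (F : Hom1 A B)) [_ /= H]] := @tn_pullback _ _ (td_str B) 2 isT.
have [] := H _ (fun i => lm_cell F ∘ (F ◃ tπ (td_str A) i)).
  move=> i j.
  have E k : (p_ B ▹ F) ∘ (lm_cell F ∘ (F ◃ tπ (td_str A) k))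
    = eq_hom (esym (comp1_idl _)) ∘ (eq_hom (comp1_idr _)
      ∘ (F ◃ (p_ A ∘ tπ (td_str A) k))).
    transitivity (eq_hom (esym (comp1_idl F)) ∘
      ((rw_to_id (p_ B) F ∘ lm_cell F) ∘ (F ◃ tπ (td_str A) k))).
      by two_cell_coh.
    by rewrite lm_p; two_cell_coh.
  have [[e _] _] := @tn_pullback _ _ (td_str A) 2 isT.
  by rewrite !E (e i j).
by move=> u [Hu _]; exists u.
Qed.

(** [β_F ∘ Gα] *)
Definition comp_cell (X Y Z : K) (T : Hom1 X X) (T' : Hom1 Y Y)
    (T'' : Hom1 Z Z) (G : Hom1 Y Z) (β : G ⊚ T' ~> T'' ⊚ G) (F : Hom1 X Y)
    (α : F ⊚ T ~> T' ⊚ F) : (G ⊚ F) ⊚ T ~> T'' ⊚ G ⊚ F :=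
  rw_comp β F ∘ (G ◃ α) ∘ eq_hom (comp1A G F T).

Lemma twice_comp_cell (X Y Z : K) (T : Hom1 X X) (T' : Hom1 Y Y)
    (T'' : Hom1 Z Z) (G : Hom1 Y Z) (β : G ⊚ T' ~> T'' ⊚ G) (F : Hom1 X Y)
    (α : F ⊚ T ~> T' ⊚ F) :
  twice_cell (comp_cell β α)
  = eq_hom (f_equal (comp1 T'') (comp1A T'' G F))
    ∘ (eq_hom (comp1A T'' (T'' ⊚ G) F) ∘ ((twice_cell β ▹ F)
    ∘ (eq_hom (esym (comp1A G (T' ⊚ T') F))
    ∘ (eq_hom (f_equal (comp1 G) (esym (comp1A T' T' F)))
    ∘ ((G ◃ twice_cell α) ∘ eq_hom (comp1A G F (T ⊚ T))))))).
Proof.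
rewrite /twice_cell /comp_cell.
transitivity ((T'' ◃ rw_comp β F) ∘ eq_hom (comp1A T'' G (T' ⊚ F))
  ∘ (((T'' ⊚ G) ◃ α) ∘ (β ▹ (F ⊚ T))) ∘ eq_hom (esym (comp1A G T' (F ⊚ T)))
  ∘ (G ◃ rw_comp α T) ∘ eq_hom (comp1A G F (T ⊚ T))).
  by two_cell_coh.
by rewrite interchange; two_cell_coh.
Qed.

Section LaxComp.
Variables (A B C : Tangentad K) (G : LaxMor B C) (F : LaxMor A B).

Lemma comp_cell_p : rw_to_id (p_ C) (G ⊚ F) ∘ comp_cell (lm_cell G) (lm_cell F)
  = lw_to_id (G ⊚ F) (p_ A).
Proof.
transitivity (
   ((rw_to_id (p_ C) G ∘ lm_cell G) ▹ F) ∘ eq_hom (esym (comp1A _ _ _))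
   ∘ (G ◃ lm_cell F) ∘ eq_hom (comp1A G F (T_ A))).
  by rewrite /comp_cell; two_cell_coh.
rewrite lm_p.
transitivity ((G ◃ (rw_to_id (p_ B) F ∘ lm_cell F)) ∘
   eq_hom (comp1A G F (T_ A))); first by two_cell_coh.
by rewrite lm_p; two_cell_coh.
Qed.

Lemma comp_cell_z : comp_cell (lm_cell G) (lm_cell F) ∘ lw_of_id (G ⊚ F) (z_ A)
  = rw_of_id (z_ C) (G ⊚ F).
Proof.
transitivity (rw_comp (lm_cell G) F ∘
   (G ◃ (lm_cell F ∘ lw_of_id F (z_ A)))).
  by rewrite /comp_cell; two_cell_coh.
rewrite lm_z.
transitivity (eq_hom (comp1A _ _ _) ∘
   ((lm_cell G ∘ lw_of_id G (z_ B)) ▹ F)); first by two_cell_coh.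
by rewrite lm_z; two_cell_coh.
Qed.

Lemma comp_cell_s : forall u : (G ⊚ F) ⊚ tn (td_str A) 2 ~> tn (td_str C) 2 ⊚ G ⊚ F,
    (forall i, (tπ (td_str C) i ▹ (G ⊚ F)) ∘ u
       = comp_cell (lm_cell G) (lm_cell F) ∘ ((G ⊚ F) ◃ tπ (td_str A) i)) ->
  comp_cell (lm_cell G) (lm_cell F) ∘ ((G ⊚ F) ◃ s_ A)
  = (s_ C ▹ (G ⊚ F)) ∘ u.
Proof.
move=> u Hu.
have [uF HF] := lm_pair F; have [uG HG] := lm_pair G.
have {Hu} -> : u = eq_hom (comp1A _ _ _) ∘ (uG ▹ F) ∘ eq_hom (esym (comp1A _ _ _))
   ∘ (G ◃ uF) ∘ eq_hom (comp1A G F _).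
  have [_ /(_ _ ((G : Hom1 B C) ⊚ (F : Hom1 A B))) [E /= H]] :=
    @tn_pullback _ _ (td_str C) 2 isT.
  have [|h [_ Hh]] := H _ (fun i => (tπ (td_str C) i ▹ (G ⊚ F)) ∘ u).
    by move=> i j; rewrite !compA (E i j).
  rewrite -(Hh u) //; apply: Hh => i; rewrite Hu.
  transitivity (eq_hom (comp1A _ _ _) ∘ (((tπ (td_str C) i ▹ G) ∘ uG) ▹ F)
    ∘ eq_hom (esym (comp1A _ _ _)) ∘ (G ◃ uF) ∘ eq_hom (comp1A G F _)).
    by two_cell_coh.
  rewrite HG.
  transitivity (eq_hom (comp1A _ _ _) ∘ (lm_cell G ▹ F)
    ∘ eq_hom (esym (comp1A _ _ _)) ∘ (G ◃ ((tπ (td_str B) i ▹ F) ∘ uF))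
    ∘ eq_hom (comp1A G F _)).
    by two_cell_coh.
  by rewrite HF /comp_cell; two_cell_coh.
transitivity (rw_comp (lm_cell G) F ∘ (G ◃ (lm_cell F ∘ (F ◃ s_ A)))
  ∘ eq_hom (comp1A G F _)); first by rewrite /comp_cell; two_cell_coh.
rewrite (lm_s HF).
transitivity (eq_hom (comp1A _ _ _) ∘ ((lm_cell G ∘ (G ◃ s_ B)) ▹ F)
  ∘ eq_hom (esym (comp1A _ _ _)) ∘ (G ◃ uF) ∘ eq_hom (comp1A G F _)).
  by two_cell_coh.
by rewrite (lm_s HG); two_cell_coh.
Qed.

Lemma comp_cell_l : rw_to_comp (l_ C) (G ⊚ F) ∘ comp_cell (lm_cell G) (lm_cell F)
  = twice_cell (comp_cell (lm_cell G) (lm_cell F)) ∘ ((G ⊚ F) ◃ l_ A).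
Proof.
rewrite twice_comp_cell.
transitivity (eq_hom (f_equal (comp1 (T_ C)) (comp1A _ _ _))
  ∘ eq_hom (comp1A _ _ _) ∘ ((rw_to_comp (l_ C) G ∘ lm_cell G) ▹ F)
  ∘ eq_hom (esym (comp1A _ _ _)) ∘ (G ◃ lm_cell F) ∘ eq_hom (comp1A G F _)).
  by rewrite /comp_cell; two_cell_coh.
rewrite lm_l.
transitivity (eq_hom (f_equal (comp1 (T_ C)) (comp1A _ _ _))
  ∘ eq_hom (comp1A _ _ _) ∘ (twice_cell (lm_cell G) ▹ F)
  ∘ eq_hom (esym (comp1A G (T_ B ⊚ T_ B) F))
  ∘ eq_hom (f_equal (comp1 (G : Hom1 B C)) (esym (comp1A (T_ B) (T_ B) F)))
  ∘ (G ◃ (rw_to_comp (l_ B) F ∘ lm_cell F)) ∘ eq_hom (comp1A G F _)).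
  by two_cell_coh.
by rewrite lm_l; two_cell_coh.
Qed.

Lemma comp_cell_c : rw_comp (c_ C) (G ⊚ F) ∘ twice_cell (comp_cell (lm_cell G) (lm_cell F))
  = twice_cell (comp_cell (lm_cell G) (lm_cell F)) ∘ ((G ⊚ F) ◃ c_ A).
Proof.
rewrite twice_comp_cell.
transitivity (eq_hom (f_equal (comp1 (T_ C)) (comp1A _ _ _))
  ∘ eq_hom (comp1A _ _ _) ∘ ((rw_comp (c_ C) G ∘ twice_cell (lm_cell G)) ▹ F)
  ∘ eq_hom (esym (comp1A G (T_ B ⊚ T_ B) F))
  ∘ eq_hom (f_equal (comp1 (G : Hom1 B C)) (esym (comp1A (T_ B) (T_ B) F)))
  ∘ (G ◃ twice_cell (lm_cell F)) ∘ eq_hom (comp1A G F _)).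
  by two_cell_coh.
rewrite lm_c.
transitivity (eq_hom (f_equal (comp1 (T_ C)) (comp1A _ _ _))
  ∘ eq_hom (comp1A _ _ _) ∘ (twice_cell (lm_cell G) ▹ F)
  ∘ eq_hom (esym (comp1A G (T_ B ⊚ T_ B) F))
  ∘ eq_hom (f_equal (comp1 (G : Hom1 B C)) (esym (comp1A (T_ B) (T_ B) F)))
  ∘ (G ◃ (rw_comp (c_ B) F ∘ twice_cell (lm_cell F)))
  ∘ eq_hom (comp1A G F _)).
  by two_cell_coh.
by rewrite lm_c; two_cell_coh.
Qed.

Definition lax_comp : LaxMor A C :=
  {| lm := (G : Hom1 B C) ⊚ (F : Hom1 A B);
     lm_cell := comp_cell (lm_cell G) (lm_cell F);
     lm_p := comp_cell_p; lm_z := comp_cell_z; lm_s := comp_cell_s;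
     lm_l := comp_cell_l; lm_c := comp_cell_c |}.
End LaxComp.


Lemma lax_T_l A : rw_to_comp (l_ A) (T_ A) ∘ c_ A = twice_cell (c_ A) ∘ (T_ A ◃ l_ A).
Proof.
have cTT : rw_comp (c_ A) (T_ A) ∘ rw_comp (c_ A) (T_ A) = idm _.
  transitivity (eq_hom (comp1A _ _ _) ∘ ((c_ A ∘ c_ A) ▹ T_ A)
    ∘ eq_hom (esym (comp1A _ _ _))); first by two_cell_coh.
  by rewrite tcc; two_cell_coh.
have TcTc : (T_ A ◃ c_ A) ∘ (T_ A ◃ c_ A) = idm _.
  by rewrite -lwhisk_comp tcc lwhisk_id.
have -> : rw_to_comp (l_ A) (T_ A)
    = (T_ A ◃ c_ A) ∘ rw_comp (c_ A) (T_ A) ∘ ((T_ A ◃ l_ A) ∘ c_ A).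
  rewrite -tccl; move: (rw_comp _ _) (rw_to_comp _ _) cTT => x y xx.
  by rewrite !compA -(compA _ x x) xx comp_idr TcTc comp_idl.
by rewrite /twice_cell -!compA tcc comp_idr.
Qed.

Lemma lax_T_c A :
  rw_comp (c_ A) (T_ A) ∘ twice_cell (c_ A) = twice_cell (c_ A) ∘ (T_ A ◃ c_ A).
Proof. by rewrite /twice_cell tccc; exact: compA. Qed.

(** [(T, c)] *)
Definition lax_T A : LaxMor A A :=
  {| lm := T_ A; lm_cell := c_ A; lm_p := tpc (td_str A);
     lm_z := tcz (td_str A); lm_s := tcs (t := td_str A); lm_l := lax_T_l A;
     lm_c := lax_T_c A |}.

Definition tanhom_lwhisk A B C (H : LaxMor B C) (F G : LaxMor A B)
  (φ : TanHom F G) : TanHom (lax_comp H F) (lax_comp H G).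
Proof.
refine {| th := (H : Hom1 B C) ◃ th φ
          : (lax_comp H F : Hom1 A C) ~> lax_comp H G |}.
rewrite /= /comp_cell.
transitivity (eq_hom (comp1A (T_ C) H G) ∘ (((T_ C ⊚ H) ◃ th φ)
  ∘ (lm_cell H ▹ F)) ∘ eq_hom (esym (comp1A _ _ _)) ∘ (H ◃ lm_cell F)
  ∘ eq_hom (comp1A H F (T_ A))); first by two_cell_coh.
rewrite interchange.
transitivity (rw_comp (lm_cell H) G
  ∘ (H ◃ ((T_ B ◃ th φ) ∘ lm_cell F)) ∘ eq_hom (comp1A H F (T_ A))).
  by two_cell_coh.
by rewrite thP; two_cell_coh.
Defined.

Definition tanhom_rwhisk A B C (F G : LaxMor B C) (φ : TanHom F G)
  (H : LaxMor A B) : TanHom (lax_comp F H) (lax_comp G H).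
Proof.
refine {| th := th φ ▹ (H : Hom1 A B)
          : (lax_comp F H : Hom1 A C) ~> lax_comp G H |}.
rewrite /= /comp_cell.
transitivity (eq_hom (comp1A _ _ _) ∘ (((T_ C ◃ th φ) ∘ lm_cell F) ▹ H)
  ∘ eq_hom (esym (comp1A _ _ _)) ∘ (F ◃ lm_cell H)
  ∘ eq_hom (comp1A F H (T_ A))); first by two_cell_coh.
rewrite thP.
transitivity (rw_comp (lm_cell G) H ∘ ((th φ ▹ (T_ B ⊚ H)) ∘ (F ◃ lm_cell H))
  ∘ eq_hom (comp1A F H (T_ A))); first by two_cell_coh.
by rewrite -interchange; two_cell_coh.
Defined.

Definition tanhom_assoc A B C D (H : LaxMor C D) (G : LaxMor B C)
  (F : LaxMor A B) :
  TanHom (lax_comp (lax_comp H G) F) (lax_comp H (lax_comp G F)).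
Proof.
refine {| th := eq_hom (comp1A (H : Hom1 C D) G F)
  : (lax_comp (lax_comp H G) F : Hom1 A D) ~> lax_comp H (lax_comp G F) |}.
by rewrite /= /comp_cell; two_cell_coh.
Defined.
End TangentMorphisms.

(** The part of a tangent category on which its vector fields, their morphisms
    and their tangent bundle functor [(M, v) ↦ (TM, c_M ∘ Tv)] depend. *)
Record BundleCategory := {
  bcat :> Category;
  bT : Functor bcat bcat;
  bp : NatTrans bT (fid bcat);
  bc : NatTrans (fcomp bT bT) (fcomp bT bT);
  bpc : forall M, bp (bT M) ∘ bc M = fmap bT (bp M)
}.

Section HomTangent.
Variable K : TwoCategory.
Variables A B : Tangentad K.

Definition hom_T : Functor (TngHom A B) (TngHom A B).
Proof.
refine {| fob := fun F : TngHom A B => lax_comp (lax_T B) F : TngHom A B;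
          fmap := fun F G φ => tanhom_lwhisk (lax_T B) φ |}.
- by move=> F; apply: tanhom_eq; exact: lwhisk_id.
- by move=> F G H ψ φ; apply: tanhom_eq; exact: lwhisk_comp.
Defined.

Definition tanhom_p (F : LaxMor A B) : TanHom (lax_comp (lax_T B) F) F.
Proof.
refine {| th := rw_to_id (p_ B) F : lm (lax_comp (lax_T B) F) ~> lm F |}.
rewrite /= /comp_cell.
have Tpc : lw_to_id (T_ B) (p_ B) ∘ c_ B = rw_to_id (p_ B) (T_ B).
  by rewrite -tpc -compA tcc comp_idr.
transitivity (((lw_to_id (T_ B) (p_ B) ∘ c_ B) ▹ F)
  ∘ eq_hom (esym (comp1A _ _ _)) ∘ (T_ B ◃ lm_cell F)
  ∘ eq_hom (comp1A (T_ B) F (T_ A))); first by two_cell_coh.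
rewrite Tpc.
transitivity (eq_hom (comp1_idl _) ∘ ((p_ B ▹ (T_ B ⊚ F))
  ∘ (T_ B ◃ lm_cell F)) ∘ eq_hom (comp1A (T_ B) F (T_ A))).
  by two_cell_coh.
rewrite -interchange lwhisk_id1E.
by two_cell_coh.
Defined.

Definition tanhom_c (F : LaxMor A B) :
  TanHom (lax_comp (lax_T B) (lax_comp (lax_T B) F))
         (lax_comp (lax_T B) (lax_comp (lax_T B) F)).
Proof.
refine {| th := rw_comp (c_ B) F
  : lm (lax_comp (lax_T B) (lax_comp (lax_T B) F))
    ~> lm (lax_comp (lax_T B) (lax_comp (lax_T B) F)) |}.
rewrite /= /comp_cell /=.
transitivity (eq_hom (f_equal (comp1 (T_ B)) (comp1A _ _ _))
  ∘ eq_hom (comp1A _ _ _)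
  ∘ (((T_ B ◃ c_ B) ∘ rw_comp (c_ B) (T_ B) ∘ (T_ B ◃ c_ B)) ▹ F)
  ∘ eq_hom (esym (comp1A (T_ B) (T_ B ⊚ T_ B) F))
  ∘ eq_hom (f_equal (comp1 (T_ B)) (esym (comp1A (T_ B) (T_ B) F)))
  ∘ (T_ B ◃ (T_ B ◃ lm_cell F))
  ∘ eq_hom (f_equal (comp1 (T_ B)) (comp1A (T_ B) F (T_ A)))
  ∘ eq_hom (comp1A (T_ B) (T_ B ⊚ F) (T_ A))).
  by two_cell_coh.
rewrite tccc.
transitivity (eq_hom (f_equal (comp1 (T_ B)) (comp1A _ _ _))
  ∘ eq_hom (comp1A _ _ _)
  ∘ ((rw_comp (c_ B) (T_ B) ∘ (T_ B ◃ c_ B)) ▹ F)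
  ∘ eq_hom (esym (comp1A (T_ B) (T_ B ⊚ T_ B) F))
  ∘ eq_hom (f_equal (comp1 (T_ B)) (esym (comp1A (T_ B) (T_ B) F)))
  ∘ eq_hom (comp1A (T_ B) (T_ B) (T_ B ⊚ F))
  ∘ ((c_ B ▹ (T_ B ⊚ F)) ∘ ((T_ B ⊚ T_ B) ◃ lm_cell F))
  ∘ eq_hom (esym (comp1A (T_ B) (T_ B) (F ⊚ T_ A)))
  ∘ eq_hom (f_equal (comp1 (T_ B)) (comp1A (T_ B) F (T_ A)))
  ∘ eq_hom (comp1A (T_ B) (T_ B ⊚ F) (T_ A))).
  by two_cell_coh.
rewrite -interchange.
by two_cell_coh.
Defined.

Definition hom_p : NatTrans hom_T (fid (TngHom A B)).
Proof.
refine {| nt := fun F : TngHom A B => tanhom_p F : hom_T F ~> fid _ F |}.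
move=> F G φ; apply: tanhom_eq; rewrite /= /rw_to_id.
transitivity (eq_hom (comp1_idl _) ∘ ((id1 B ◃ th φ) ∘ (p_ B ▹ F))).
  by rewrite lwhisk_id1E; two_cell_coh.
by rewrite interchange; two_cell_coh.
Defined.

Definition hom_c : NatTrans (fcomp hom_T hom_T) (fcomp hom_T hom_T).
Proof.
refine {| nt := fun F : TngHom A B =>
  tanhom_c F : fcomp hom_T hom_T F ~> fcomp hom_T hom_T F |}.
move=> F G φ; apply: tanhom_eq => /=.
transitivity (eq_hom (comp1A _ _ _) ∘ (((T_ B ⊚ T_ B) ◃ th φ) ∘ (c_ B ▹ F))
  ∘ eq_hom (esym (comp1A _ _ _))); first by two_cell_coh.
by rewrite interchange; two_cell_coh.
Defined.

(** The hom-tangent category [[A | B]]. *)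
Definition HomTan : BundleCategory.
Proof.
refine {| bcat := TngHom A B; bT := hom_T; bp := hom_p; bc := hom_c |}.
move=> F; apply: tanhom_eq => /=.
transitivity ((rw_to_id (p_ B) (T_ B) ∘ c_ B) ▹ F
  ∘ eq_hom (esym (comp1A _ _ _))); first by two_cell_coh.
by rewrite tpc; two_cell_coh.
Defined.
End HomTangent.

Section VectorFields.
Variable Y : BundleCategory.

Record VectorField (M : Y) := {
  vf :> M ~> bT Y M;
  vf_sect : bp Y M ∘ vf = idm M
}.

Record VFOb := { vf_ob : Y; vf_field : VectorField vf_ob }.

Record VFHom (M N : VFOb) := {
  vf_hom :> vf_ob M ~> vf_ob N;
  vf_homP : fmap (bT Y) vf_hom ∘ vf_field M = vf_field N ∘ vf_hom
}.

Lemma vfhom_eq (M N : VFOb) (f g : VFHom M N) : vf_hom f = vf_hom g -> f = g.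
Proof.
case: f g => [f Hf] [g Hg] /= e.
by subst g; rewrite (proof_irrelevance _ Hf Hg).
Qed.

Definition vfhom_id (M : VFOb) : VFHom M M.
Proof.
refine {| vf_hom := idm (vf_ob M) |}.
by rewrite fmap_id comp_idl comp_idr.
Defined.

Definition vfhom_comp (M N P : VFOb) (g : VFHom N P) (f : VFHom M N) :
  VFHom M P.
Proof.
refine {| vf_hom := vf_hom g ∘ vf_hom f |}.
by rewrite fmap_comp -compA vf_homP compA vf_homP compA.
Defined.

Definition VF : Category.
Proof.
refine {| Ob := VFOb; Hom := VFHom; idm := vfhom_id; comp := vfhom_comp |}.
- by move=> M N f; apply: vfhom_eq; exact: comp_idl.
- by move=> M N f; apply: vfhom_eq; exact: comp_idr.
- by move=> M N P Q h g f; apply: vfhom_eq; exact: compA.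
Defined.

Definition VF_forget : Functor VF Y.
Proof. by refine {| fob := vf_ob : VF -> Y; fmap := fun M N f => vf_hom f |}. Defined.

Definition VF_T_ob (M : VF) : VF.
Proof.
refine {| vf_ob := bT Y (vf_ob M);
  vf_field := {| vf := bc Y (vf_ob M) ∘ fmap (bT Y) (vf_field M) |} |}.
by rewrite compA bpc -fmap_comp vf_sect fmap_id.
Defined.

Definition VF_T : Functor VF VF.
Proof.
unshelve refine {| fob := VF_T_ob |}.
- move=> M N f; refine {| vf_hom := fmap (bT Y) (vf_hom f)
                          : vf_ob (VF_T_ob M) ~> vf_ob (VF_T_ob N) |}.
  have /= H := nt_nat (bc Y) (vf_hom f).
  by rewrite /= compA H -!compA -!fmap_comp vf_homP.
- by move=> M; apply: vfhom_eq; exact: fmap_id.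
- by move=> M N P g f; apply: vfhom_eq; exact: fmap_comp.
Defined.
End VectorFields.

Section Construction.
Variable K : TwoCategory.

Section Gamma.
Variables V X : Tangentad K.
Variable U : LaxMor V X.
Variable v : VectorField (Y := HomTan V X) U.

(** [v_H : U ∘ H ⇒ T ∘ (U ∘ H)] *)
Definition vf_restrict (X' : Tangentad K) (H : LaxMor X' V) :
  VectorField (Y := HomTan X' X) (lax_comp U H).
Proof.
refine {| vf := tanhom_comp (tanhom_assoc (lax_T X) U H)
                            (tanhom_rwhisk (vf v : TanHom U (lax_comp (lax_T X) U)) H)
   : (lax_comp U H : HomTan X' X) ~> bT (HomTan X' X) (lax_comp U H) |}.
apply: tanhom_eq => /=.
have := f_equal (@th _ _ _ _ _) (vf_sect v) => /= E.
transitivity ((rw_to_id (p_ X) U ∘ th (vf v)) ▹ H); first by two_cell_coh.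
by rewrite E rwhisk_id.
Defined.

Definition Gamma_ob (X' : Tangentad K) (H : LaxMor X' V) :
    VF (HomTan X' X) :=
  Build_VFOb (Y := HomTan X' X) (vf_restrict H).

Definition Gamma_hom (X' : Tangentad K) (H L : LaxMor X' V)
  (φ : TanHom H L) : VFHom (Gamma_ob H) (Gamma_ob L).
Proof.
refine {| vf_hom := tanhom_lwhisk U φ
  : vf_ob (Gamma_ob H) ~> vf_ob (Gamma_ob L) |}.
apply: tanhom_eq => /=.
transitivity (eq_hom (comp1A _ _ _) ∘ (((T_ X ⊚ U) ◃ th φ)
  ∘ (th (vf v : TanHom U (lax_comp (lax_T X) U)) ▹ H))).
  by two_cell_coh.
by rewrite interchange; two_cell_coh.
Defined.

(** [Γ_v : (H, γ) ↦ (U ∘ (H, γ), v_H)] *)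
Definition Gamma (X' : Tangentad K) :
  Functor (TngHom X' V) (VF (HomTan X' X)).
Proof.
refine {| fob := Gamma_ob (X' := X') : TngHom X' V -> VF (HomTan X' X);
          fmap := fun H L φ => Gamma_hom φ |}.
- by move=> H; apply: vfhom_eq; apply: tanhom_eq; exact: lwhisk_id.
- by move=> H L M ψ φ; apply: vfhom_eq; apply: tanhom_eq; exact: lwhisk_comp.
Defined.

(** [Γ_v] is a strict tangent morphism, so that an inverse of its underlying
    functor is one too: [Γ_v] is invertible as a tangent morphism when it is
    invertible as a functor. *)
Definition is_universal_vector_field : Prop :=
  is_strict U /\ forall X' : Tangentad K, invertible (Gamma X').
End Gamma.

Definition admits_vector_fields (X : Tangentad K) : Prop :=
  exists (V : Tangentad K) (U : LaxMor V X)
    (v : VectorField (Y := HomTan V X) U), is_universal_vector_field v.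
End Construction.

Definition admits_construction_of_vector_fields (K : TwoCategory) : Prop :=
  forall X : Tangentad K, admits_vector_fields X.
Section Cartesian.
Variables (E B : Category) (P : Functor E B).

Definition is_cartesian (x y : E) (φ : x ~> y) : Prop :=
  forall (w : E) (ψ : w ~> y) (g : P w ~> P x), fmap P φ ∘ g = fmap P ψ ->
    exists! χ : w ~> x, fmap P χ = g /\ φ ∘ χ = ψ.

(** [φ : x → y] is a Cartesian lift of [f : a → b]; in particular [P x = a] and
    [P y = b]. *)
Definition is_cartesian_lift (a b : B) (f : a ~> b) (x y : E) (φ : x ~> y) :
    Prop :=
  fmap P φ ≈ f /\ is_cartesian φ.

Record Cleavage := {
  cl_ob : forall (y : E) (a : B), a ~> P y -> E;
  cl_hom : forall (y : E) (a : B) (f : a ~> P y), cl_ob f ~> y;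
  cl_lift : forall (y : E) (a : B) (f : a ~> P y), is_cartesian_lift f (cl_hom f)
}.
End Cartesian.

Record Fibration := {
  ftot : Category;
  fbase : Category;
  fproj : Functor ftot fbase;
  fcleavage : Cleavage fproj
}.

Record FibMor (P Q : Fibration) := {
  fm_base : Functor (fbase P) (fbase Q);
  fm_tot : Functor (ftot P) (ftot Q);
  fm_comm : fcomp (fproj Q) fm_tot = fcomp fm_base (fproj P);
  fm_cart : forall (a b : fbase P) (f : a ~> b) (x y : ftot P) (φ : x ~> y),
    is_cartesian_lift (fproj P) f φ ->
    is_cartesian_lift (fproj Q) (fmap fm_base f) (fmap fm_tot φ)
}.

Record FibCell (P Q : Fibration) (F G : FibMor P Q) := {
  fc_base : NatTrans (fm_base F) (fm_base G);
  fc_tot : NatTrans (fm_tot F) (fm_tot G);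
  fc_comm : forall x : ftot P, fmap (fproj Q) (fc_tot x) ≈ fc_base (fproj P x)
}.

Lemma fibmor_eq (P Q : Fibration) (F G : FibMor P Q) :
  (forall a b (f : a ~> b), fmap (fm_base F) f ≈ fmap (fm_base G) f) ->
  (forall a b (f : a ~> b), fmap (fm_tot F) f ≈ fmap (fm_tot G) f) ->
  F = G.
Proof.
case: F G => [F F' Fc Fl] [G G' Gc Gl] /= /functor_eq e /functor_eq e'.
by subst G G'; rewrite (proof_irrelevance _ Fc Gc) (proof_irrelevance _ Fl Gl).
Qed.

Lemma fibcell_eq (P Q : Fibration) (F G : FibMor P Q) (φ ψ : FibCell F G) :
  (forall a, fc_base φ a = fc_base ψ a) ->
  (forall x, fc_tot φ x = fc_tot ψ x) -> φ = ψ.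
Proof.
case: φ ψ => [φ φ' Hφ] [ψ ψ' Hψ] /= /nat_eq e /nat_eq e'.
by subst ψ ψ'; rewrite (proof_irrelevance _ Hφ Hψ).
Qed.

Definition fibcell_id (P Q : Fibration) (F : FibMor P Q) : FibCell F F.
Proof.
unshelve refine {| fc_base := _; fc_tot := _ |}.
- refine {| nt := fun a => idm (fm_base F a) |}.
  by move=> a b f; rewrite comp_idl comp_idr.
- refine {| nt := fun x => idm (fm_tot F x) |}.
  by move=> a b f; rewrite comp_idl comp_idr.
- move=> x /=; rewrite fmap_id.
  have e : fproj Q (fm_tot F x) = fm_base F (fproj P x)
    := functor_eq_ob x (fm_comm F).
  by rewrite e.
Defined.

Definition nat_comp (C D : Category) (F G H : Functor C D) (t : NatTrans G H)
  (s : NatTrans F G) : NatTrans F H.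
Proof.
refine {| nt := fun a => t a ∘ s a |}.
by move=> a b f; rewrite compA nt_nat -compA nt_nat compA.
Defined.

Definition fibcell_comp (P Q : Fibration) (F G H : FibMor P Q)
  (ψ : FibCell G H) (φ : FibCell F G) : FibCell F H.
Proof.
refine {| fc_base := nat_comp (fc_base ψ) (fc_base φ);
          fc_tot := nat_comp (fc_tot ψ) (fc_tot φ) |}.
by move=> x /=; rewrite fmap_comp; apply: heq_comp; exact: fc_comm.
Defined.

Definition FibHom (P Q : Fibration) : Category.
Proof.
refine {| Ob := FibMor P Q; Hom := @FibCell P Q; idm := @fibcell_id P Q;
          comp := @fibcell_comp P Q |}.
- by move=> F G φ; apply: fibcell_eq => a; exact: comp_idl.
- by move=> F G φ; apply: fibcell_eq => a; exact: comp_idr.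
- by move=> F G H L χ ψ φ; apply: fibcell_eq => a; exact: compA.
Defined.

Definition fib_id (P : Fibration) : FibMor P P.
Proof.
refine {| fm_base := fid (fbase P); fm_tot := fid (ftot P) |}.
- exact: functor_eq.
- by [].
Defined.

Definition fib_comp (P Q R : Fibration) (G : FibMor Q R) (F : FibMor P Q) :
  FibMor P R.
Proof.
refine {| fm_base := fcomp (fm_base G) (fm_base F);
          fm_tot := fcomp (fm_tot G) (fm_tot F) |}.
- apply: functor_eq => a b f.
  apply: heq_trans (functor_eq_heq (fmap (fm_tot F) f) (fm_comm G)) _.
  exact: heq_fmap (functor_eq_heq f (fm_comm F)).
- by move=> a b f x y φ Hφ; apply: fm_cart; exact: fm_cart.
Defined.

Definition nat_lwhisk (C D E : Category) (H : Functor D E) (F G : Functor C D)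
  (s : NatTrans F G) : NatTrans (fcomp H F) (fcomp H G).
Proof.
refine {| nt := fun a => fmap H (s a) : fcomp H F a ~> fcomp H G a |}.
by move=> a b f /=; rewrite -!fmap_comp nt_nat.
Defined.

Definition nat_rwhisk (C D E : Category) (F G : Functor D E) (H : Functor C D)
  (s : NatTrans F G) : NatTrans (fcomp F H) (fcomp G H).
Proof.
refine {| nt := fun a => s (H a) : fcomp F H a ~> fcomp G H a |}.
by move=> a b f /=; rewrite nt_nat.
Defined.

Definition fib_lwhisk (P Q R : Fibration) (H : FibMor Q R) (F G : FibMor P Q)
  (φ : FibCell F G) : FibCell (fib_comp H F) (fib_comp H G).
Proof.
refine {| fc_base := nat_lwhisk (fm_base H) (fc_base φ)
            : NatTrans (fm_base (fib_comp H F)) (fm_base (fib_comp H G));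
          fc_tot := nat_lwhisk (fm_tot H) (fc_tot φ)
            : NatTrans (fm_tot (fib_comp H F)) (fm_tot (fib_comp H G)) |}.
move=> x /=; apply: heq_trans (functor_eq_heq (fc_tot φ x) (fm_comm H)) _.
exact: heq_fmap (fc_comm φ x).
Defined.

Definition fib_rwhisk (P Q R : Fibration) (F G : FibMor Q R) (H : FibMor P Q)
  (φ : FibCell F G) : FibCell (fib_comp F H) (fib_comp G H).
Proof.
refine {| fc_base := nat_rwhisk (fm_base H) (fc_base φ)
            : NatTrans (fm_base (fib_comp F H)) (fm_base (fib_comp G H));
          fc_tot := nat_rwhisk (fm_tot H) (fc_tot φ)
            : NatTrans (fm_tot (fib_comp F H)) (fm_tot (fib_comp G H)) |}.
move=> x /=; apply: heq_trans (fc_comm φ (fm_tot H x)) _.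
have e : fproj Q (fm_tot H x) = fm_base H (fproj P x)
  := functor_eq_ob x (fm_comm H).
by rewrite e.
Defined.

Lemma fibcell_heq (P Q : Fibration) (F G F' G' : FibMor P Q)
  (φ : FibCell F G) (ψ : FibCell F' G') : F = F' -> G = G' ->
  (forall a, fc_base φ a ≈ fc_base ψ a) ->
  (forall x, fc_tot φ x ≈ fc_tot ψ x) ->
  @heq (FibHom P Q) F G φ F' G' ψ.
Proof.
move=> eF eG; subst F' G' => Hb Ht; apply: heq_of_eq.
by apply: fibcell_eq => a; exact: heq_eq.
Qed.

Lemma fib_compA (P Q R S : Fibration) (H : FibMor R S) (G : FibMor Q R)
  (F : FibMor P Q) : fib_comp (fib_comp H G) F = fib_comp H (fib_comp G F).
Proof. exact: fibmor_eq. Qed.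

Lemma fib_idl (P Q : Fibration) (F : FibMor P Q) : fib_comp (fib_id Q) F = F.
Proof. exact: fibmor_eq. Qed.

Lemma fib_idr (P Q : Fibration) (F : FibMor P Q) : fib_comp F (fib_id P) = F.
Proof. exact: fibmor_eq. Qed.

Definition Fib : TwoCategory.
Proof.
refine {| Ob1 := Fibration; Hom1 := FibHom; id1 := fib_id;
  comp1 := fun P Q R (G : FibHom Q R) (F : FibHom P Q) =>
    fib_comp G F : FibHom P R;
  lwhisk := fun P Q R (H : FibHom Q R) (F G : FibHom P Q) (φ : F ~> G) =>
    fib_lwhisk H φ;
  rwhisk := fun P Q R (F G : FibHom Q R) (H : FibHom P Q) (φ : F ~> G) =>
    fib_rwhisk H φ |}.
- by move=> P Q R H F; apply: fibcell_eq => a /=; exact: fmap_id.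
- by move=> P Q R H F G L ψ φ; apply: fibcell_eq => a /=; exact: fmap_comp.
- by move=> P Q R H F; apply: fibcell_eq.
- by move=> P Q R H F G L ψ φ; apply: fibcell_eq.
- by move=> P Q R H L F G ψ φ; apply: fibcell_eq => a /=; exact: nt_nat.
- exact: fib_compA.
- exact: fib_idl.
- exact: fib_idr.
- by move=> *; apply: fibcell_heq => //; exact: fib_compA.
- by move=> *; apply: fibcell_heq => //; exact: fib_compA.
- by move=> *; apply: fibcell_heq => //; exact: fib_compA.
- by move=> *; apply: fibcell_heq => //; exact: fib_idl.
- by move=> *; apply: fibcell_heq => //; exact: fib_idr.
Defined.

Lemma fc_base_eq_hom (Q R : Fibration) (F G : FibMor Q R) (e : F = G)
  (a : fbase Q) : fc_base (@eq_hom (FibHom Q R) F G e) a ≈ idm (fm_base F a).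
Proof. by subst. Qed.

Lemma fc_tot_eq_hom (Q R : Fibration) (F G : FibMor Q R) (e : F = G)
  (x : ftot Q) : fc_tot (@eq_hom (FibHom Q R) F G e) x ≈ idm (fm_tot F x).
Proof. by subst. Qed.

(** A tangentad in [Fib] is a tangent fibration [P : (X', T') → (X, T)]; the
    data of [(X, T)] and [(X', T')] are extracted below. *)
Section VFFib.
Variable P : Tangentad Fib.

Definition tan_fib : Fibration := td_ob P.
Definition tan_fib_T : FibMor tan_fib tan_fib := T_ P.
Definition tan_fib_p : FibCell tan_fib_T (fib_id tan_fib) := p_ P.
Definition tan_fib_c :
  FibCell (fib_comp tan_fib_T tan_fib_T) (fib_comp tan_fib_T tan_fib_T) := c_ P.

Lemma tan_fib_pc :
  fibcell_comp (fibcell_comp (@eq_hom (FibHom _ _) _ _ (fib_idl tan_fib_T))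
    (fib_rwhisk tan_fib_T tan_fib_p)) tan_fib_c
  = fibcell_comp (@eq_hom (FibHom _ _) _ _ (fib_idr tan_fib_T))
      (fib_lwhisk tan_fib_T tan_fib_p).
Proof. exact: (tpc (td_str P)). Qed.

Lemma heq_idl (C : Category) (a b c d : C) (e : b ~> c) (f : a ~> b) :
  e ≈ idm d -> e ∘ f ≈ f.
Proof.
move=> H; have ed := heq_dom H; have ec := heq_cod H; subst d c.
by rewrite (heq_eq H) comp_idl.
Qed.

Definition base_tangent : BundleCategory.
Proof.
refine {| bcat := fbase tan_fib; bT := fm_base tan_fib_T;
  bp := fc_base tan_fib_p : NatTrans (fm_base tan_fib_T) (fid (fbase tan_fib));
  bc := fc_base tan_fib_c :
    NatTrans (fcomp (fm_base tan_fib_T) (fm_base tan_fib_T))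
             (fcomp (fm_base tan_fib_T) (fm_base tan_fib_T)) |}.
move=> a; apply: heq_eq.
have /(f_equal (fun φ : FibCell _ _ => fc_base φ a)) /= := tan_fib_pc.
rewrite -compA => E.
apply: heq_trans (heq_sym (heq_idl _ (fc_base_eq_hom (fib_idl tan_fib_T) a))) _.
apply: heq_trans (heq_of_eq E) _.
exact: heq_idl (fc_base_eq_hom (fib_idr tan_fib_T) a).
Defined.

Definition tot_tangent : BundleCategory.
Proof.
refine {| bcat := ftot tan_fib; bT := fm_tot tan_fib_T;
  bp := fc_tot tan_fib_p : NatTrans (fm_tot tan_fib_T) (fid (ftot tan_fib));
  bc := fc_tot tan_fib_c :
    NatTrans (fcomp (fm_tot tan_fib_T) (fm_tot tan_fib_T))
             (fcomp (fm_tot tan_fib_T) (fm_tot tan_fib_T)) |}.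
move=> x; apply: heq_eq.
have /(f_equal (fun φ : FibCell _ _ => fc_tot φ x)) /= := tan_fib_pc.
rewrite -compA => E.
apply: heq_trans (heq_sym (heq_idl _ (fc_tot_eq_hom (fib_idl tan_fib_T) x))) _.
apply: heq_trans (heq_of_eq E) _.
exact: heq_idl (fc_tot_eq_hom (fib_idr tan_fib_T) x).
Defined.

Lemma tan_fib_comm (E : ftot tan_fib) :
  fproj tan_fib (bT tot_tangent E) = bT base_tangent (fproj tan_fib E).
Proof. exact: functor_eq_ob E (fm_comm tan_fib_T). Qed.

(** [Π(w) : ΠE → ΠT'E = TΠE]. *)
Definition VF_proj_field (E : tot_tangent) (w : VectorField E) :
  VectorField (Y := base_tangent) (fproj tan_fib E).
Proof.
refine {| vf := eq_hom (tan_fib_comm E) ∘ fmap (fproj tan_fib) (vf w)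
  : (fproj tan_fib E : base_tangent) ~> bT base_tangent (fproj tan_fib E) |}.
apply: heq_eq.
apply: heq_trans (_ : fmap (fproj tan_fib) (bp tot_tangent E ∘ vf w) ≈ _).
  rewrite fmap_comp; apply: heq_comp.
    exact: heq_sym (fc_comm tan_fib_p E).
  exact: heq_eq_hom_l.
by rewrite vf_sect fmap_id.
Defined.

Definition VF_proj_ob (E : VF tot_tangent) : VF base_tangent :=
  Build_VFOb (VF_proj_field (vf_field E)).

Definition VF_proj_hom (E E' : VF tot_tangent) (f : VFHom E E') :
  VFHom (VF_proj_ob E) (VF_proj_ob E').
Proof.
refine {| vf_hom := fmap (fproj tan_fib) (vf_hom f)
  : vf_ob (VF_proj_ob E) ~> vf_ob (VF_proj_ob E') |}.
apply: heq_eq => /=.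
apply: heq_trans (_ : fmap (fproj tan_fib) (fmap (bT tot_tangent) (vf_hom f)
  ∘ vf (vf_field E)) ≈ _).
  rewrite fmap_comp; apply: heq_comp; last exact: heq_eq_hom_l.
  exact: heq_sym (functor_eq_heq (vf_hom f) (fm_comm tan_fib_T)).
rewrite vf_homP fmap_comp -compA; apply: heq_sym.
exact: heq_eq_hom_l.
Defined.

(** [VF(Π) : VF(X', T') → VF(X, T)], [(E, w) ↦ (ΠE, Πw)]. *)
Definition VF_proj : Functor (VF tot_tangent) (VF base_tangent).
Proof.
refine {| fob := VF_proj_ob : VF tot_tangent -> VF base_tangent;
          fmap := fun E E' f => VF_proj_hom f |}.
- by move=> E; apply: vfhom_eq; exact: fmap_id.
- by move=> E E' E'' g f; apply: vfhom_eq; exact: fmap_comp.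
Defined.

Definition VF_fibration (cl : Cleavage VF_proj) : Fib :=
  {| ftot := VF tot_tangent; fbase := VF base_tangent; fproj := VF_proj;
     fcleavage := cl |}.

(** The tangent fibration [VF(Π)]: its tangent bundle functors are those of
    [VF(X, T)] and [VF(X', T')], and, [U] being strict with the forgetful
    functors as underlying 1-morphism, its structural transformations lie over
    those of [P]; the vector field [v] is tautological. *)
Definition is_VF_tangent_fibration (cl : Cleavage VF_proj)
    (S : TangentStructure (VF_fibration cl))
    (U : LaxMor (Build_Tangentad S) P)
    (v : VectorField (Y := HomTan (Build_Tangentad S) P) U) : Prop :=
  let TV : FibMor (VF_fibration cl) (VF_fibration cl) := tT S in
  let U1 : FibMor (VF_fibration cl) tan_fib := lm U in
  let v2 : FibCell U1 (fib_comp tan_fib_T U1) :=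
    th (vf v : TanHom U (lax_comp (lax_T P) U)) in
  [/\ fm_base TV = VF_T base_tangent /\ fm_tot TV = VF_T tot_tangent,
      is_strict U,
      fm_base U1 = VF_forget base_tangent /\ fm_tot U1 = VF_forget tot_tangent
    & (forall M : VF base_tangent, fc_base v2 M ≈ vf (vf_field M)) /\
      (forall E : VF tot_tangent, fc_tot v2 E ≈ vf (vf_field E))].
End VFFib.

(* Main.v *)
From mathcomp Require Import all_boot.
From Stdlib Require Import ClassicalEpsilon ProofIrrelevance.
From Stdlib Require Import FunctionalExtensionality.
Require Import Defs.

Set Implicit Arguments.
Unset Strict Implicit.
Unset Printing Implicit Defensive.

(** Let [Π : (X', T') → (X, T)] be a tangent fibration. The functor
    [VF(Π) : VF(X', T') → VF(X, T)] is again one, and everything about it is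
    created by the forgetful functors [(M, v) ↦ M].

    It is a fibration because [T'] preserves Cartesian arrows. If [φ : x → y] is
    Cartesian, then [T'φ] is Cartesian over [T(Πφ)], so a vector field on [y]
    and a compatible one on [Πx] induce a unique vector field on [x] for which
    [φ] is an arrow of vector fields ([cartesian_VF_exists]). For the same
    reason an arrow of vector fields is Cartesian exactly when its underlying
    arrow is ([cartesian_VF], [VF_cartesian]).

    It carries a tangent structure: [T(M, v) = (TM, c ∘ Tv)], and
    [T_n(M, v) = (T_n M, tw ∘ T_n v)], where [tw : T_n T → T T_n] is induced by
    [c]. The equations between structural transformations are inherited. A limit
    is inherited when the arrows that it induces commute with the vector fields,
    for which it suffices that [T] keeps its projections jointly monic. For the
    [T_n] this follows from the isomorphism [T T_n ≅ T_n T] given by [c]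
    ([tg_flip_iso], [tg_pb_iter]); for the vertical lift, from the fact that [T]
    sends the lift square of [M] to that of [TM], up to flips
    ([tg_lift_monicT]). The result is [is_tangent_VF], on an arbitrary category.

    To apply it to the base and to the total category, one passes between cells
    of fibrations and their components. An object of the base, or of the total
    category, is a morphism to [Π] from a fibration over the point with empty, or
    one-point, total category ([over_point]); hence the pointwise limits of
    [Fib] are exactly the componentwise ones ([base_wide_pullback],
    [tot_wide_pullback], [wide_pullback_components]). So a tangent structure on
    a fibration amounts to compatible tangent structures on its base and on its
    total category ([is_tangent_base], [is_tangent_tot], [tangent_of_sides]).

    Finally, let [(F, α)] be a lax tangent morphism to [Π] and [w : F ⇒ TF] a
    vector field on it. Then [a ↦ (F a, w_a)] lifts [F] to vector fields. Because
    [w] is a tangent 2-morphism, the components of [α] are arrows of vector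
    fields, and the axioms of a lax tangent morphism hold for the lift since the
    forgetful functors are faithful ([is_lax_lift]). This lifting is strictly
    inverse to the comparison functor ([lift_Gamma], [Gamma_lift]). *)

Lemma dep_choice (I : Type) (A : I -> Type) (R : forall i, A i -> Prop) :
  (forall i, exists x, R i x) -> exists f : forall i, A i, forall i, R i (f i).
Proof.
move=> H; exists (fun i => proj1_sig (constructive_indefinite_description _ (H i))).
by move=> i; exact: proj2_sig.
Qed.

(** * Wide pullbacks *)

(** Both kinds of limits in a tangent structure are wide pullbacks: [n]-fold
    pullbacks by unfolding, squares by [is_pullbackE]. *)
Definition is_wide_pullback (I : Type) (C : Category) (L D : C) (A : I -> C)
    (f : forall i, A i ~> D) (pr : forall i, L ~> A i) : Prop :=
  (forall i j, f i ∘ pr i = f j ∘ pr j) /\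
  forall (S : C) (q : forall i, S ~> A i),
    (forall i j, f i ∘ q i = f j ∘ q j) ->
    exists! h : S ~> L, forall i, pr i ∘ h = q i.

Definition jointly_monic (I : Type) (C : Category) (L : C) (A : I -> C)
    (pr : forall i, L ~> A i) : Prop :=
  forall (S : C) (h k : S ~> L), (forall i, pr i ∘ h = pr i ∘ k) -> h = k.

Lemma wide_pullback_monic (I : Type) (C : Category) (L D : C) (A : I -> C)
    (f : forall i, A i ~> D) (pr : forall i, L ~> A i) :
  is_wide_pullback f pr -> jointly_monic pr.
Proof.
move=> [E H] S h k hk.
have [|m [_ Hm]] := H S (fun i => pr i ∘ h).
  by move=> i j; rewrite !compA (E i j).
by rewrite -(Hm h) // -(Hm k).
Qed.

Lemma wide_pullback_pair (I : Type) (C : Category) (L D : C) (A : I -> C)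
    (f : forall i, A i ~> D) (pr : forall i, L ~> A i) (S : C)
    (q : forall i, S ~> A i) :
  is_wide_pullback f pr -> (forall i j, f i ∘ q i = f j ∘ q j) ->
  exists h : S ~> L, forall i, pr i ∘ h = q i.
Proof. by move=> [_ H] /H [h [Hh _]]; exists h. Qed.

Lemma is_pullbackE (C : Category) (L D : C) (A : bool -> C)
    (f : forall i, A i ~> D) (pr : forall i, L ~> A i) :
  is_pullback (pr true) (pr false) (f true) (f false)
  <-> is_wide_pullback f pr.
Proof.
split=> - [E H]; split.
- by case=> -[]; rewrite ?E.
- move=> S q Hq; have [h [[h1 h2] Hh]] := H S (q true) (q false) (Hq _ _).
  exists h; split; first by case.
  by move=> k Hk; apply: Hh.
- exact: E.
- move=> S a b ab.
  pose q i := if i return S ~> A i then a else b.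
  have [|h [h1 Hh]] := H S q; first by case=> -[] //=; rewrite ab.
  exists h; split; first by split; [exact: (h1 true) | exact: (h1 false)].
  by move=> k [ka kb]; apply: Hh; case.
Qed.

Lemma nfold_pullback_iso (C : Category) (n : nat) (A B L A' L' : C)
    (f : A ~> B) (pr : 'I_n -> L ~> A) (pr' : 'I_n -> L' ~> A')
    (a : A' ~> A) (a' : A ~> A') (k : L' ~> L) (k' : L ~> L') :
  a' ∘ a = idm A' -> a ∘ a' = idm A -> k' ∘ k = idm L' -> k ∘ k' = idm L ->
  (forall i, pr i ∘ k = a ∘ pr' i) ->
  is_nfold_pullback f pr -> is_nfold_pullback (f ∘ a) pr'.
Proof.
move=> a'a aa' k'k kk' ak [E H]; split.
  by move=> i j; rewrite -!compA -!ak !compA (E i j).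
move=> S q Hq.
have [|h [Hh Uh]] := H S (fun i => a ∘ q i).
  by move=> i j; rewrite !compA (Hq i j).
exists (k' ∘ h); split=> [i|g Hg].
  rewrite -[pr' i ∘ _]comp_idl -a'a -compA (compA a) -ak -compA (compA k) kk'.
  by rewrite comp_idl Hh compA a'a comp_idl.
have -> : h = k ∘ g by apply: Uh => i; rewrite compA ak -compA Hg.
by rewrite compA k'k comp_idl.
Qed.

(** A full and faithful functor that is surjective on objects is an equivalence,
    hence preserves limits. *)
Lemma wide_pullback_equivalence (C D : Category) (F : Functor C D) (I : Type)
    (L B : C) (A : I -> C) (f : forall i, A i ~> B) (pr : forall i, L ~> A i) :
  (forall d, exists a, F a = d) ->
  (forall a b (g : F a ~> F b), exists h, fmap F h = g) ->
  (forall a b (h k : a ~> b), fmap F h = fmap F k -> h = k) ->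
  is_wide_pullback f pr ->
  is_wide_pullback (fun i => fmap F (f i)) (fun i => fmap F (pr i)).
Proof.
move=> surj full faith [E H]; split.
  by move=> i j; rewrite -!fmap_comp (E i j).
move=> S q Hq; have [S' eS] := surj S; subst S.
have [q' Hq'] := dep_choice (fun i => full _ _ (q i)).
have [|h [Hh Uh]] := H S' q'.
  by move=> i j; apply: faith; rewrite !fmap_comp !Hq' (Hq i j).
exists (fmap F h); split=> [i|g Hg]; first by rewrite -fmap_comp Hh Hq'.
have [g' eg] := full _ _ g; subst g; congr fmap; apply: Uh => i.
by apply: faith; rewrite fmap_comp Hg Hq'.
Qed.

(** * Tangent structures on a category *)

Notation o0 := (@Ordinal 2 0 isT).
Notation o1 := (@Ordinal 2 1 isT).
Notation "F ◂ f" := (fmap F f) (at level 38, no associativity).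

Lemma ord2P (Q : 'I_2 -> Prop) : Q o0 -> Q o1 -> forall i, Q i.
Proof.
move=> Q0 Q1 [[|[|m]] Hm] //.
- by rewrite (bool_irrelevance Hm isT).
- by rewrite (bool_irrelevance Hm isT).
Qed.

(** [Tn n] is the pullback of [n.+1] copies of [p], so that every index is
    meaningful. The equations between pairings are stated on generalized elements
    [S ~> Tn 1 M]: they then apply to any arrow with the right projections.
    Preservation by [T] is asked once, the iterates being [tg_pb_iter]. *)
Record is_tangent (C : Category) (T : Functor C C) (Tn : nat -> Functor C C)
    (p : forall M, T M ~> M) (z : forall M, M ~> T M)
    (π : forall n, 'I_n.+1 -> forall M, Tn n M ~> T M)
    (s : forall M, Tn 1 M ~> T M) (l : forall M, T M ~> T (T M))
    (c : forall M, T (T M) ~> T (T M)) : Prop := {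
  tg_pN : forall M N (f : M ~> N), p N ∘ T ◂ f = f ∘ p M;
  tg_zN : forall M N (f : M ~> N), z N ∘ f = T ◂ f ∘ z M;
  tg_πN : forall n i M N (f : M ~> N), π n i N ∘ Tn n ◂ f = T ◂ f ∘ π n i M;
  tg_sN : forall M N (f : M ~> N), s N ∘ Tn 1 ◂ f = T ◂ f ∘ s M;
  tg_lN : forall M N (f : M ~> N), l N ∘ T ◂ f = T ◂ (T ◂ f) ∘ l M;
  tg_cN : forall M N (f : M ~> N),
    c N ∘ T ◂ (T ◂ f) = T ◂ (T ◂ f) ∘ c M;
  tg_pb : forall n M, is_nfold_pullback (p M) (fun i => π n i M);
  tg_pbT : forall n M,
    is_nfold_pullback (T ◂ p M) (fun i => T ◂ π n i M);
  tg_pz : forall M, p M ∘ z M = idm M;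
  tg_ps : forall M, p M ∘ s M = p M ∘ π 1 o0 M;
  tg_sA : forall (M S : C) (a b v w : S ~> Tn 1 M),
    π 1 o1 M ∘ a = π 1 o0 M ∘ b ->
    π 1 o0 M ∘ v = s M ∘ a -> π 1 o1 M ∘ v = π 1 o1 M ∘ b ->
    π 1 o0 M ∘ w = π 1 o0 M ∘ a -> π 1 o1 M ∘ w = s M ∘ b ->
    s M ∘ v = s M ∘ w;
  tg_sC : forall (M S : C) (a b : S ~> Tn 1 M),
    π 1 o0 M ∘ a = π 1 o1 M ∘ b -> π 1 o1 M ∘ a = π 1 o0 M ∘ b ->
    s M ∘ a = s M ∘ b;
  tg_sz : forall (M S : C) (a : S ~> Tn 1 M),
    π 1 o0 M ∘ a = z M ∘ (p M ∘ (π 1 o1 M ∘ a)) -> s M ∘ a = π 1 o1 M ∘ a;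
  tg_pl : forall M, T ◂ p M ∘ l M = z M ∘ p M;
  tg_lz : forall M, l M ∘ z M = T ◂ z M ∘ z M;
  tg_ls : forall (M S : C) (a : S ~> Tn 1 M) (b : S ~> T (Tn 1 M)),
    (forall i, T ◂ π 1 i M ∘ b = l M ∘ (π 1 i M ∘ a)) ->
    l M ∘ (s M ∘ a) = T ◂ s M ∘ b;
  tg_pc : forall M, p (T M) ∘ c M = T ◂ p M;
  tg_cz : forall M, c M ∘ T ◂ z M = z (T M);
  tg_cs : forall (M S : C) (a : S ~> T (Tn 1 M)) (b : S ~> Tn 1 (T M)),
    (forall i, π 1 i (T M) ∘ b = c M ∘ (T ◂ π 1 i M ∘ a)) ->
    c M ∘ (T ◂ s M ∘ a) = s (T M) ∘ b;
  tg_ll : forall M, T ◂ l M ∘ l M = l (T M) ∘ l M;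
  tg_cl : forall M, c M ∘ l M = l M;
  tg_ccl : forall M, c (T M) ∘ T ◂ c M ∘ l (T M) = T ◂ l M ∘ c M;
  tg_cc : forall M, c M ∘ c M = idm (T (T M));
  tg_ccc : forall M, T ◂ c M ∘ c (T M) ∘ T ◂ c M
                     = c (T M) ∘ T ◂ c M ∘ c (T M);
  tg_lift : forall M (u : Tn 1 M ~> T (Tn 1 M)),
    T ◂ π 1 o0 M ∘ u = l M ∘ π 1 o0 M ->
    T ◂ π 1 o1 M ∘ u = z (T M) ∘ π 1 o1 M ->
    is_pullback (T ◂ s M ∘ u) (p M ∘ π 1 o0 M) (T ◂ p M) (z M)
}.

Fixpoint fiter (C : Category) (T : Functor C C) (m : nat) : Functor C C :=
  if m is m'.+1 then fcomp T (fiter T m') else fid C.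

Lemma fiterS (C : Category) (T : Functor C C) (m : nat) :
  fiter T m.+1 = fcomp (fiter T m) T.
Proof.
elim: m => [|m IH]; first exact: functor_eq.
transitivity (fcomp T (fcomp (fiter T m) T)); first by rewrite -IH.
exact: functor_eq.
Qed.

Section TangentTheory.
Context {C : Category} {T : Functor C C} {Tn : nat -> Functor C C}
  {p : forall M, T M ~> M} {z : forall M, M ~> T M}
  {π : forall n, 'I_n.+1 -> forall M, Tn n M ~> T M}
  {s : forall M, Tn 1 M ~> T M} {l : forall M, T M ~> T (T M)}
  {c : forall M, T (T M) ~> T (T M)}.
Arguments π : clear implicits.
Hypothesis tg : is_tangent p z π s l c.

Lemma tg_pair n M (S : C) (q : 'I_n.+1 -> S ~> T M) :
  (forall i j, p M ∘ q i = p M ∘ q j) ->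
  exists h : S ~> Tn n M, forall i, π n i M ∘ h = q i.
Proof. exact: wide_pullback_pair (tg_pb tg n M). Qed.

Lemma tg_pairT n M (S : C) (q : 'I_n.+1 -> S ~> T (T M)) :
  (forall i j, T ◂ p M ∘ q i = T ◂ p M ∘ q j) ->
  exists h : S ~> T (Tn n M), forall i, T ◂ π n i M ∘ h = q i.
Proof. exact: wide_pullback_pair (tg_pbT tg n M). Qed.

Lemma tg_monic n M : jointly_monic (fun i => π n i M).
Proof. exact: wide_pullback_monic (tg_pb tg n M). Qed.

Lemma tg_monicT n M : jointly_monic (fun i => T ◂ π n i M).
Proof. exact: wide_pullback_monic (tg_pbT tg n M). Qed.

Lemma tg_pTc M : T ◂ p M ∘ c M = p (T M).
Proof. by rewrite -(tg_pc tg) -compA (tg_cc tg) comp_idr. Qed.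

Lemma tg_czT M : c M ∘ z (T M) = T ◂ z M.
Proof. by rewrite -(tg_cz tg) compA (tg_cc tg) comp_idl. Qed.

Lemma tg_lc M : l (T M) ∘ c M = T ◂ c M ∘ c (T M) ∘ T ◂ l M.
Proof.
have E : T ◂ l M = c (T M) ∘ T ◂ c M ∘ l (T M) ∘ c M.
  by rewrite (tg_ccl tg) -compA (tg_cc tg) comp_idr.
rewrite E -!compA (compA (c (T M)) (c (T M))) (tg_cc tg) comp_idl.
by rewrite (compA (T ◂ c M)) -fmap_comp (tg_cc tg) fmap_id comp_idl.
Qed.

(** Both sides are pullbacks of isomorphic cospans, as [c] exchanges [Tp] and
    [p_T]. *)
Lemma tg_flip_iso n M : exists (θ : T (Tn n M) ~> Tn n (T M))
    (θ' : Tn n (T M) ~> T (Tn n M)),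
  [/\ forall i, π n i (T M) ∘ θ = c M ∘ T ◂ π n i M,
      θ' ∘ θ = idm _ & θ ∘ θ' = idm _].
Proof.
have [|θ Hθ] := @tg_pair n (T M) _ (fun i => c M ∘ T ◂ π n i M).
  by move=> i j; rewrite !compA (tg_pc tg) (proj1 (tg_pbT tg n M) i j).
have [|θ' Hθ'] := @tg_pairT n M _ (fun i => c M ∘ π n i (T M)).
  by move=> i j; rewrite !compA !tg_pTc (proj1 (tg_pb tg n (T M)) i j).
exists θ, θ'; split=> //.
- apply: tg_monicT => i.
  by rewrite compA Hθ' -compA Hθ compA (tg_cc tg) comp_idl comp_idr.
- apply: tg_monic => i.
  by rewrite compA Hθ -compA Hθ' compA (tg_cc tg) comp_idl comp_idr.
Qed.

(** Preservation by [T] suffices: [T^m T T_n M] is isomorphic to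
    [T^m T_n (TM)] through the flip, which lowers the number of iterations. *)
Lemma tg_pb_iter m n M : is_nfold_pullback (fiter T m ◂ p M)
  (fun i => fiter T m ◂ π n i M).
Proof.
elim: m M => [|m IH] M; first exact: (tg_pb tg).
rewrite fiterS.
have [θ [θ' [Hθ θ'θ θθ']]] := tg_flip_iso n M.
set F := fiter T m in IH *.
have -> : fmap (fcomp F T) (p M) = F ◂ p (T M) ∘ F ◂ c M.
  by rewrite -fmap_comp (tg_pc tg).
apply: (nfold_pullback_iso (a' := F ◂ c M) (k := F ◂ θ) (k' := F ◂ θ') _ _ _ _ _
  (IH (T M))).
- by rewrite -fmap_comp (tg_cc tg) fmap_id.
- by rewrite -fmap_comp (tg_cc tg) fmap_id.
- by rewrite -fmap_comp θ'θ fmap_id.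
- by rewrite -fmap_comp θθ' fmap_id.
- by move=> i; rewrite -!fmap_comp Hθ.
Qed.

(** The image under [T] of the vertical lift square of [M] is, up to flips, the
    vertical lift square of [TM]; so [T] preserves the joint monicity of its
    projections. This is what makes an arrow induced by the square of [M]
    compatible with vector fields. *)
Lemma tg_lift_monicT M (u : Tn 1 M ~> T (Tn 1 M)) (S : C)
    (h k : S ~> T (Tn 1 M)) :
  T ◂ π 1 o0 M ∘ u = l M ∘ π 1 o0 M ->
  T ◂ π 1 o1 M ∘ u = z (T M) ∘ π 1 o1 M ->
  T ◂ (T ◂ s M ∘ u) ∘ h = T ◂ (T ◂ s M ∘ u) ∘ k ->
  T ◂ (p M ∘ π 1 o0 M) ∘ h = T ◂ (p M ∘ π 1 o0 M) ∘ k -> h = k.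
Proof.
move=> u0 u1 E1 E2.
have [θ [θ' [Hθ θ'θ θθ']]] := tg_flip_iso 1 M.
have [|u' Hu'] := @tg_pairT 1 (T M) _
  (fun i => if val i is 0 then l (T M) ∘ π 1 i (T M)
            else z (T (T M)) ∘ π 1 i (T M)).
  have e0 : T ◂ p (T M) ∘ (l (T M) ∘ π 1 o0 (T M))
      = z (T M) ∘ (p (T M) ∘ π 1 o0 (T M)).
    by rewrite compA (tg_pl tg) -compA.
  have e1 : T ◂ p (T M) ∘ (z (T (T M)) ∘ π 1 o1 (T M))
      = z (T M) ∘ (p (T M) ∘ π 1 o0 (T M)).
    rewrite compA -(tg_zN tg (p (T M))) -compA.
    by rewrite (proj1 (tg_pb tg 1 (T M)) o0 o1).
  by apply: ord2P; apply: ord2P; rewrite /= ?e0 ?e1.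
have u'0 := Hu' o0; have u'1 := Hu' o1; rewrite /= in u'0 u'1.
(* [θ] carries [T] of the lift to the lift of [TM], up to [Tc ∘ c_T]: this is
   [tg_lc] on the first projection and the naturality of [z] on the second. *)
have claim (g : S ~> T (Tn 1 M)) : (T ◂ s (T M) ∘ u') ∘ (θ ∘ g)
    = T ◂ c M ∘ (c (T M) ∘ (T ◂ (T ◂ s M ∘ u) ∘ g)).
  have -> : (T ◂ s (T M) ∘ u') ∘ (θ ∘ g)
      = T ◂ (s (T M) ∘ θ) ∘ (c (Tn 1 M) ∘ (T ◂ u ∘ g)).
    rewrite fmap_comp -!compA; apply: (f_equal (comp _)); apply: tg_monicT.
    move=> i; rewrite [RHS]compA -fmap_comp Hθ fmap_comp.
    rewrite -(compA (T ◂ c M)) (compA (T ◂ (T ◂ π 1 i M))).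
    rewrite -(tg_cN tg).
    rewrite -(compA (c (T M))) (compA (T ◂ (T ◂ π 1 i M))) -fmap_comp.
    move: i; apply: ord2P.
    - rewrite u0 compA u'0 -compA (compA (π 1 o0 (T M))) Hθ.
      by rewrite !compA tg_lc -!compA fmap_comp -!compA.
    - rewrite u1 compA u'1 -compA (compA (π 1 o1 (T M))) Hθ.
      rewrite !compA (tg_zN tg) -!compA fmap_comp; apply: (f_equal (comp _)).
      by rewrite -!compA (compA (c (T M)) (T ◂ z (T M))) (tg_cz tg).
  rewrite -(tg_cs tg (a := idm _)); last by move=> i; rewrite comp_idr Hθ.
  rewrite comp_idr fmap_comp -compA; apply: (f_equal (comp _)).
  by rewrite compA -(tg_cN tg) -!compA fmap_comp -compA.
have pθ (g : S ~> T (Tn 1 M)) : (p (T M) ∘ π 1 o0 (T M)) ∘ (θ ∘ g)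
    = T ◂ (p M ∘ π 1 o0 M) ∘ g.
  rewrite -!compA (compA (π 1 o0 (T M))) Hθ !compA (tg_pc tg).
  by rewrite -fmap_comp.
have e : θ ∘ h = θ ∘ k.
  have P := tg_lift tg u'0 u'1.
  have [E H] := P.
  have [|m [_ Hm]] := H S ((T ◂ s (T M) ∘ u') ∘ (θ ∘ h))
    ((p (T M) ∘ π 1 o0 (T M)) ∘ (θ ∘ h)); first by rewrite compA E -compA.
  by rewrite -(Hm (θ ∘ h)) // -(Hm (θ ∘ k)) // !claim !pθ E1 E2.
by rewrite -[h]comp_idl -[k]comp_idl -θ'θ -!compA e.
Qed.
End TangentTheory.

(** * Vector fields *)

Lemma vfob_eq (Y : BundleCategory) (M N : VFOb Y) : vf_ob M = vf_ob N ->
  vf (vf_field M) ≈ vf (vf_field N) -> M = N.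
Proof.
case: M N => [M [v Hv]] [N [w Hw]] /= e; subst N => /heq_eq e; subst w.
by rewrite (proof_irrelevance _ Hv Hw).
Qed.

Lemma vf_hom_eq (Y : BundleCategory) (M N : VF Y) (f g : M ~> N) :
  f = g -> vf_hom f = vf_hom g.
Proof. by move->. Qed.

Lemma vfhom_heq (Y : BundleCategory) (M N M' N' : VF Y) (f : M ~> N)
    (g : M' ~> N') : M = M' -> N = N' -> vf_hom f ≈ vf_hom g -> f ≈ g.
Proof.
by move=> eM eN; subst M' N' => /heq_eq e; apply/heq_of_eq/vfhom_eq.
Qed.

(** Whether the arrow induced in [Y] commutes with the vector fields can be
    tested after the arrows [T pr_i], where it holds because the cone does. *)
Lemma wide_pullback_VF (Y : BundleCategory) (I : Type) (L D : VF Y)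
    (A : I -> VF Y) (f : forall i, A i ~> D) (pr : forall i, L ~> A i) :
  is_wide_pullback (C := Y) (fun i => vf_hom (f i)) (fun i => vf_hom (pr i)) ->
  jointly_monic (C := Y) (fun i => bT Y ◂ vf_hom (pr i)) ->
  is_wide_pullback f pr.
Proof.
move=> [E H] J; split; first by move=> i j; apply: vfhom_eq; exact: E.
move=> S q Hq.
have [|h [Hh Uh]] := H _ (fun i => vf_hom (q i)).
  by move=> i j; exact: vf_hom_eq (Hq i j).
have homh : bT Y ◂ h ∘ vf_field S = vf_field L ∘ h.
  apply: J => i; rewrite !compA -fmap_comp Hh (vf_homP (pr i)) (vf_homP (q i)).
  by rewrite -compA Hh.
exists {| vf_hom := h : vf_ob S ~> vf_ob L; vf_homP := homh |}; split.
  by move=> i; apply: vfhom_eq; exact: Hh.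
move=> k Hk; apply: vfhom_eq; apply: Uh => i.
exact: vf_hom_eq (Hk i).
Qed.

Section VFLift.
Variables (C : Category) (Y : BundleCategory) (F : Functor C Y)
  (w : NatTrans F (fcomp (bT Y) F))
  (w_sect : forall a, bp Y (F a) ∘ w a = idm (F a)).

Definition vf_lift_ob (a : C) : VF Y :=
  {| vf_ob := F a; vf_field := Build_VectorField (w_sect a) |}.

Definition vf_lift_hom (a b : C) (f : a ~> b) :
    vf_lift_ob a ~> vf_lift_ob b :=
  {| vf_hom := F ◂ f : vf_ob (vf_lift_ob a) ~> vf_ob (vf_lift_ob b);
     vf_homP := nt_nat w f |}.

Definition vf_lift : Functor C (VF Y).
Proof.
refine {| fob := vf_lift_ob; fmap := vf_lift_hom |}.
- by move=> a; apply: vfhom_eq; exact: fmap_id.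
- by move=> a b d g f; apply: vfhom_eq; exact: fmap_comp.
Defined.
End VFLift.

Section TangentVF.
Variables (Y : BundleCategory) (Tn : nat -> Functor Y Y).
Local Notation T := (bT Y).
Local Notation p := (bp Y).
Local Notation c := (bc Y).
Variables (z : forall M : Y, M ~> T M)
  (π : forall n, 'I_n.+1 -> forall M : Y, Tn n M ~> T M)
  (s : forall M : Y, Tn 1 M ~> T M) (l : forall M : Y, T M ~> T (T M)).
Arguments π : clear implicits.
Hypothesis tg : is_tangent (T := T) p z π s l c.
Variable tw : forall n, NatTrans (fcomp (Tn n) T) (fcomp T (Tn n)).
Hypothesis twπ : forall n i M, T ◂ π n i M ∘ tw n M = c M ∘ π n i (T M).

(** The transposition [tw] is chosen so that [Tπ_i ∘ tw ∘ T_n v = c ∘ Tv ∘ π_i],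
    that is, so that the projections become arrows of vector fields. *)
Definition vf_Tn_field n : NatTrans (fcomp (Tn n) (VF_forget Y))
  (fcomp T (fcomp (Tn n) (VF_forget Y))).
Proof.
refine {| nt := fun M : VF Y => tw n (vf_ob M) ∘ Tn n ◂ vf_field M
  : fcomp (Tn n) (VF_forget Y) M ~> fcomp T (fcomp (Tn n) (VF_forget Y)) M |}.
move=> M N f; have /= e := nt_nat (tw n) (vf_hom f).
by rewrite /= compA e -!compA -!fmap_comp vf_homP.
Defined.

Lemma vf_Tn_sect n (M : VF Y) :
  p (Tn n (vf_ob M)) ∘ vf_Tn_field n M = idm (Tn n (vf_ob M)).
Proof.
apply: (tg_monic tg) => i /=.
rewrite (compA (p _)) compA compA -(tg_pN tg) -(compA (p _)) twπ.
rewrite compA (tg_pc tg) -compA (tg_πN tg) compA -fmap_comp vf_sect fmap_id.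
by rewrite comp_idl comp_idr.
Qed.

Definition VF_Tn n : Functor (VF Y) (VF Y) := vf_lift (vf_Tn_sect n).

Definition vf_p (M : VF Y) : VF_T Y M ~> M.
Proof.
refine {| vf_hom := p (vf_ob M) : vf_ob (VF_T Y M) ~> vf_ob M |}.
by rewrite /= compA (tg_pTc tg) (tg_pN tg).
Defined.

Definition vf_z (M : VF Y) : M ~> VF_T Y M.
Proof.
refine {| vf_hom := z (vf_ob M) : vf_ob M ~> vf_ob (VF_T Y M) |}.
by rewrite /= -compA -(tg_zN tg) compA (tg_czT tg).
Defined.

Definition vf_π n (i : 'I_n.+1) (M : VF Y) : VF_Tn n M ~> VF_T Y M.
Proof.
refine {| vf_hom := π n i (vf_ob M) : vf_ob (VF_Tn n M) ~> vf_ob (VF_T Y M) |}.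
by rewrite /= compA twπ -!compA (tg_πN tg).
Defined.

Arguments vf_π : clear implicits.

Definition vf_s (M : VF Y) : VF_Tn 1 M ~> VF_T Y M.
Proof.
refine {| vf_hom := s (vf_ob M) : vf_ob (VF_Tn 1 M) ~> vf_ob (VF_T Y M) |}.
(* Inserting [c ∘ c] in front makes the additivity of [c] applicable. *)
rewrite /= -[LHS]comp_idl -(tg_cc tg) -!compA.
rewrite (tg_cs tg (b := Tn 1 ◂ vf_field M)); first by rewrite (tg_sN tg).
move=> i; rewrite (compA (T ◂ _)) twπ !compA (tg_cc tg) comp_idl.
by [].
Defined.

Definition vf_l (M : VF Y) : VF_T Y M ~> VF_T Y (VF_T Y M).
Proof.
refine {| vf_hom := l (vf_ob M)
  : vf_ob (VF_T Y M) ~> vf_ob (VF_T Y (VF_T Y M)) |}.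
rewrite /= compA -(tg_ccl tg) fmap_comp -!compA.
by rewrite (tg_lN tg).
Defined.

Definition vf_c (M : VF Y) : VF_T Y (VF_T Y M) ~> VF_T Y (VF_T Y M).
Proof.
refine {| vf_hom := c (vf_ob M)
  : vf_ob (VF_T Y (VF_T Y M)) ~> vf_ob (VF_T Y (VF_T Y M)) |}.
rewrite /= fmap_comp !compA (tg_ccc tg) -!compA.
by rewrite (tg_cN tg).
Defined.

Lemma vf_pb n (M : VF Y) : is_nfold_pullback (vf_p M) (fun i => vf_π n i M).
Proof.
apply: (wide_pullback_VF (A := fun _ : 'I_n.+1 => VF_T Y M)
  (f := fun _ => vf_p M)).
- exact: (tg_pb tg).
- exact: (tg_monicT tg).
Qed.

Lemma vf_pbT n (M : VF Y) : is_nfold_pullback (VF_T Y ◂ vf_p M)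
  (fun i => VF_T Y ◂ vf_π n i M).
Proof.
apply: (wide_pullback_VF (A := fun _ : 'I_n.+1 => VF_T Y (VF_T Y M))
  (f := fun _ => VF_T Y ◂ vf_p M)).
- exact: (tg_pbT tg).
- exact: wide_pullback_monic (tg_pb_iter tg 2 n (vf_ob M)).
Qed.

Lemma vf_lift_pullback (M : VF Y) (u : VF_Tn 1 M ~> VF_T Y (VF_Tn 1 M)) :
  VF_T Y ◂ vf_π 1 o0 M ∘ u = vf_l M ∘ vf_π 1 o0 M ->
  VF_T Y ◂ vf_π 1 o1 M ∘ u = vf_z (VF_T Y M) ∘ vf_π 1 o1 M ->
  is_pullback (VF_T Y ◂ vf_s M ∘ u) (vf_p M ∘ vf_π 1 o0 M) (VF_T Y ◂ vf_p M)
    (vf_z M).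
Proof.
move=> /vf_hom_eq /= u0 /vf_hom_eq /= u1.
pose A i := if i then VF_T Y (VF_T Y M) else M.
pose f i := if i return A i ~> VF_T Y M then VF_T Y ◂ vf_p M else vf_z M.
pose pr i := if i return VF_Tn 1 M ~> A i then VF_T Y ◂ vf_s M ∘ u
             else vf_p M ∘ vf_π 1 o0 M.
apply/(is_pullbackE f pr)/wide_pullback_VF.
- apply/(is_pullbackE (fun i => vf_hom (f i)) (fun i => vf_hom (pr i))).
  have H := tg_lift tg u0 u1; exact H.
- move=> S h k hk.
  exact: (tg_lift_monicT tg u0 u1 (hk true) (hk false)).
Qed.

Lemma is_tangent_VF :
  is_tangent vf_p vf_z vf_π vf_s vf_l vf_c.
Proof.
split.
- by move=> M N f; apply: vfhom_eq; exact: tg_pN tg _ _ _.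
- by move=> M N f; apply: vfhom_eq; exact: tg_zN tg _ _ _.
- by move=> n i M N f; apply: vfhom_eq; exact: tg_πN tg _ _ _ _ _.
- by move=> M N f; apply: vfhom_eq; exact: tg_sN tg _ _ _.
- by move=> M N f; apply: vfhom_eq; exact: tg_lN tg _ _ _.
- by move=> M N f; apply: vfhom_eq; exact: tg_cN tg _ _ _.
- exact: vf_pb.
- exact: vf_pbT.
- by move=> M; apply: vfhom_eq; exact: tg_pz tg _.
- by move=> M; apply: vfhom_eq; exact: tg_ps tg _.
- move=> M S a b v w /vf_hom_eq e1.
  move=> /vf_hom_eq e2 /vf_hom_eq e3.
  move=> /vf_hom_eq e4 /vf_hom_eq e5.
  by apply: vfhom_eq; have H := tg_sA tg e1 e2 e3 e4 e5; exact H.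
- move=> M S a b /vf_hom_eq e1 /vf_hom_eq e2.
  by apply: vfhom_eq; have H := tg_sC tg e1 e2; exact H.
- move=> M S a /vf_hom_eq e.
  by apply: vfhom_eq; have H := tg_sz tg e; exact H.
- by move=> M; apply: vfhom_eq; exact: tg_pl tg _.
- by move=> M; apply: vfhom_eq; exact: tg_lz tg _.
- move=> M S a b e; apply: vfhom_eq; apply: (tg_ls tg) => i.
  exact: vf_hom_eq (e i).
- by move=> M; apply: vfhom_eq; exact: tg_pc tg _.
- by move=> M; apply: vfhom_eq; exact: tg_cz tg _.
- move=> M S a b e; apply: vfhom_eq; apply: (tg_cs tg) => i.
  exact: vf_hom_eq (e i).
- by move=> M; apply: vfhom_eq; exact: tg_ll tg _.
- by move=> M; apply: vfhom_eq; exact: tg_cl tg _.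
- by move=> M; apply: vfhom_eq; exact: tg_ccl tg _.
- by move=> M; apply: vfhom_eq; exact: tg_cc tg _.
- by move=> M; apply: vfhom_eq; exact: tg_ccc tg _.
- exact: vf_lift_pullback.
Qed.
End TangentVF.

(** * Components of cells of fibrations *)

Lemma heq_idr (C : Category) (a b c d : C) (e : a ~> b) (f : b ~> c) :
  e ≈ idm d -> f ∘ e ≈ f.
Proof.
move=> H; have ed := heq_dom H; have ec := heq_cod H; subst d b.
by rewrite (heq_eq H) comp_idr.
Qed.

Section Components.
Variables (P Q : Fib).
Implicit Types (F : Hom1 P Q).

Lemma base_lw_to_id F (G : Hom1 P P) (φ : G ~> id1 P) a :
  fc_base (lw_to_id F φ) a = fm_base F ◂ fc_base φ a.
Proof. by apply: heq_eq; apply: heq_idl; exact: fc_base_eq_hom. Qed.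
Lemma tot_lw_to_id F (G : Hom1 P P) (φ : G ~> id1 P) x :
  fc_tot (lw_to_id F φ) x = fm_tot F ◂ fc_tot φ x.
Proof. by apply: heq_eq; apply: heq_idl; exact: fc_tot_eq_hom. Qed.

Lemma base_lw_of_id F (G : Hom1 P P) (φ : id1 P ~> G) a :
  fc_base (lw_of_id F φ) a = fm_base F ◂ fc_base φ a.
Proof. by apply: heq_eq; apply: heq_idr; exact: fc_base_eq_hom. Qed.
Lemma tot_lw_of_id F (G : Hom1 P P) (φ : id1 P ~> G) x :
  fc_tot (lw_of_id F φ) x = fm_tot F ◂ fc_tot φ x.
Proof. by apply: heq_eq; apply: heq_idr; exact: fc_tot_eq_hom. Qed.

Lemma base_rw_to_id (G : Hom1 Q Q) (φ : G ~> id1 Q) F a :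
  fc_base (rw_to_id φ F) a = fc_base φ (fm_base F a).
Proof. by apply: heq_eq; apply: heq_idl; exact: fc_base_eq_hom. Qed.
Lemma tot_rw_to_id (G : Hom1 Q Q) (φ : G ~> id1 Q) F x :
  fc_tot (rw_to_id φ F) x = fc_tot φ (fm_tot F x).
Proof. by apply: heq_eq; apply: heq_idl; exact: fc_tot_eq_hom. Qed.

Lemma base_rw_of_id (G : Hom1 Q Q) (φ : id1 Q ~> G) F a :
  fc_base (rw_of_id φ F) a = fc_base φ (fm_base F a).
Proof. by apply: heq_eq; apply: heq_idr; exact: fc_base_eq_hom. Qed.
Lemma tot_rw_of_id (G : Hom1 Q Q) (φ : id1 Q ~> G) F x :
  fc_tot (rw_of_id φ F) x = fc_tot φ (fm_tot F x).
Proof. by apply: heq_eq; apply: heq_idr; exact: fc_tot_eq_hom. Qed.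

Lemma base_comp F G H (ψ : G ~> H) (φ : F ~> G) a :
  fc_base (ψ ∘ φ) a = fc_base ψ a ∘ fc_base φ a.
Proof. by []. Qed.

Lemma tot_comp F G H (ψ : G ~> H) (φ : F ~> G) x :
  fc_tot (ψ ∘ φ) x = fc_tot ψ x ∘ fc_tot φ x.
Proof. by []. Qed.

Variables (Q' Q'' R : Fib).

Lemma base_rw_to_comp (G : Hom1 Q R) (H : Hom1 Q' R) (L : Hom1 Q Q')
    (φ : G ~> H ⊚ L) F a :
  fc_base (rw_to_comp φ F) a = fc_base φ (fm_base F a).
Proof. by apply: heq_eq; apply: heq_idl; exact: fc_base_eq_hom. Qed.
Lemma tot_rw_to_comp (G : Hom1 Q R) (H : Hom1 Q' R) (L : Hom1 Q Q')
    (φ : G ~> H ⊚ L) F x :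
  fc_tot (rw_to_comp φ F) x = fc_tot φ (fm_tot F x).
Proof. by apply: heq_eq; apply: heq_idl; exact: fc_tot_eq_hom. Qed.

Lemma base_rw_comp (H : Hom1 Q' R) (L : Hom1 Q Q') (H' : Hom1 Q'' R)
    (L' : Hom1 Q Q'') (φ : H ⊚ L ~> H' ⊚ L') F a :
  fc_base (rw_comp φ F) a = fc_base φ (fm_base F a).
Proof.
apply: heq_eq; apply: heq_trans (heq_idr _ (fc_base_eq_hom _ _)) _.
by apply: heq_idl; exact: fc_base_eq_hom.
Qed.
Lemma tot_rw_comp (H : Hom1 Q' R) (L : Hom1 Q Q') (H' : Hom1 Q'' R)
    (L' : Hom1 Q Q'') (φ : H ⊚ L ~> H' ⊚ L') F x :
  fc_tot (rw_comp φ F) x = fc_tot φ (fm_tot F x).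
Proof.
apply: heq_eq; apply: heq_trans (heq_idr _ (fc_tot_eq_hom _ _)) _.
by apply: heq_idl; exact: fc_tot_eq_hom.
Qed.

Lemma base_lwhisk (H : Hom1 Q R) F G (φ : F ~> G) a :
  fc_base (H ◃ φ) a = fm_base H ◂ fc_base φ a.
Proof. by []. Qed.

Lemma base_rwhisk (G H : Hom1 Q R) (φ : G ~> H) F a :
  fc_base (φ ▹ F) a = fc_base φ (fm_base F a).
Proof. by []. Qed.

Lemma tot_lwhisk (H : Hom1 Q R) F G (φ : F ~> G) x :
  fc_tot (H ◃ φ) x = fm_tot H ◂ fc_tot φ x.
Proof. by []. Qed.

Lemma tot_rwhisk (G H : Hom1 Q R) (φ : G ~> H) F x :
  fc_tot (φ ▹ F) x = fc_tot φ (fm_tot F x).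
Proof. by []. Qed.
End Components.

Lemma base_twice_cell (P Q : Fib) (T : Hom1 P P) (T' : Hom1 Q Q)
    (F : Hom1 P Q) (α : F ⊚ T ~> T' ⊚ F) a :
  fc_base (twice_cell α) a
  = fm_base T' ◂ fc_base α a ∘ fc_base α (fm_base T a).
Proof. by apply: (f_equal (comp _)); exact: base_rw_comp. Qed.
Lemma tot_twice_cell (P Q : Fib) (T : Hom1 P P) (T' : Hom1 Q Q)
    (F : Hom1 P Q) (α : F ⊚ T ~> T' ⊚ F) x :
  fc_tot (twice_cell α) x = fm_tot T' ◂ fc_tot α x ∘ fc_tot α (fm_tot T x).
Proof. by apply: (f_equal (comp _)); exact: tot_rw_comp. Qed.

Lemma base_comp_cell (P Q R : Fib) (T : Hom1 P P) (T' : Hom1 Q Q)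
    (T'' : Hom1 R R) (G : Hom1 Q R) (β : G ⊚ T' ~> T'' ⊚ G) (F : Hom1 P Q)
    (α : F ⊚ T ~> T' ⊚ F) a :
  fc_base (comp_cell β α) a
  = fc_base β (fm_base F a) ∘ fm_base G ◂ fc_base α a.
Proof.
apply: heq_eq; apply: heq_trans (heq_idr _ (fc_base_eq_hom _ _)) _.
apply: heq_comp => //; apply: heq_of_eq; exact: base_rw_comp.
Qed.
Lemma tot_comp_cell (P Q R : Fib) (T : Hom1 P P) (T' : Hom1 Q Q)
    (T'' : Hom1 R R) (G : Hom1 Q R) (β : G ⊚ T' ~> T'' ⊚ G) (F : Hom1 P Q)
    (α : F ⊚ T ~> T' ⊚ F) x :
  fc_tot (comp_cell β α) x = fc_tot β (fm_tot F x) ∘ fm_tot G ◂ fc_tot α x.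
Proof.
apply: heq_eq; apply: heq_trans (heq_idr _ (fc_tot_eq_hom _ _)) _.
apply: heq_comp => //; apply: heq_of_eq; exact: tot_rw_comp.
Qed.

(** All the structural isomorphisms of [Fib] have identities as components, so
    that the components of a composite cell can be computed. *)
Definition base_cellE := (base_comp, base_lwhisk, base_rwhisk, base_lw_to_id,
  base_lw_of_id, base_rw_to_id,
  base_rw_of_id, base_rw_to_comp, base_rw_comp, base_twice_cell,
  base_comp_cell).
Definition tot_cellE := (tot_comp, tot_lwhisk, tot_rwhisk, tot_lw_to_id,
  tot_lw_of_id, tot_rw_to_id,
  tot_rw_of_id, tot_rw_to_comp, tot_rw_comp, tot_twice_cell, tot_comp_cell).

Lemma base_congr (P Q : Fib) (F G : Hom1 P Q) (φ ψ : F ~> G) a :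
  φ = ψ -> fc_base φ a = fc_base ψ a.
Proof. by move->. Qed.

Lemma tot_congr (P Q : Fib) (F G : Hom1 P Q) (φ ψ : F ~> G) x :
  φ = ψ -> fc_tot φ x = fc_tot ψ x.
Proof. by move->. Qed.

(** * The pairings occurring in a tangent structure *)

Section Pairings.
Variables (K : TwoCategory) (X : K) (A : TangentStructure X).
Local Notation T := (tT A).
Local Notation p := (tp A).
Local Notation c := (tc A).
Local Notation s := (ts A).

Lemma tang_pb (X' : K) (F : Hom1 X' X) n : is_nfold_pullback (p ▹ F)
  (fun i : 'I_n.+1 => tπ A i ▹ F).
Proof. have [_ H] := tn_pullback A (ltn0Sn n); exact: H. Qed.

Lemma tang_pb_id n : is_nfold_pullback p (fun i : 'I_n.+1 => tπ A i).
Proof. by have [H _] := tn_pullback A (ltn0Sn n). Qed.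

Lemma tang_pbT n : is_nfold_pullback (T ◃ p) (fun i : 'I_n.+1 => T ◃ tπ A i).
Proof.
have := tn_preserved A 1 (ltn0Sn n).
by have -> : iter1 T 1 = T by exact: comp1_idr.
Qed.

Lemma tang_lwE : T ◃ p = eq_hom (esym (comp1_idr T)) ∘ lw_to_id T p.
Proof. by two_cell_coh. Qed.

Lemma tang_rwE : p ▹ T = eq_hom (esym (comp1_idl T)) ∘ rw_to_id p T.
Proof. by two_cell_coh. Qed.

Lemma tang_pair n (S : Hom1 X X) (q : 'I_n.+1 -> S ~> T) :
  (forall i j, p ∘ q i = p ∘ q j) ->
  exists h : S ~> tn A n.+1, forall i, tπ A i ∘ h = q i.
Proof. exact: wide_pullback_pair (tang_pb_id n). Qed.

(** Preservation of [T_n] by [T] is only given in the category of endomorphisms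
    of [X]. There [T_n ∘ T] is the vertex of a cone, which yields the inverse
    [tw] of [θ]; the identity [tw ∘ θ = id] then holds on components, and makes
    the preservation pointwise. *)
Lemma tang_flip n : exists (θ : T ⊚ tn A n.+1 ~> tn A n.+1 ⊚ T)
    (tw : tn A n.+1 ⊚ T ~> T ⊚ tn A n.+1),
  [/\ forall i, (tπ A i ▹ T) ∘ θ = c ∘ (T ◃ tπ A i),
      forall i, (T ◃ tπ A i) ∘ tw = c ∘ (tπ A i ▹ T) & tw ∘ θ = idm _].
Proof.
have [|θ Hθ] := wide_pullback_pair (q := fun i => c ∘ (T ◃ tπ A i)) (tang_pb T n).
  move=> i j.
  have E k : (p ▹ T) ∘ (c ∘ (T ◃ tπ A k))
      = eq_hom (esym (comp1_idl T)) ∘ eq_hom (comp1_idr T) ∘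
        (T ◃ (p ∘ tπ A k)).
    rewrite tang_rwE -compA (compA (rw_to_id _ _)) tpc lwhisk_comp /lw_to_id.
    by rewrite !compA.
  by rewrite !E (proj1 (tang_pb_id n) i j).
have [|tw Htw] := wide_pullback_pair (q := fun i => c ∘ (tπ A i ▹ T)) (tang_pbT n).
  move=> i j.
  have E k : (T ◃ p) ∘ (c ∘ (tπ A k ▹ T))
      = eq_hom (esym (comp1_idr T)) ∘ eq_hom (comp1_idl T) ∘
        ((p ∘ tπ A k) ▹ T).
    by rewrite tang_lwE -tpc -!compA (compA c c) tcc comp_idl rwhisk_comp.
  by rewrite !E (proj1 (tang_pb_id n) i j).
exists θ, tw; split=> //.
apply: (wide_pullback_monic (tang_pbT n)) => i.
by rewrite compA Htw -compA Hθ compA tcc comp_idl comp_idr.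
Qed.

Lemma tang_distributor :
  exists tw : forall n, tn A n.+1 ⊚ T ~> T ⊚ tn A n.+1,
    forall n i, (T ◃ tπ A i) ∘ tw n = c ∘ (tπ A i ▹ T).
Proof.
apply: (@dep_choice nat (fun n => tn A n.+1 ⊚ T ~> T ⊚ tn A n.+1)
  (fun n tw => forall i, (T ◃ tπ A i) ∘ tw = c ∘ (tπ A i ▹ T))) => n.
by have [_ [tw [_ Htw _]]] := tang_flip n; exists tw.
Qed.

Local Notation π2 k := (tπ A (@Ordinal 2 k isT)).
Local Notation π3 k := (tπ A (@Ordinal 3 k isT)).

Lemma tang_pπ n (i j : 'I_n.+1) : p ∘ tπ A i = p ∘ tπ A j.
Proof. exact: (proj1 (tang_pb_id n)). Qed.

Lemma tang_pair2 (S : Hom1 X X) (f g : S ~> T) : p ∘ f = p ∘ g ->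
  exists h : S ~> tn A 2, π2 0 ∘ h = f /\ π2 1 ∘ h = g.
Proof.
move=> fg.
have [|h Hh] := tang_pair (n := 1) (q := fun i => if val i is 0 then f else g).
  by apply: ord2P; apply: ord2P; rewrite /= ?fg.
by exists h; split; [exact: Hh o0 | exact: Hh o1].
Qed.

Lemma tang_sA : exists a b v w : tn A 3 ~> tn A 2,
  [/\ π2 0 ∘ a = π3 0, π2 1 ∘ a = π3 1, π2 0 ∘ b = π3 1 & π2 1 ∘ b = π3 2] /\
  [/\ π2 0 ∘ v = s ∘ a, π2 1 ∘ v = π3 2, π2 0 ∘ w = π3 0, π2 1 ∘ w = s ∘ b
    & s ∘ v = s ∘ w].
Proof.
have [|a [a0 a1]] := tang_pair2 (f := π3 0) (g := π3 1); first exact: tang_pπ.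
have [|b [b0 b1]] := tang_pair2 (f := π3 1) (g := π3 2); first exact: tang_pπ.
have [|v [v0 v1]] := tang_pair2 (f := s ∘ a) (g := π3 2).
  by rewrite compA tps -compA a0; exact: tang_pπ.
have [|w [w0 w1]] := tang_pair2 (f := π3 0) (g := s ∘ b).
  by rewrite compA tps -compA b0; exact: tang_pπ.
exists a, b, v, w; do 2 split=> //; exact: tsA a0 a1 b0 b1 v0 v1 w0 w1.
Qed.

Lemma tang_sC : exists a : tn A 2 ~> tn A 2,
  [/\ π2 0 ∘ a = π2 1, π2 1 ∘ a = π2 0 & s ∘ a = s].
Proof.
have [|a [a0 a1]] := tang_pair2 (f := π2 1) (g := π2 0); first exact: tang_pπ.
by exists a; split=> //; exact: tsC.
Qed.

Lemma tang_sz : exists a : T ~> tn A 2,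
  [/\ π2 0 ∘ a = tz A ∘ p, π2 1 ∘ a = idm T & s ∘ a = idm T].
Proof.
have [|a [a0 a1]] := tang_pair2 (f := tz A ∘ p) (g := idm T).
  by rewrite compA tpz comp_idl comp_idr.
by exists a; split=> //; exact: tsz.
Qed.

Lemma tang_pairT2 (S : Hom1 X X) (f g : S ~> T ⊚ T) :
  (T ◃ p) ∘ f = (T ◃ p) ∘ g ->
  exists h : S ~> T ⊚ tn A 2, (T ◃ π2 0) ∘ h = f /\ (T ◃ π2 1) ∘ h = g.
Proof.
move=> fg.
have [|h Hh] := wide_pullback_pair
  (q := fun i : 'I_2 => if val i is 0 then f else g) (tang_pbT 1).
  by apply: ord2P; apply: ord2P; rewrite /= ?fg.
by exists h; split; [exact: Hh o0 | exact: Hh o1].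
Qed.

Lemma tang_pl : (T ◃ p) ∘ tl A = eq_hom (esym (comp1_idr T)) ∘ (tz A ∘ p).
Proof. by rewrite tang_lwE -compA tpl. Qed.

Lemma tang_ls : exists a : tn A 2 ~> T ⊚ tn A 2,
  [/\ (T ◃ π2 0) ∘ a = tl A ∘ π2 0, (T ◃ π2 1) ∘ a = tl A ∘ π2 1
    & tl A ∘ s = (T ◃ s) ∘ a].
Proof.
have [|a [a0 a1]] := tang_pairT2 (f := tl A ∘ π2 0) (g := tl A ∘ π2 1).
  by rewrite !compA tang_pl -!compA (tang_pπ (@Ordinal 2 0 isT) o1).
by exists a; split=> //; apply: tls; exact: ord2P.
Qed.

Lemma tang_lift : exists a : tn A 2 ~> T ⊚ tn A 2,
  [/\ (T ◃ π2 0) ∘ a = tl A ∘ π2 0,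
      (T ◃ π2 1) ∘ a = rw_of_id (tz A) T ∘ π2 1
    & is_pointwise_pullback ((T ◃ s) ∘ a) (p ∘ π2 0) (lw_to_id T p) (tz A)].
Proof.
have [|a [a0 a1]] := tang_pairT2 (f := tl A ∘ π2 0)
    (g := rw_of_id (tz A) T ∘ π2 1).
  rewrite compA tang_pl.
  transitivity ((eq_hom (esym (comp1_idr T)) ∘ (tz A ∘ p)) ∘ π2 1).
    by rewrite -!compA (tang_pπ (@Ordinal 2 0 isT) o1).
  rewrite [RHS]compA; apply: (f_equal (fun f => f ∘ _)); rewrite /rw_of_id [RHS]compA.
  rewrite interchange lwhisk_id1E.
  have -> : tz A ▹ id1 X = eq_hom (esym (comp1_idr T)) ∘ (tz A
     ∘ eq_hom (comp1_idr (id1 X))) by apply: heq_conj; exact: rwhisk_id1.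
  by two_cell_coh.
by exists a; split=> //; exact: tlift.
Qed.
End Pairings.

(** * Evaluation at an object *)

Lemma eq_hom_heq (C : Category) (a b : C) (e : a = b) : eq_hom e ≈ idm a.
Proof. by case: b / e. Qed.

Lemma eq_hom_cartesian (E B : Category) (P : Functor E B) (x y : E)
  (e : x = y) : is_cartesian P (eq_hom e).
Proof.
case: y / e => w ψ g /=; rewrite fmap_id comp_idl => ->.
exists ψ; split; first by split=> //; exact: comp_idl.
by move=> χ [_]; rewrite comp_idl.
Qed.

(** Depending on [I], the empty or the terminal category. *)
Definition prop_cat (I : Prop) : Category.
Proof.
refine {| Ob := I; Hom := fun _ _ => unit; idm := fun _ => tt;
          comp := fun _ _ _ _ _ => tt |}.
- by move=> i j; case.
- by move=> i j; case.
- by [].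
Defined.

Definition prop_functor (I : Prop) (C : Category) (F : I -> C) :
  Functor (prop_cat I) C.
Proof.
refine {| fob := F : prop_cat I -> C;
  fmap := fun i j _ => eq_hom (f_equal F (proof_irrelevance I i j)) |}.
- by move=> i; exact: eq_hom_id.
- by move=> i j k _ _; rewrite eq_hom_comp; exact: eq_homK.
Defined.

Lemma prop_functor_hom (I : Prop) (C : Category) (F : Functor (prop_cat I) C)
  (i j : prop_cat I) (f : i ~> j) : F ◂ f ≈ idm (F i).
Proof.
rewrite -(proof_irrelevance I i j) in f *; rewrite -(fmap_id F).
by apply: heq_of_eq; congr fmap; case: f.
Qed.

(** A morphism from [over_point False] is an object of the base, a morphism from
    [over_point True] an object of the total category. Testing the pointwise
    limits of a tangent fibration against these two fibrations shows that they
    are computed componentwise. *)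
Definition over_point (I : Prop) : Fib.
Proof.
refine {| ftot := prop_cat I; fbase := prop_cat True;
  fproj := prop_functor (fun _ => Logic.I : prop_cat True) |}.
refine {| cl_ob := fun y a _ => y : prop_cat I;
          cl_hom := fun y a _ => idm (y : prop_cat I) |}.
move=> y a f; split.
  case: a f => f; case: f; rewrite fmap_id.
  by [].
move=> w ψ g _; exists ψ; split; last by move=> [] _; case: ψ.
split; last by case: ψ.
by case: (fmap _ _) g => -[].
Defined.

Section OverPoint.
Variables (I : Prop) (P : Fib).

Definition fib_object (M : fbase P) (x : I -> ftot P)
  (xM : forall i, fproj P (x i) = M) : Hom1 (over_point I) P.
Proof.
refine {| fm_base := prop_functor (fun _ => M)
            : Functor (fbase (over_point I)) (fbase P);
          fm_tot := prop_functor x : Functor (ftot (over_point I)) (ftot P) |}.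
- apply: functor_eq => i j f /=; rewrite fmap_eq_hom.
  apply: heq_trans (eq_hom_heq _) _; apply: heq_sym.
  by apply: heq_trans (eq_hom_heq _) _; rewrite xM.
- move=> a b f i j φ _; split; last exact: eq_hom_cartesian.
  rewrite /= fmap_eq_hom; apply: heq_trans (eq_hom_heq _) _; apply: heq_sym.
  by apply: heq_trans (eq_hom_heq _) _; rewrite xM.
Defined.

Variables F G : Hom1 (over_point I) P.

Definition fib_object_cell (f : fm_base F Logic.I ~> fm_base G Logic.I)
  (t : forall i : I, fm_tot F i ~> fm_tot G i)
  (tf : forall i, fproj P ◂ t i ≈ f) : F ~> G.
Proof.
unshelve refine {| fc_base := _; fc_tot := _ |}.
- unshelve refine (@Build_NatTrans (prop_cat True) _ (fm_base F) (fm_base G) _ _);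
    first by case.
  case=> -[] g; apply: heq_eq.
  apply: heq_trans (heq_idl _ (prop_functor_hom (fm_base G) g)) _.
  exact: heq_sym (heq_idr _ (prop_functor_hom (fm_base F) g)).
- refine (@Build_NatTrans (prop_cat I) _ (fm_tot F) (fm_tot G) t _).
  move=> i j g; apply: heq_eq.
  apply: heq_trans (heq_idl _ (prop_functor_hom (fm_tot G) g)) _.
  apply: heq_sym; rewrite (proof_irrelevance I j i) in g *.
  exact: (heq_idr _ (prop_functor_hom (fm_tot F) g)).
- by move=> i; exact: tf.
Defined.
End OverPoint.

Section Evaluation.
Variable P : Fib.

Definition eval_base : Functor (Hom1 (over_point False) P) (fbase P).
Proof.
by refine {| fob := fun F : Hom1 (over_point False) P => fm_base F Logic.I;
  fmap := fun F G φ => fc_base φ Logic.I |}.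
Defined.

Definition eval_tot : Functor (Hom1 (over_point True) P) (ftot P).
Proof.
by refine {| fob := fun F : Hom1 (over_point True) P => fm_tot F Logic.I;
  fmap := fun F G φ => fc_tot φ Logic.I |}.
Defined.

Lemma eval_base_surj M : exists F, eval_base F = M.
Proof.
by exists (@fib_object False P M (False_rect _) (fun i => match i with end)).
Qed.

Lemma eval_base_full F G (f : eval_base F ~> eval_base G) :
  exists φ, eval_base ◂ φ = f.
Proof.
by exists (fib_object_cell (F := F) (G := G) (f := f) (t := fun i => match i with end)
  (fun i => match i with end)).
Qed.

Lemma eval_base_faithful F G (φ ψ : F ~> G) :
  eval_base ◂ φ = eval_base ◂ ψ -> φ = ψ.
Proof. by move=> e; apply: fibcell_eq => -[]. Qed.

Lemma eval_tot_surj x : exists F, eval_tot F = x.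
Proof.
by exists (@fib_object True P (fproj P x) (fun _ => x) (fun i => erefl)).
Qed.

(** The base component of a cell is forced, being the image of the total one. *)
Lemma eval_tot_full F G (t : eval_tot F ~> eval_tot G) :
  exists φ, eval_tot ◂ φ = t.
Proof.
have eF : fproj P (fm_tot F Logic.I) = fm_base F Logic.I :=
  functor_eq_ob (Logic.I : ftot (over_point True)) (fm_comm F).
have eG : fproj P (fm_tot G Logic.I) = fm_base G Logic.I :=
  functor_eq_ob (Logic.I : ftot (over_point True)) (fm_comm G).
pose f := eq_hom eG ∘ (fproj P ◂ t ∘ eq_hom (esym eF)).
pose t' (i : True) : fm_tot F i ~> fm_tot G i := match i with Logic.I => t end.
have tf (i : True) : fproj P ◂ t' i ≈ f.
  case: i; apply: heq_sym; apply: heq_trans (heq_eq_hom_l _ _) _.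
  exact: heq_eq_hom_r.
by exists (fib_object_cell tf).
Qed.

Lemma eval_tot_faithful F G (φ ψ : F ~> G) :
  eval_tot ◂ φ = eval_tot ◂ ψ -> φ = ψ.
Proof.
move=> e; apply: fibcell_eq => -[] //; apply: heq_eq.
have := fc_comm φ (Logic.I : ftot (over_point True)).
have := fc_comm ψ (Logic.I : ftot (over_point True)).
rewrite /= in e *; rewrite e => H1 H2.
exact: heq_trans (heq_sym H2) H1.
Qed.
End Evaluation.

Section PointwiseLimits.
Variables (P Q : Fib) (I : Type) (L D : Hom1 P Q) (A : I -> Hom1 P Q)
  (f : forall i, A i ~> D) (pr : forall i, L ~> A i).

Lemma base_wide_pullback :
  (forall (X : Fib) (F : Hom1 X P),
    is_wide_pullback (fun i => f i ▹ F) (fun i => pr i ▹ F)) ->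
  forall M, is_wide_pullback (fun i => fc_base (f i) M)
                             (fun i => fc_base (pr i) M).
Proof.
move=> H M; have [F <-] := eval_base_surj M.
exact: wide_pullback_equivalence (@eval_base_surj Q) (@eval_base_full Q)
  (@eval_base_faithful Q) (H _ F).
Qed.

Lemma tot_wide_pullback :
  (forall (X : Fib) (F : Hom1 X P),
    is_wide_pullback (fun i => f i ▹ F) (fun i => pr i ▹ F)) ->
  forall x, is_wide_pullback (fun i => fc_tot (f i) x)
                             (fun i => fc_tot (pr i) x).
Proof.
move=> H x; have [F <-] := eval_tot_surj x.
exact: wide_pullback_equivalence (@eval_tot_surj Q) (@eval_tot_full Q)
  (@eval_tot_faithful Q) (H _ F).
Qed.

(** Conversely, the cell induced by a cone is computed componentwise; its two
    halves are compatible by the uniqueness in the base. *)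
Lemma wide_pullback_components :
  (forall M, is_wide_pullback (fun i => fc_base (f i) M)
                              (fun i => fc_base (pr i) M)) ->
  (forall x, is_wide_pullback (fun i => fc_tot (f i) x)
                              (fun i => fc_tot (pr i) x)) ->
  is_wide_pullback f pr.
Proof.
move=> Hb Ht; split.
  move=> i j; apply: fibcell_eq => a; first exact: (proj1 (Hb a)).
  exact: (proj1 (Ht a)).
move=> S q Hq.
have [hb Hhb] : exists h : forall M, fm_base S M ~> fm_base L M,
    forall M i, fc_base (pr i) M ∘ h M = fc_base (q i) M.
  apply: (@dep_choice _ _ (fun M h => forall i, fc_base (pr i) M ∘ h = fc_base (q i) M)).
  move=> M; apply: wide_pullback_pair (Hb M) _ => i j.
  exact: base_congr (Hq i j).
have [ht Hht] : exists h : forall x, fm_tot S x ~> fm_tot L x,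
    forall x i, fc_tot (pr i) x ∘ h x = fc_tot (q i) x.
  apply: (@dep_choice _ _ (fun x h => forall i, fc_tot (pr i) x ∘ h = fc_tot (q i) x)).
  move=> x; apply: wide_pullback_pair (Ht x) _ => i j.
  exact: tot_congr (Hq i j).
have nb M N (g : M ~> N) : fm_base L ◂ g ∘ hb M = hb N ∘ fm_base S ◂ g.
  apply: (wide_pullback_monic (Hb N)) => i.
  by rewrite !compA -nt_nat Hhb -compA Hhb nt_nat.
have nt x y (g : x ~> y) : fm_tot L ◂ g ∘ ht x = ht y ∘ fm_tot S ◂ g.
  apply: (wide_pullback_monic (Ht y)) => i.
  by rewrite !compA -nt_nat Hht -compA Hht nt_nat.
have eS x : fproj Q (fm_tot S x) = fm_base S (fproj P x)
  := functor_eq_ob x (fm_comm S).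
have eL x : fproj Q (fm_tot L x) = fm_base L (fproj P x)
  := functor_eq_ob x (fm_comm L).
have comm x : fproj Q ◂ ht x ≈ hb (fproj P x).
  have -> : hb (fproj P x) = eq_hom (eL x) ∘ (fproj Q ◂ ht x ∘ eq_hom (esym (eS x))).
    apply: (wide_pullback_monic (Hb _)) => i; rewrite Hhb; apply: heq_eq.
    apply: heq_trans (heq_sym (fc_comm (q i) x)) _; rewrite -Hht fmap_comp.
    apply: heq_comp; first exact: fc_comm.
    by apply: heq_sym; apply: heq_trans (heq_eq_hom_l _ _) (heq_eq_hom_r _ _).
  by apply: heq_sym; apply: heq_trans (heq_eq_hom_l _ _) (heq_eq_hom_r _ _).
exists ({| fc_base := Build_NatTrans nb; fc_tot := Build_NatTrans nt;
          fc_comm := comm |} : FibCell S L); split.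
  by move=> i; apply: fibcell_eq => a /=.
move=> k Hk; apply: fibcell_eq => a /=.
- apply: (wide_pullback_monic (Hb a)) => i; rewrite Hhb -(Hk i).
  by [].
- apply: (wide_pullback_monic (Ht a)) => i; rewrite Hht -(Hk i).
  by [].
Qed.
End PointwiseLimits.

Section PointwiseSquares.
Variables (P Q : Fib) (L A B D : Hom1 P Q) (a : L ~> A) (b : L ~> B)
  (f : A ~> D) (g : B ~> D).

Let A' (i : bool) : Hom1 P Q := if i then A else B.
Let f' i : A' i ~> D := if i return A' i ~> D then f else g.
Let pr' i : L ~> A' i := if i return L ~> A' i then a else b.

Lemma base_pullback : is_pointwise_pullback a b f g -> forall M,
  is_pullback (fc_base a M) (fc_base b M) (fc_base f M) (fc_base g M).
Proof.
move=> [_ H] M.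
apply/(is_pullbackE (fun i => fc_base (f' i) M) (fun i => fc_base (pr' i) M)).
apply: base_wide_pullback => X F.
by apply/(is_pullbackE (fun i => f' i ▹ F) (fun i => pr' i ▹ F)); exact: H.
Qed.

Lemma tot_pullback : is_pointwise_pullback a b f g -> forall x,
  is_pullback (fc_tot a x) (fc_tot b x) (fc_tot f x) (fc_tot g x).
Proof.
move=> [_ H] x.
apply/(is_pullbackE (fun i => fc_tot (f' i) x) (fun i => fc_tot (pr' i) x)).
apply: tot_wide_pullback => X F.
by apply/(is_pullbackE (fun i => f' i ▹ F) (fun i => pr' i ▹ F)); exact: H.
Qed.

Lemma pullback_components :
  (forall M, is_pullback (fc_base a M) (fc_base b M) (fc_base f M) (fc_base g M)) ->
  (forall x, is_pullback (fc_tot a x) (fc_tot b x) (fc_tot f x) (fc_tot g x)) ->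
  is_pointwise_pullback a b f g.
Proof.
move=> Hb Ht; split.
  apply/(is_pullbackE f' pr'); apply: wide_pullback_components => x.
  - by apply/(is_pullbackE (fun i => fc_base (f' i) x) (fun i => fc_base (pr' i) x)).
  - by apply/(is_pullbackE (fun i => fc_tot (f' i) x) (fun i => fc_tot (pr' i) x)).
move=> X F.
apply/(is_pullbackE (fun i => f' i ▹ F) (fun i => pr' i ▹ F)).
apply: wide_pullback_components => x.
- apply/(is_pullbackE (fun i => fc_base (f' i ▹ F) x) (fun i => fc_base (pr' i ▹ F) x)).
  exact: Hb.
- apply/(is_pullbackE (fun i => fc_tot (f' i ▹ F) x) (fun i => fc_tot (pr' i ▹ F) x)).
  exact: Ht.
Qed.
End PointwiseSquares.

(** * The two tangent categories of a tangent fibration *)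

(** Generalized elements factor through the universal pairings, which reduces
    the equations to those pairings. [T] preserves [T_n], because [tw] transports
    the universal property of [T_n (TM)] to [T (T_n M)]. *)
Lemma is_tangent_of_universal (C : Category) (T : Functor C C)
    (Tn : nat -> Functor C C) (p : NatTrans T (fid C)) (z : NatTrans (fid C) T)
    (π : forall n, 'I_n.+1 -> NatTrans (Tn n) T) (s : NatTrans (Tn 1) T)
    (l : NatTrans T (fcomp T T)) (c : NatTrans (fcomp T T) (fcomp T T)) :
  (forall n M, is_nfold_pullback (p M) (fun i => π n i M)) ->
  (forall n M, exists (θ : T (Tn n M) ~> Tn n (T M))
      (tw : Tn n (T M) ~> T (Tn n M)),
    [/\ forall i, π n i (T M) ∘ θ = c M ∘ T ◂ π n i M,
        forall i, T ◂ π n i M ∘ tw = c M ∘ π n i (T M) & tw ∘ θ = idm _]) ->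
  (forall M, p M ∘ z M = idm M) ->
  (forall M, p M ∘ s M = p M ∘ π 1 o0 M) ->
  (forall M, exists a b v w : Tn 2 M ~> Tn 1 M,
    [/\ π 1 o0 M ∘ a = π 2 (@Ordinal 3 0 isT) M,
        π 1 o1 M ∘ a = π 2 (@Ordinal 3 1 isT) M,
        π 1 o0 M ∘ b = π 2 (@Ordinal 3 1 isT) M &
        π 1 o1 M ∘ b = π 2 (@Ordinal 3 2 isT) M] /\
    [/\ π 1 o0 M ∘ v = s M ∘ a, π 1 o1 M ∘ v = π 2 (@Ordinal 3 2 isT) M,
        π 1 o0 M ∘ w = π 2 (@Ordinal 3 0 isT) M, π 1 o1 M ∘ w = s M ∘ b
      & s M ∘ v = s M ∘ w]) ->
  (forall M, exists a : Tn 1 M ~> Tn 1 M,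
    [/\ π 1 o0 M ∘ a = π 1 o1 M, π 1 o1 M ∘ a = π 1 o0 M & s M ∘ a = s M]) ->
  (forall M, exists a : T M ~> Tn 1 M,
    [/\ π 1 o0 M ∘ a = z M ∘ p M, π 1 o1 M ∘ a = idm (T M)
      & s M ∘ a = idm (T M)]) ->
  (forall M, T ◂ p M ∘ l M = z M ∘ p M) ->
  (forall M, l M ∘ z M = T ◂ z M ∘ z M) ->
  (forall M, exists a : Tn 1 M ~> T (Tn 1 M),
    [/\ T ◂ π 1 o0 M ∘ a = l M ∘ π 1 o0 M,
        T ◂ π 1 o1 M ∘ a = l M ∘ π 1 o1 M & l M ∘ s M = T ◂ s M ∘ a]) ->
  (forall M, p (T M) ∘ c M = T ◂ p M) ->
  (forall M, c M ∘ T ◂ z M = z (T M)) ->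
  (forall M, exists θ : T (Tn 1 M) ~> Tn 1 (T M),
    (forall i, π 1 i (T M) ∘ θ = c M ∘ T ◂ π 1 i M) /\
    c M ∘ T ◂ s M = s (T M) ∘ θ) ->
  (forall M, T ◂ l M ∘ l M = l (T M) ∘ l M) ->
  (forall M, c M ∘ l M = l M) ->
  (forall M, c (T M) ∘ T ◂ c M ∘ l (T M) = T ◂ l M ∘ c M) ->
  (forall M, c M ∘ c M = idm (T (T M))) ->
  (forall M, T ◂ c M ∘ c (T M) ∘ T ◂ c M = c (T M) ∘ T ◂ c M ∘ c (T M)) ->
  (forall M, exists u : Tn 1 M ~> T (Tn 1 M),
    [/\ T ◂ π 1 o0 M ∘ u = l M ∘ π 1 o0 M,
        T ◂ π 1 o1 M ∘ u = z (T M) ∘ π 1 o1 M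
      & is_pullback (T ◂ s M ∘ u) (p M ∘ π 1 o0 M) (T ◂ p M) (z M)]) ->
  is_tangent p z π s l c.
Proof.
move=> pb flip pz ps sA sC sz pl lz ls pc cz cs ll cl ccl cc ccc lift.
have monic n M : jointly_monic (fun i => π n i M).
  exact: wide_pullback_monic (pb n M).
have pTc M : T ◂ p M ∘ c M = p (T M) by rewrite -pc -compA cc comp_idr.
have pbT n M : is_nfold_pullback (T ◂ p M) (fun i => T ◂ π n i M).
  split; first by move=> i j; rewrite -!fmap_comp (proj1 (pb n M) i j).
  have [θ [tw [Hθ Htw twθ]]] := flip n M.
  move=> S q Hq.
  have [|h Hh] := wide_pullback_pair (q := fun i => c M ∘ q i) (pb n (T M)).
    by move=> i j; rewrite /= !compA pc (Hq i j).
  exists (tw ∘ h); split=> [i|k Hk].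
    by rewrite compA Htw -compA Hh compA cc comp_idl.
  rewrite -[k]comp_idl -twθ -compA; apply: (f_equal (comp _)).
  by apply: monic => i; rewrite Hh compA Hθ -compA Hk.
have monicT n M : jointly_monic (fun i => T ◂ π n i M).
  exact: wide_pullback_monic (pbT n M).
split=> //.
- by move=> M N f; rewrite -(nt_nat p).
- by move=> M N f; rewrite -(nt_nat z).
- by move=> n i M N f; rewrite -(nt_nat (π n i)).
- by move=> M N f; rewrite -(nt_nat s).
- by move=> M N f; rewrite -(nt_nat l).
- by move=> M N f; have /= -> := nt_nat c f.
- move=> M S a b v w e1 e2 e3 e4 e5.
  have [a' [b' [v' [w' [[a0 a1 b0 b1] [v0 v1 w0 w1 svw]]]]]] := sA M.
  have [|t Ht] := wide_pullback_pair (pb 2 M) (q := fun i =>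
    if val i is i'.+1 then π 1 (inord i') M ∘ b else π 1 o0 M ∘ a).
    have sp i j : p M ∘ π 1 i M = p M ∘ π 1 j M by exact: (proj1 (pb 1 M)).
    have E i : p M ∘ (if val i is i'.+1 then π 1 (inord i') M ∘ b
        else π 1 o0 M ∘ a) = p M ∘ (π 1 o1 M ∘ a).
      case: (val i) => [|k]; first by rewrite !compA (sp o0 o1).
      by rewrite e1 !compA (sp _ o0).
    by move=> i j; rewrite !E.
  have t0 : π 2 (@Ordinal 3 0 isT) M ∘ t = π 1 o0 M ∘ a by rewrite Ht.
  have t1 : π 2 (@Ordinal 3 1 isT) M ∘ t = π 1 o0 M ∘ b.
    rewrite Ht /=; congr (π 1 _ M ∘ b); apply: val_inj; exact: inordK.
  have t2 : π 2 (@Ordinal 3 2 isT) M ∘ t = π 1 o1 M ∘ b.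
    rewrite Ht /=; congr (π 1 _ M ∘ b); apply: val_inj; exact: inordK.
  have ea : a = a' ∘ t.
    by apply: monic; apply: ord2P; rewrite compA ?a0 ?a1 ?t0 ?t1.
  have eb : b = b' ∘ t.
    by apply: monic; apply: ord2P; rewrite compA ?b0 ?b1 ?t1 ?t2.
  have -> : v = v' ∘ t.
    apply: monic; apply: ord2P; rewrite compA ?v0 ?v1 ?t2 //.
    by rewrite -compA -ea.
  have -> : w = w' ∘ t.
    apply: monic; apply: ord2P; rewrite compA ?w0 ?w1 ?t0 //.
    by rewrite -compA -eb.
  by rewrite !compA svw.
- move=> M S a b e1 e2; have [u [u0 u1 su]] := sC M.
  have -> : a = u ∘ b by apply: monic; apply: ord2P; rewrite compA ?u0 ?u1.
  by rewrite compA su.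
- move=> M S a e; have [u [u0 u1 su]] := sz M.
  rewrite {1}(_ : a = u ∘ (π 1 o1 M ∘ a)); first by rewrite compA su comp_idl.
  apply: monic; apply: ord2P; rewrite compA ?u0 ?u1 ?comp_idl //.
  by rewrite e -compA.
- move=> M S a b e; have [u [u0 u1 lsu]] := ls M.
  have -> : b = u ∘ a.
    apply: monicT => i; rewrite e; move: i.
    by apply: ord2P; rewrite !compA ?u0 ?u1.
  by rewrite compA lsu -compA.
- move=> M S a b e; have [θ [Hθ csθ]] := cs M.
  have -> : b = θ ∘ a by apply: monic => i; rewrite e !compA Hθ.
  by rewrite !compA csθ.
- move=> M u e0 e1; have [u' [u0 u1 H]] := lift M.
  suff -> : u = u' by [].
  by apply: monicT; apply: ord2P; rewrite ?u0 ?u1.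
Qed.

Section TangentFibration.
Variable P : Tangentad Fib.
Local Notation A := (td_str P).

Lemma is_tangent_base : is_tangent (T := fm_base (T_ P))
  (Tn := fun n => fm_base (tn A n.+1)) (fc_base (p_ P)) (fc_base (z_ P))
  (fun n i => fc_base (tπ A i)) (fc_base (s_ P)) (fc_base (l_ P)) (fc_base (c_ P)).
Proof.
apply: (is_tangent_of_universal (T := fm_base (T_ P))
  (Tn := fun n => fm_base (tn A n.+1)) (p := fc_base (p_ P))
  (z := fc_base (z_ P)) (π := fun n i => fc_base (tπ A i))
  (s := fc_base (s_ P)) (l := fc_base (l_ P)) (c := fc_base (c_ P))).
- move=> n M; apply: (base_wide_pullback (f := fun _ => p_ P)) => X F.
  exact: tang_pb.
- move=> n M; have [θ [tw [h1 h2 h3]]] := tang_flip A n.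
  exists (fc_base θ M), (fc_base tw M); split.
  + by move=> i; have := base_congr M (h1 i).
  + by move=> i; have := base_congr M (h2 i).
  + exact: base_congr M h3.
- by move=> M; exact: base_congr M (tpz A).
- by move=> M; exact: base_congr M (tps A).
- move=> M; have [a [b [v [w [[a0 a1 b0 b1] [v0 v1 w0 w1 e]]]]]] := tang_sA A.
  exists (fc_base a M), (fc_base b M), (fc_base v M), (fc_base w M).
  by do 2 split; [move: a0|move: a1|move: b0|move: b1|move: v0|move: v1|move: w0|
    move: w1|move: e] => /(base_congr M).
- move=> M; have [a [a0 a1 e]] := tang_sC A; exists (fc_base a M).
  by split; [move: a0|move: a1|move: e] => /(base_congr M).
- move=> M; have [a [a0 a1 e]] := tang_sz A; exists (fc_base a M).
  by split; [move: a0|move: a1|move: e] => /(base_congr M).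
- by move=> M; have := base_congr M (tpl A); rewrite !base_cellE.
- by move=> M; have := base_congr M (tlz A); rewrite !base_cellE.
- move=> M; have [a [a0 a1 e]] := tang_ls A; exists (fc_base a M).
  by split; [move: a0|move: a1|move: e] => /(base_congr M).
- by move=> M; have := base_congr M (tpc A); rewrite !base_cellE.
- by move=> M; have := base_congr M (tcz A); rewrite !base_cellE.
- move=> M; have [θ [_ [h _ _]]] := tang_flip A 1; exists (fc_base θ M); split.
    by move=> i; have := base_congr M (h i).
  exact: base_congr M (tcs h).
- by move=> M; have := base_congr M (tll A); rewrite !base_cellE.
- by move=> M; exact: base_congr M (tcl A).
- by move=> M; have := base_congr M (tccl A); rewrite !base_cellE.
- by move=> M; exact: base_congr M (tcc A).
- by move=> M; have := base_congr M (tccc A); rewrite !base_cellE.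
- move=> M; have [a [a0 a1 e]] := tang_lift A; exists (fc_base a M).
  have e' := base_pullback e M; split.
  + exact: base_congr M a0.
  + by have := base_congr M a1; rewrite !base_cellE.
  + by move: e'; rewrite !base_cellE.
Qed.

Lemma is_tangent_tot : is_tangent (T := fm_tot (T_ P))
  (Tn := fun n => fm_tot (tn A n.+1)) (fc_tot (p_ P)) (fc_tot (z_ P))
  (fun n i => fc_tot (tπ A i)) (fc_tot (s_ P)) (fc_tot (l_ P)) (fc_tot (c_ P)).
Proof.
apply: (is_tangent_of_universal (T := fm_tot (T_ P))
  (Tn := fun n => fm_tot (tn A n.+1)) (p := fc_tot (p_ P))
  (z := fc_tot (z_ P)) (π := fun n i => fc_tot (tπ A i))
  (s := fc_tot (s_ P)) (l := fc_tot (l_ P)) (c := fc_tot (c_ P))).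
- move=> n M; apply: (tot_wide_pullback (f := fun _ => p_ P)) => X F.
  exact: tang_pb.
- move=> n M; have [θ [tw [h1 h2 h3]]] := tang_flip A n.
  exists (fc_tot θ M), (fc_tot tw M); split.
  + by move=> i; have := tot_congr M (h1 i).
  + by move=> i; have := tot_congr M (h2 i).
  + exact: tot_congr M h3.
- by move=> M; exact: tot_congr M (tpz A).
- by move=> M; exact: tot_congr M (tps A).
- move=> M; have [a [b [v [w [[a0 a1 b0 b1] [v0 v1 w0 w1 e]]]]]] := tang_sA A.
  exists (fc_tot a M), (fc_tot b M), (fc_tot v M), (fc_tot w M).
  by do 2 split; [move: a0|move: a1|move: b0|move: b1|move: v0|move: v1|move: w0|
    move: w1|move: e] => /(tot_congr M).
- move=> M; have [a [a0 a1 e]] := tang_sC A; exists (fc_tot a M).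
  by split; [move: a0|move: a1|move: e] => /(tot_congr M).
- move=> M; have [a [a0 a1 e]] := tang_sz A; exists (fc_tot a M).
  by split; [move: a0|move: a1|move: e] => /(tot_congr M).
- by move=> M; have := tot_congr M (tpl A); rewrite !tot_cellE.
- by move=> M; have := tot_congr M (tlz A); rewrite !tot_cellE.
- move=> M; have [a [a0 a1 e]] := tang_ls A; exists (fc_tot a M).
  by split; [move: a0|move: a1|move: e] => /(tot_congr M).
- by move=> M; have := tot_congr M (tpc A); rewrite !tot_cellE.
- by move=> M; have := tot_congr M (tcz A); rewrite !tot_cellE.
- move=> M; have [θ [_ [h _ _]]] := tang_flip A 1; exists (fc_tot θ M); split.
    by move=> i; have := tot_congr M (h i).
  exact: tot_congr M (tcs h).
- by move=> M; have := tot_congr M (tll A); rewrite !tot_cellE.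
- by move=> M; exact: tot_congr M (tcl A).
- by move=> M; have := tot_congr M (tccl A); rewrite !tot_cellE.
- by move=> M; exact: tot_congr M (tcc A).
- by move=> M; have := tot_congr M (tccc A); rewrite !tot_cellE.
- move=> M; have [a [a0 a1 e]] := tang_lift A; exists (fc_tot a M).
  have e' := tot_pullback e M; split.
  + exact: tot_congr M a0.
  + by have := tot_congr M a1; rewrite !tot_cellE.
  + by move: e'; rewrite !tot_cellE.
Qed.
End TangentFibration.

Lemma cell_ext (P Q : Fib) (F G : Hom1 P Q) (φ ψ : F ~> G) :
  (forall a, fc_base φ a = fc_base ψ a) ->
  (forall x, fc_tot φ x = fc_tot ψ x) -> φ = ψ.
Proof. exact: fibcell_eq. Qed.

Lemma base_iter1 (Q : Fib) (T : Hom1 Q Q) m :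
  fm_base (iter1 T m) = fiter (fm_base T) m.
Proof. by elim: m => //= m ->. Qed.

Lemma tot_iter1 (Q : Fib) (T : Hom1 Q Q) m :
  fm_tot (iter1 T m) = fiter (fm_tot T) m.
Proof. by elim: m => //= m ->. Qed.

Section OfSides.
Variables (Q : Fib) (T : Hom1 Q Q) (Tn : nat -> Hom1 Q Q) (p : T ~> id1 Q)
  (z : id1 Q ~> T) (π : forall n, 'I_n.+1 -> Tn n ~> T) (s : Tn 1 ~> T)
  (l : T ~> T ⊚ T) (c : T ⊚ T ~> T ⊚ T).
Hypothesis tgb : is_tangent (T := fm_base T) (Tn := fun n => fm_base (Tn n))
  (fc_base p) (fc_base z) (fun n i => fc_base (π i)) (fc_base s) (fc_base l)
  (fc_base c).
Hypothesis tgt : is_tangent (T := fm_tot T) (Tn := fun n => fm_tot (Tn n))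
  (fc_tot p) (fc_tot z) (fun n i => fc_tot (π i)) (fc_tot s) (fc_tot l)
  (fc_tot c).

(** The value in degree 0 is arbitrary. *)
Definition tangent_powers (n : nat) : Hom1 Q Q := if n is m.+1 then Tn m else T.

Definition tangent_projs (n : nat) : 'I_n -> tangent_powers n ~> T :=
  if n is m.+1 return 'I_n -> tangent_powers n ~> T then @π m
  else fun _ => idm T.

Lemma sides_pullback n : 0 < n ->
  is_pointwise_nfold_pullback p (tangent_projs (n := n)).
Proof.
case: n => // n _; split; first apply: (wide_pullback_components (f := fun _ => p)).
- exact: (tg_pb tgb).
- exact: (tg_pb tgt).
move=> X F; apply: (wide_pullback_components (f := fun _ => p ▹ F)) => a.
- exact: (tg_pb tgb n (fm_base F a)).
- exact: (tg_pb tgt n (fm_tot F a)).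
Qed.

Lemma sides_preserved n m : 0 < n ->
  is_nfold_pullback (fmap (postcomp Q (iter1 T m)) p)
    (fun i : 'I_n => fmap (postcomp Q (iter1 T m)) (tangent_projs i)).
Proof.
case: n => // n _.
apply: (wide_pullback_components (f := fun _ => iter1 T m ◃ p)) => a.
- by have := tg_pb_iter tgb m n a; rewrite -base_iter1.
- by have := tg_pb_iter tgt m n a; rewrite -tot_iter1.
Qed.

Lemma sides_lift (u : Tn 1 ~> T ⊚ Tn 1) :
  (T ◃ π o0) ∘ u = l ∘ π o0 ->
  (T ◃ π o1) ∘ u = rw_of_id z T ∘ π o1 ->
  is_pointwise_pullback ((T ◃ s) ∘ u) (p ∘ π o0) (lw_to_id T p) z.
Proof.
move=> u0 u1; apply: pullback_components => a; rewrite ?base_cellE ?tot_cellE.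
- apply: (tg_lift tgb); first exact: base_congr a u0.
  by have := base_congr a u1; rewrite !base_cellE.
- apply: (tg_lift tgt); first exact: tot_congr a u0.
  by have := tot_congr a u1; rewrite !tot_cellE.
Qed.

(** Every axiom is an equation between cells or a limit of cells, and both are
    decided componentwise. *)
Definition tangent_of_sides : TangentStructure Q.
Proof.
refine {| tT := T; tp := p; tz := z; tn := tangent_powers;
  tπ := tangent_projs; ts := s; tl := l; tc := c;
  tn_pullback := sides_pullback; tn_preserved := sides_preserved;
  tlift := sides_lift |}.
- by apply: cell_ext => a; [exact: tg_pz tgb a | exact: tg_pz tgt a].
- by apply: cell_ext => a; [exact: tg_ps tgb a | exact: tg_ps tgt a].
- move=> a b v w a0 a1 b0 b1 v0 v1 w0 w1; apply: cell_ext => M.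
  + apply: (tg_sA tgb (a := fc_base a M) (b := fc_base b M)).
    * exact: base_congr M (etrans a1 (esym b0)).
    * exact: base_congr M v0.
    * exact: base_congr M (etrans v1 (esym b1)).
    * exact: base_congr M (etrans w0 (esym a0)).
    * exact: base_congr M w1.
  + apply: (tg_sA tgt (a := fc_tot a M) (b := fc_tot b M)).
    * exact: tot_congr M (etrans a1 (esym b0)).
    * exact: tot_congr M v0.
    * exact: tot_congr M (etrans v1 (esym b1)).
    * exact: tot_congr M (etrans w0 (esym a0)).
    * exact: tot_congr M w1.
- move=> u u0 u1; apply: cell_ext => M.
  + rewrite -[RHS]comp_idr; apply: (tg_sC tgb); rewrite comp_idr.
      exact: base_congr M u0.
    exact: base_congr M u1.
  + rewrite -[RHS]comp_idr; apply: (tg_sC tgt); rewrite comp_idr.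
      exact: tot_congr M u0.
    exact: tot_congr M u1.
- move=> u u0 u1; apply: cell_ext => M.
  + have e1 := base_congr M u1; rewrite -[RHS]e1; apply: (tg_sz tgb).
    by have := base_congr M u0; rewrite [X in _ ∘ (_ ∘ X)]e1 comp_idr.
  + have e1 := tot_congr M u1; rewrite -[RHS]e1; apply: (tg_sz tgt).
    by have := tot_congr M u0; rewrite [X in _ ∘ (_ ∘ X)]e1 comp_idr.
- by apply: cell_ext => a; rewrite ?base_cellE ?tot_cellE;
    [exact: tg_pl tgb a | exact: tg_pl tgt a].
- by apply: cell_ext => a; rewrite ?base_cellE ?tot_cellE;
    [exact: tg_lz tgb a | exact: tg_lz tgt a].
- move=> u Hu; apply: cell_ext => M.
  + rewrite [LHS]base_comp -[X in _ ∘ X = _]comp_idr; apply: (tg_ls tgb) => i.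
    rewrite comp_idr.
    exact: base_congr M (Hu i).
  + rewrite [LHS]tot_comp -[X in _ ∘ X = _]comp_idr; apply: (tg_ls tgt) => i.
    rewrite comp_idr.
    exact: tot_congr M (Hu i).
- by apply: cell_ext => a; rewrite ?base_cellE ?tot_cellE;
    [exact: tg_pc tgb a | exact: tg_pc tgt a].
- by apply: cell_ext => a; rewrite ?base_cellE ?tot_cellE;
    [exact: tg_cz tgb a | exact: tg_cz tgt a].
- move=> u Hu; apply: cell_ext => M.
  + rewrite -[LHS]comp_idr -compA; apply: (tg_cs tgb) => i; rewrite comp_idr.
    exact: base_congr M (Hu i).
  + rewrite -[LHS]comp_idr -compA; apply: (tg_cs tgt) => i; rewrite comp_idr.
    exact: tot_congr M (Hu i).
- by apply: cell_ext => a; rewrite ?base_cellE ?tot_cellE;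
    [exact: tg_ll tgb a | exact: tg_ll tgt a].
- by apply: cell_ext => a; rewrite ?base_cellE ?tot_cellE;
    [exact: tg_cl tgb a | exact: tg_cl tgt a].
- by apply: cell_ext => a; rewrite ?base_cellE ?tot_cellE;
    [exact: tg_ccl tgb a | exact: tg_ccl tgt a].
- by apply: cell_ext => a; rewrite ?base_cellE ?tot_cellE;
    [exact: tg_cc tgb a | exact: tg_cc tgt a].
- by apply: cell_ext => a; rewrite ?base_cellE ?tot_cellE;
    [exact: tg_ccc tgb a | exact: tg_ccc tgt a].
Defined.
End OfSides.

(** * Cartesian arrows between vector fields *)

Section CartesianArrows.
Variables (E B : Category) (P : Functor E B).

Lemma cartesian_monic (x y w : E) (φ : x ~> y) (χ χ' : w ~> x) :
  is_cartesian P φ -> φ ∘ χ = φ ∘ χ' -> P ◂ χ = P ◂ χ' -> χ = χ'.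
Proof.
move=> H e Pe.
have [|h [_ Hh]] := H w (φ ∘ χ) (P ◂ χ); first by rewrite fmap_comp.
by rewrite -(Hh χ) // -(Hh χ').
Qed.

Lemma cartesian_comp_iso (x' x y : E) (φ : x ~> y) (χ : x' ~> x)
    (χ' : x ~> x') :
  χ' ∘ χ = idm x' -> χ ∘ χ' = idm x -> is_cartesian P φ ->
  is_cartesian P (φ ∘ χ).
Proof.
move=> χ'χ χχ' H w ψ g Hg.
have [|h [[Ph φh] Uh]] := H w ψ (P ◂ χ ∘ g); first by rewrite compA -fmap_comp.
exists (χ' ∘ h); split; first split.
- by rewrite fmap_comp Ph compA -fmap_comp χ'χ fmap_id comp_idl.
- by rewrite -compA (compA χ) χχ' comp_idl.
- move=> k [Pk φk].
  have -> : h = χ ∘ k by apply: Uh; rewrite fmap_comp Pk compA.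
  by rewrite compA χ'χ comp_idl.
Qed.

Lemma cartesian_lift_iso (x x' y : E) (φ : x ~> y) (φ' : x' ~> y) :
  is_cartesian P φ -> is_cartesian P φ' -> P ◂ φ ≈ P ◂ φ' ->
  exists (χ : x ~> x') (χ' : x' ~> x),
    [/\ χ' ∘ χ = idm x, χ ∘ χ' = idm x' & φ' ∘ χ = φ].
Proof.
move=> H H' e; have ex := heq_dom e.
have [|χ [[Pχ φχ] _]] := H' x φ (eq_hom ex).
  by apply: heq_eq; apply: heq_trans (heq_eq_hom_r _ _) (heq_sym e).
have [|χ' [[Pχ' φχ'] _]] := H x' φ' (eq_hom (esym ex)).
  by apply: heq_eq; apply: heq_trans (heq_eq_hom_r _ _) e.
exists χ, χ'; split=> //.
- apply: (cartesian_monic H); first by rewrite compA φχ' φχ comp_idr.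
  by rewrite fmap_comp Pχ Pχ' eq_hom_comp eq_hom_id fmap_id.
- apply: (cartesian_monic H'); first by rewrite compA φχ φχ' comp_idr.
  by rewrite fmap_comp Pχ Pχ' eq_hom_comp eq_hom_id fmap_id.
Qed.
End CartesianArrows.

Lemma fibmor_cartesian (P Q : Fib) (F : Hom1 P Q) (x y : ftot P) (φ : x ~> y) :
  is_cartesian (fproj P) φ -> is_cartesian (fproj Q) (fm_tot F ◂ φ).
Proof.
move=> H; have [|_ //] := @fm_cart _ _ F _ _ (fproj P ◂ φ) _ _ φ.
by split.
Qed.

Section CartesianVF.
Variable P : Tangentad Fib.
Local Notation Π := (fproj (tan_fib P)).
Local Notation T := (bT (tot_tangent P)).

Lemma T_cartesian (x y : ftot (tan_fib P)) (φ : x ~> y) :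
  is_cartesian Π φ -> is_cartesian Π (T ◂ φ).
Proof. by move=> H; exact (fibmor_cartesian (F := tan_fib_T P) H). Qed.

Lemma proj_T (x y : ftot (tan_fib P)) (φ : x ~> y) :
  Π ◂ (T ◂ φ) ≈ bT (base_tangent P) ◂ (Π ◂ φ).
Proof. exact: functor_eq_heq φ (fm_comm (tan_fib_T P)). Qed.

Lemma VF_proj_fieldE (E : VF (tot_tangent P)) :
  vf (vf_field (VF_proj P E)) ≈ Π ◂ vf (vf_field E).
Proof. exact: heq_eq_hom_l. Qed.

(** The arrow [χ] induced between the underlying objects commutes with the vector
    fields: as [Tφ] is Cartesian, this can be tested after [Tφ] and after [Π]. *)
Lemma cartesian_VF (E' E : VF (tot_tangent P)) (φ : E' ~> E) :
  is_cartesian Π (vf_hom φ) -> is_cartesian (VF_proj P) φ.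
Proof.
move=> H W ψ g /vf_hom_eq /= Hg.
have [χ [[Pχ φχ] Uχ]] := H _ (vf_hom ψ) (vf_hom g) Hg.
have homχ : T ◂ χ ∘ vf (vf_field W) = vf (vf_field E') ∘ χ.
  apply: (cartesian_monic (T_cartesian H)).
    rewrite compA -fmap_comp φχ (vf_homP ψ) compA (vf_homP φ).
    by rewrite -[RHS]compA φχ.
  apply: heq_eq; rewrite !fmap_comp.
  apply: heq_trans (_ : bT (base_tangent P) ◂ vf_hom g
    ∘ vf (vf_field (VF_proj P W)) ≈ _).
    apply: heq_comp; last exact: heq_sym (VF_proj_fieldE W).
    by rewrite -Pχ; exact: proj_T.
  rewrite (vf_homP g) Pχ; apply: heq_comp => //; exact: VF_proj_fieldE.
exists {| vf_hom := χ : vf_ob W ~> vf_ob E'; vf_homP := homχ |}; split.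
  by split; apply: vfhom_eq.
move=> k [/vf_hom_eq Pk /vf_hom_eq φk]; apply: vfhom_eq.
by apply: Uχ; split.
Qed.

(** The vector field [w] on [y] and the one on the base lift to the Cartesian
    arrow [φ : x → y], as [Tφ] is Cartesian over [T(Πφ)]; the lift is a section
    because [φ] is Cartesian. *)
Lemma cartesian_VF_exists (E : VF (tot_tangent P)) (N : VF (base_tangent P))
    (f : N ~> VF_proj P E) : exists (E' : VF (tot_tangent P)) (φ : E' ~> E),
  VF_proj P ◂ φ ≈ f /\ is_cartesian Π (vf_hom φ).
Proof.
case: N f => [N u] [/= f Hf].
have [x [φ [Πφ cart]]] : exists x (φ : x ~> vf_ob E), is_cartesian_lift Π f φ.
  exists (cl_ob (fcleavage (tan_fib P)) f).
  by exists (cl_hom (fcleavage (tan_fib P)) f); exact: cl_lift.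
have eN : Π x = N := heq_dom Πφ.
subst N; move/heq_eq: Πφ => Πφ; subst f.
have [|w [[Πw φw] _]] := T_cartesian cart (ψ := vf (vf_field E) ∘ φ)
  (g := eq_hom (esym (tan_fib_comm x)) ∘ vf u).
  apply: heq_eq; rewrite fmap_comp.
  apply: heq_trans (_ : bT (base_tangent P) ◂ (Π ◂ φ) ∘ vf u ≈ _).
    by apply: heq_comp; [exact: proj_T | exact: heq_eq_hom_l].
  by rewrite Hf; apply: heq_comp => //; exact: heq_eq_hom_l.
have w_sect : bp (tot_tangent P) x ∘ w = idm x.
  have pN (a b : tot_tangent P) (h : a ~> b) :
      bp (tot_tangent P) b ∘ T ◂ h = h ∘ bp (tot_tangent P) a.
    by rewrite -(nt_nat (bp (tot_tangent P))).
  apply: (cartesian_monic cart).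
    rewrite compA -pN -compA φw compA comp_idr -[RHS]comp_idl.
    have e := vf_sect (vf_field E); exact (f_equal (fun h => comp h φ) e).
  rewrite fmap_comp [RHS]fmap_id -(vf_sect u); apply: heq_eq.
  apply: heq_comp; first exact: (fc_comm (tan_fib_p P) x).
  by rewrite Πw; exact (heq_eq_hom_l _ _).
pose E' := Build_VFOb (Build_VectorField w_sect).
exists E', {| vf_hom := φ : vf_ob E' ~> vf_ob E; vf_homP := φw |}.
split; last by [].
apply: vfhom_heq => //; apply: vfob_eq => //=.
apply: heq_trans (heq_eq_hom_l _ _) _; rewrite Πw; exact (heq_eq_hom_l _ _).
Qed.

(** By uniqueness of Cartesian lifts, [φ] differs by an isomorphism from the lift
    constructed in [cartesian_VF_exists]. *)
Lemma VF_cartesian (E' E : VF (tot_tangent P)) (φ : E' ~> E) :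
  is_cartesian (VF_proj P) φ -> is_cartesian Π (vf_hom φ).
Proof.
move=> H; have [E0 [φ0 [e H0]]] := cartesian_VF_exists (VF_proj P ◂ φ).
have [χ [χ' [/vf_hom_eq χ'χ /vf_hom_eq χχ' /vf_hom_eq <-]]] :=
  cartesian_lift_iso H (cartesian_VF H0) (heq_sym e).
exact: cartesian_comp_iso χ'χ χχ' H0.
Qed.

Definition VF_cleavage : Cleavage (VF_proj P).
Proof.
have H (E : VF (tot_tangent P)) (N : VF (base_tangent P))
    (f : N ~> VF_proj P E) : {E' : VF (tot_tangent P) & {φ : E' ~> E |
      is_cartesian_lift (VF_proj P) f φ}}.
  have e := cartesian_VF_exists f.
  have [E' H'] := constructive_indefinite_description _ e; exists E'.
  have [φ [Hφ cφ]] := constructive_indefinite_description _ H'; exists φ.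
  by split=> //; exact: cartesian_VF.
refine {| cl_ob := fun E N f => projT1 (H E N f);
          cl_hom := fun E N f => proj1_sig (projT2 (H E N f)) |}.
by move=> E N f; exact: proj2_sig (projT2 (H E N f)).
Defined.
End CartesianVF.

(** * The tangent fibration of vector fields *)

Section VFFibration.
Variable P : Tangentad Fib.
Local Notation A := (td_str P).
Local Notation YB := (base_tangent P).
Local Notation YT := (tot_tangent P).
Local Notation Π := (fproj (tan_fib P)).

Definition VF_fib : Fib := VF_fibration (VF_cleavage P).

Lemma vf_fibmor_comm (Q : Fib) (FB : Functor (fbase Q) (VF YB))
    (FT : Functor (ftot Q) (VF YT)) :
  (forall x y (f : x ~> y),
    Π ◂ vf_hom (FT ◂ f) ≈ vf_hom (FB ◂ (fproj Q ◂ f))) ->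
  (forall x, Π ◂ vf (vf_field (FT x)) ≈ vf (vf_field (FB (fproj Q x)))) ->
  fcomp (VF_proj P) FT = fcomp FB (fproj Q).
Proof.
move=> Hf Hw.
have Hob x : VF_proj P (FT x) = FB (fproj Q x).
  apply: vfob_eq; first exact: heq_dom (Hf _ _ (idm x)).
  exact: heq_trans (VF_proj_fieldE _) (Hw x).
by apply: functor_eq => x y f; apply: (vfhom_heq (Hob x) (Hob y)); exact: Hf.
Qed.

(** Since Cartesian arrows between vector fields are detected on the underlying
    arrows, they are preserved as soon as the underlying functor sends Cartesian
    arrows to Cartesian arrows. *)
Definition vf_fibmor (Q : Fib) (FB : Functor (fbase Q) (VF YB))
  (FT : Functor (ftot Q) (VF YT))
  (Hf : forall x y (f : x ~> y),
    Π ◂ vf_hom (FT ◂ f) ≈ vf_hom (FB ◂ (fproj Q ◂ f)))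
  (Hw : forall x, Π ◂ vf (vf_field (FT x)) ≈ vf (vf_field (FB (fproj Q x))))
  (Hc : forall x y (φ : x ~> y), is_cartesian (fproj Q) φ ->
    is_cartesian Π (vf_hom (FT ◂ φ))) : Hom1 Q VF_fib.
Proof.
refine {| fm_base := FB : Functor (fbase Q) (fbase VF_fib);
          fm_tot := FT : Functor (ftot Q) (ftot VF_fib);
          fm_comm := vf_fibmor_comm Hf Hw |}.
move=> a b f x y φ [e cart]; split.
  apply: heq_trans (functor_eq_heq φ (vf_fibmor_comm Hf Hw)) _.
  exact (heq_fmap FB e).
by apply: cartesian_VF; exact: Hc.
Defined.

Definition vf_nat (C : Category) (Y : BundleCategory)
  (F G : Functor C (VF Y)) (α : forall a, F a ~> G a)
  (nat : forall a b (f : a ~> b),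
    vf_hom (G ◂ f) ∘ vf_hom (α a) = vf_hom (α b) ∘ vf_hom (F ◂ f)) :
  NatTrans F G.
Proof.
by refine {| nt := α |} => a b f; apply: vfhom_eq; exact: nat.
Defined.

Definition vf_fibcell (Q : Fib) (F G : Hom1 Q VF_fib)
  (αB : NatTrans (fm_base F) (fm_base G))
  (αT : NatTrans (fm_tot F) (fm_tot G))
  (H : forall x, Π ◂ vf_hom (αT x) ≈ vf_hom (αB (fproj Q x))) : F ~> G.
Proof.
refine {| fc_base := αB; fc_tot := αT |}.
move=> x; apply: (vfhom_heq (Y := YB)); last exact: H.
- exact: (functor_eq_ob x (fm_comm F)).
- exact: (functor_eq_ob x (fm_comm G)).
Defined.

Definition VF_forget_fib : Hom1 VF_fib (tan_fib P).
Proof.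
refine {| fm_base := VF_forget YB : Functor (fbase VF_fib) (fbase (tan_fib P));
          fm_tot := VF_forget YT : Functor (ftot VF_fib) (ftot (tan_fib P)) |}.
- exact: functor_eq.
- move=> a b f x y φ [e cart]; split; last exact: VF_cartesian.
  exact (heq_fmap (VF_forget YB) e).
Defined.

Definition VF_T_fib : Hom1 VF_fib VF_fib.
Proof.
apply: (@vf_fibmor VF_fib (VF_T YB) (VF_T YT)).
- by move=> E E' f; exact: proj_T.
- move=> E; rewrite /= fmap_comp; apply: heq_comp.
    exact: (fc_comm (tan_fib_c P) (vf_ob E)).
  apply: heq_trans (proj_T _) _; apply: heq_fmap; exact: heq_sym (VF_proj_fieldE E).
- by move=> E E' φ /VF_cartesian; exact: T_cartesian.
Defined.

Variable tw : forall n, tn A n.+1 ⊚ T_ P ~> T_ P ⊚ tn A n.+1.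
Hypothesis twπ : forall n (i : 'I_n.+1),
  (T_ P ◃ tπ A i) ∘ tw n = c_ P ∘ (tπ A i ▹ T_ P).

Local Notation TnB n := (fm_base (tn A n.+1) : Functor YB YB).
Local Notation TnT n := (fm_tot (tn A n.+1) : Functor YT YT).

Let twB n : NatTrans (fcomp (TnB n) (bT YB)) (fcomp (bT YB) (TnB n)) :=
  fc_base (tw n).
Let twT n : NatTrans (fcomp (TnT n) (bT YT)) (fcomp (bT YT) (TnT n)) :=
  fc_tot (tw n).

Lemma tgB : is_tangent (T := bT YB) (Tn := fun n => TnB n) (bp YB)
  (fc_base (z_ P)) (fun n i => fc_base (tπ A i)) (fc_base (s_ P))
  (fc_base (l_ P)) (bc YB).
Proof. exact: is_tangent_base. Qed.

Lemma tgT : is_tangent (T := bT YT) (Tn := fun n => TnT n) (bp YT)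
  (fc_tot (z_ P)) (fun n i => fc_tot (tπ A i)) (fc_tot (s_ P))
  (fc_tot (l_ P)) (bc YT).
Proof. exact: is_tangent_tot. Qed.

Lemma twπB n i (M : YB) : bT YB ◂ fc_base (tπ A i) M ∘ twB n M
  = bc YB M ∘ fc_base (tπ A i) (bT YB M).
Proof. exact: base_congr M (twπ i). Qed.

Lemma twπT n i (M : YT) : bT YT ◂ fc_tot (tπ A i) M ∘ twT n M
  = bc YT M ∘ fc_tot (tπ A i) (bT YT M).
Proof. exact: tot_congr M (twπ i). Qed.

Definition VF_Tn_fib (n : nat) : Hom1 VF_fib VF_fib.
Proof.
apply: (@vf_fibmor VF_fib (VF_Tn tgB twπB n) (VF_Tn tgT twπT n)).
- by move=> E E' f; exact: functor_eq_heq (vf_hom f) (fm_comm (tn A n.+1)).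
- move=> E; rewrite /= fmap_comp; apply: heq_comp.
    exact: (fc_comm (tw n) (vf_ob E)).
  apply: heq_trans (functor_eq_heq _ (fm_comm (tn A n.+1))) _.
  exact (heq_fmap (fm_base (tn A n.+1)) (heq_sym (VF_proj_fieldE E))).
- move=> E E' φ /VF_cartesian cart.
  exact (fibmor_cartesian (F := tn A n.+1) cart).
Defined.

Definition VF_p_fib : VF_T_fib ~> id1 VF_fib.
Proof.
exact (@vf_fibcell VF_fib (VF_T_fib) (id1 VF_fib)
  (vf_nat (Y := YB) (F := VF_T YB) (G := fid (VF YB)) (α := vf_p tgB)
    (fun M N f => nt_nat (fc_base (p_ P)) (vf_hom f)))
  (vf_nat (Y := YT) (F := VF_T YT) (G := fid (VF YT)) (α := vf_p tgT)
    (fun M N f => nt_nat (fc_tot (p_ P)) (vf_hom f)))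
  (fun E => fc_comm (p_ P) (vf_ob E))).
Defined.

Definition VF_z_fib : id1 VF_fib ~> VF_T_fib.
Proof.
exact (@vf_fibcell VF_fib (id1 VF_fib) (VF_T_fib)
  (vf_nat (Y := YB) (F := fid (VF YB)) (G := VF_T YB) (α := vf_z tgB)
    (fun M N f => nt_nat (fc_base (z_ P)) (vf_hom f)))
  (vf_nat (Y := YT) (F := fid (VF YT)) (G := VF_T YT) (α := vf_z tgT)
    (fun M N f => nt_nat (fc_tot (z_ P)) (vf_hom f)))
  (fun E => fc_comm (z_ P) (vf_ob E))).
Defined.

Definition VF_π_fib n (i : 'I_n.+1) : VF_Tn_fib n ~> VF_T_fib.
Proof.
exact (@vf_fibcell VF_fib (VF_Tn_fib n) (VF_T_fib)
  (vf_nat (Y := YB) (F := VF_Tn tgB twπB n) (G := VF_T YB) (α := vf_π tgB twπB i)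
    (fun M N f => nt_nat (fc_base (tπ A i)) (vf_hom f)))
  (vf_nat (Y := YT) (F := VF_Tn tgT twπT n) (G := VF_T YT) (α := vf_π tgT twπT i)
    (fun M N f => nt_nat (fc_tot (tπ A i)) (vf_hom f)))
  (fun E => fc_comm (tπ A i) (vf_ob E))).
Defined.

Definition VF_s_fib : VF_Tn_fib 1 ~> VF_T_fib.
Proof.
exact (@vf_fibcell VF_fib (VF_Tn_fib 1) (VF_T_fib)
  (vf_nat (Y := YB) (F := VF_Tn tgB twπB 1) (G := VF_T YB) (α := vf_s tgB twπB)
    (fun M N f => nt_nat (fc_base (s_ P)) (vf_hom f)))
  (vf_nat (Y := YT) (F := VF_Tn tgT twπT 1) (G := VF_T YT) (α := vf_s tgT twπT)
    (fun M N f => nt_nat (fc_tot (s_ P)) (vf_hom f)))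
  (fun E => fc_comm (s_ P) (vf_ob E))).
Defined.

Definition VF_l_fib : VF_T_fib ~> VF_T_fib ⊚ VF_T_fib.
Proof.
exact (@vf_fibcell VF_fib (VF_T_fib) (VF_T_fib ⊚ VF_T_fib)
  (vf_nat (Y := YB) (F := VF_T YB) (G := fcomp (VF_T YB) (VF_T YB)) (α := vf_l tgB)
    (fun M N f => nt_nat (fc_base (l_ P)) (vf_hom f)))
  (vf_nat (Y := YT) (F := VF_T YT) (G := fcomp (VF_T YT) (VF_T YT)) (α := vf_l tgT)
    (fun M N f => nt_nat (fc_tot (l_ P)) (vf_hom f)))
  (fun E => fc_comm (l_ P) (vf_ob E))).
Defined.

Definition VF_c_fib : VF_T_fib ⊚ VF_T_fib ~> VF_T_fib ⊚ VF_T_fib.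
Proof.
exact (@vf_fibcell VF_fib (VF_T_fib ⊚ VF_T_fib) (VF_T_fib ⊚ VF_T_fib)
  (vf_nat (Y := YB) (F := fcomp (VF_T YB) (VF_T YB))
    (G := fcomp (VF_T YB) (VF_T YB)) (α := vf_c tgB)
    (fun M N f => nt_nat (fc_base (c_ P)) (vf_hom f)))
  (vf_nat (Y := YT) (F := fcomp (VF_T YT) (VF_T YT))
    (G := fcomp (VF_T YT) (VF_T YT)) (α := vf_c tgT)
    (fun M N f => nt_nat (fc_tot (c_ P)) (vf_hom f)))
  (fun E => fc_comm (c_ P) (vf_ob E))).
Defined.

Definition VF_structure : TangentStructure VF_fib.
Proof.
apply: (@tangent_of_sides VF_fib VF_T_fib VF_Tn_fib VF_p_fib VF_z_fib
  VF_π_fib VF_s_fib VF_l_fib VF_c_fib).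
- exact (is_tangent_VF tgB twπB).
- exact (is_tangent_VF tgT twπT).
Defined.
End VFFibration.

(** * Lax tangent functors *)

(** Stated on bare categories, so that it serves both sides of a tangent
    fibration as well as the vector fields on either. *)
Record is_lax (C D : Category) (TC C2 : Functor C C) (TD D2 : Functor D D)
    (pC : forall a, TC a ~> a) (zC : forall a, a ~> TC a)
    (πC : 'I_2 -> forall a, C2 a ~> TC a) (sC : forall a, C2 a ~> TC a)
    (lC : forall a, TC a ~> TC (TC a)) (cC : forall a, TC (TC a) ~> TC (TC a))
    (pD : forall a, TD a ~> a) (zD : forall a, a ~> TD a)
    (πD : 'I_2 -> forall a, D2 a ~> TD a) (sD : forall a, D2 a ~> TD a)
    (lD : forall a, TD a ~> TD (TD a)) (cD : forall a, TD (TD a) ~> TD (TD a))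
    (F : Functor C D) (α : forall a, F (TC a) ~> TD (F a)) : Prop := {
  lax_p : forall a, pD (F a) ∘ α a = F ◂ pC a;
  lax_z : forall a, α a ∘ F ◂ zC a = zD (F a);
  lax_s : forall a (u : F (C2 a) ~> D2 (F a)),
    (forall i, πD i (F a) ∘ u = α a ∘ F ◂ πC i a) ->
    α a ∘ F ◂ sC a = sD (F a) ∘ u;
  lax_l : forall a, lD (F a) ∘ α a = TD ◂ α a ∘ α (TC a) ∘ F ◂ lC a;
  lax_c : forall a, cD (F a) ∘ (TD ◂ α a ∘ α (TC a))
                    = TD ◂ α a ∘ α (TC a) ∘ F ◂ cC a
}.

Section LaxComponents.
Variables A B : Tangentad Fib.

Definition base_is_lax (F : Hom1 A B) (α : F ⊚ T_ A ~> T_ B ⊚ F) : Prop :=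
  is_lax (TC := fm_base (T_ A)) (C2 := fm_base (tn (td_str A) 2))
    (TD := fm_base (T_ B)) (D2 := fm_base (tn (td_str B) 2))
    (fc_base (p_ A)) (fc_base (z_ A)) (fun i => fc_base (tπ (td_str A) i))
    (fc_base (s_ A)) (fc_base (l_ A)) (fc_base (c_ A))
    (fc_base (p_ B)) (fc_base (z_ B)) (fun i => fc_base (tπ (td_str B) i))
    (fc_base (s_ B)) (fc_base (l_ B)) (fc_base (c_ B)) (F := fm_base F)
    (fc_base α).

Definition tot_is_lax (F : Hom1 A B) (α : F ⊚ T_ A ~> T_ B ⊚ F) : Prop :=
  is_lax (TC := fm_tot (T_ A)) (C2 := fm_tot (tn (td_str A) 2))
    (TD := fm_tot (T_ B)) (D2 := fm_tot (tn (td_str B) 2))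
    (fc_tot (p_ A)) (fc_tot (z_ A)) (fun i => fc_tot (tπ (td_str A) i))
    (fc_tot (s_ A)) (fc_tot (l_ A)) (fc_tot (c_ A))
    (fc_tot (p_ B)) (fc_tot (z_ B)) (fun i => fc_tot (tπ (td_str B) i))
    (fc_tot (s_ B)) (fc_tot (l_ B)) (fc_tot (c_ B)) (F := fm_tot F)
    (fc_tot α).

Lemma lax_base (F : LaxMor A B) : base_is_lax (lm_cell F).
Proof.
split.
- by move=> a; have := base_congr a (lm_p F); rewrite !base_cellE.
- by move=> a; have := base_congr a (lm_z F); rewrite !base_cellE.
- move=> a u Hu; have [v Hv] := lm_pair F.
  have := base_congr a (lm_s Hv); rewrite !base_cellE => ->.
  apply: (f_equal (comp _)); apply: (tg_monic (is_tangent_base B)) => i /=.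
  by rewrite Hu; have := base_congr a (Hv i).
- by move=> a; have := base_congr a (lm_l F); rewrite !base_cellE.
- by move=> a; have := base_congr a (lm_c F); rewrite !base_cellE.
Qed.

Lemma lax_tot (F : LaxMor A B) : tot_is_lax (lm_cell F).
Proof.
split.
- by move=> a; have := tot_congr a (lm_p F); rewrite !tot_cellE.
- by move=> a; have := tot_congr a (lm_z F); rewrite !tot_cellE.
- move=> a u Hu; have [v Hv] := lm_pair F.
  have := tot_congr a (lm_s Hv); rewrite !tot_cellE => ->.
  apply: (f_equal (comp _)); apply: (tg_monic (is_tangent_tot B)) => i /=.
  by rewrite Hu; have := tot_congr a (Hv i).
- by move=> a; have := tot_congr a (lm_l F); rewrite !tot_cellE.
- by move=> a; have := tot_congr a (lm_c F); rewrite !tot_cellE.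
Qed.

Section OfComponents.
Variables (F : Hom1 A B) (α : F ⊚ T_ A ~> T_ B ⊚ F).
Hypotheses (Hb : base_is_lax α) (Ht : tot_is_lax α).

Definition lax_of_components : LaxMor A B.
Proof.
refine {| lm := F; lm_cell := α |}.
- by apply: cell_ext => a; rewrite ?base_cellE ?tot_cellE;
    [exact: (lax_p Hb) | exact: (lax_p Ht)].
- by apply: cell_ext => a; rewrite ?base_cellE ?tot_cellE;
    [exact: (lax_z Hb) | exact: (lax_z Ht)].
- move=> u Hu; apply: cell_ext => a.
  + by apply: (lax_s Hb) => i; exact: base_congr a (Hu i).
  + by apply: (lax_s Ht) => i; exact: tot_congr a (Hu i).
- by apply: cell_ext => a; rewrite ?base_cellE ?tot_cellE;
    [exact: (lax_l Hb) | exact: (lax_l Ht)].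
- by apply: cell_ext => a; rewrite ?base_cellE ?tot_cellE;
    [exact: (lax_c Hb) | exact: (lax_c Ht)].
Defined.
End OfComponents.

Lemma tanhom_of_components (F G : LaxMor A B) (φ : lm F ~> lm G) :
  (forall a, fm_base (T_ B) ◂ fc_base φ a ∘ fc_base (lm_cell F) a
    = fc_base (lm_cell G) a ∘ fc_base φ (fm_base (T_ A) a)) ->
  (forall x, fm_tot (T_ B) ◂ fc_tot φ x ∘ fc_tot (lm_cell F) x
    = fc_tot (lm_cell G) x ∘ fc_tot φ (fm_tot (T_ A) x)) ->
  (T_ B ◃ φ) ∘ lm_cell F = lm_cell G ∘ (φ ▹ T_ A).
Proof. by move=> Hb Ht; apply: cell_ext => a; [exact: Hb | exact: Ht]. Qed.
End LaxComponents.

Lemma laxmor_eq (K : TwoCategory) (A B : Tangentad K) (F G : LaxMor A B) :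
  lm F = lm G -> lm_cell F ≈ lm_cell G -> F = G.
Proof.
case: F G => [F α p1 z1 s1 l1 c1] [G β p2 z2 s2 l2 c2] /= e; subst G.
move=> /heq_eq e; subst β.
by rewrite (proof_irrelevance _ p1 p2) (proof_irrelevance _ z1 z2)
  (proof_irrelevance _ s1 s2) (proof_irrelevance _ l1 l2)
  (proof_irrelevance _ c1 c2).
Qed.

Lemma tanhom_heq (K : TwoCategory) (A B : Tangentad K) (F G F' G' : TngHom A B)
    (φ : F ~> G) (ψ : F' ~> G') :
  F = F' -> G = G' -> th φ ≈ th ψ -> φ ≈ ψ.
Proof.
by move=> eF eG; subst F' G' => /heq_eq e; apply/heq_of_eq/tanhom_eq.
Qed.

Lemma base_lax_comp (A B C : Tangentad Fib) (G : LaxMor B C) (F : LaxMor A B) a :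
  fc_base (lm_cell (lax_comp G F)) a
  = fc_base (lm_cell G) (fm_base (lm F) a) ∘ fm_base (lm G) ◂ fc_base (lm_cell F) a.
Proof. exact: base_comp_cell. Qed.

Lemma tot_lax_comp (A B C : Tangentad Fib) (G : LaxMor B C) (F : LaxMor A B) x :
  fc_tot (lm_cell (lax_comp G F)) x
  = fc_tot (lm_cell G) (fm_tot (lm F) x) ∘ fm_tot (lm G) ◂ fc_tot (lm_cell F) x.
Proof. exact: tot_comp_cell. Qed.

Lemma th_congr (K : TwoCategory) (A B : Tangentad K) (F G : LaxMor A B)
  (φ ψ : TanHom F G) : φ = ψ -> th φ = th ψ.
Proof. by move->. Qed.

Section LaxVF.
Variables (Y : BundleCategory) (Tn : nat -> Functor Y Y).
Local Notation T := (bT Y).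
Local Notation p := (bp Y).
Local Notation c := (bc Y).
Variables (z : forall M : Y, M ~> T M)
  (π : forall n, 'I_n.+1 -> forall M : Y, Tn n M ~> T M)
  (s : forall M : Y, Tn 1 M ~> T M) (l : forall M : Y, T M ~> T (T M)).
Arguments π : clear implicits.
Hypothesis tg : is_tangent (T := T) p z π s l c.
Variable tw : forall n, NatTrans (fcomp (Tn n) T) (fcomp T (Tn n)).
Hypothesis twπ : forall n i M, T ◂ π n i M ∘ tw n M = c M ∘ π n i (T M).

Lemma is_lax_forget : is_lax (TC := VF_T Y) (C2 := VF_Tn tg twπ 1) (TD := T)
  (D2 := Tn 1) (vf_p tg) (vf_z tg) (@vf_π _ _ _ _ _ _ tg _ twπ 1)
  (vf_s tg twπ) (vf_l tg) (vf_c tg) p z (π 1) s l c (F := VF_forget Y)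
  (fun M => idm (T (vf_ob M))).
Proof.
split=> [M|M|M u Hu|M|M] /=.
- exact: comp_idr.
- exact: comp_idl.
- rewrite comp_idl (_ : u = idm _) ?comp_idr //.
  by apply: (tg_monic tg) => i; rewrite comp_idr Hu /= comp_idl.
- by rewrite fmap_id !comp_idl comp_idr.
- by rewrite fmap_id !comp_idl comp_idr.
Qed.

(** The forgetful functor being faithful, the axioms for a lift to [VF Y] are
    those for the lifted functor. *)
Lemma is_lax_lift (C : Category) (TC C2 : Functor C C) pC zC πC sC lC cC
    (F : Functor C Y) (α : forall a, F (TC a) ~> T (F a))
    (w : NatTrans F (fcomp T F)) (w_sect : forall a, p (F a) ∘ w a = idm (F a))
    (γ : forall a, vf_lift w_sect (TC a) ~> VF_T Y (vf_lift w_sect a)) :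
  (forall a, vf_hom (γ a) = α a) ->
  is_lax (TC := TC) (C2 := C2) pC zC πC sC lC cC (TD := T) (D2 := Tn 1)
    p z (π 1) s l c (F := F) α ->
  is_lax (TC := TC) (C2 := C2) pC zC πC sC lC cC (TD := VF_T Y)
    (D2 := VF_Tn tg twπ 1) (vf_p tg) (vf_z tg) (@vf_π _ _ _ _ _ _ tg _ twπ 1)
    (vf_s tg twπ) (vf_l tg) (vf_c tg) (F := vf_lift w_sect) γ.
Proof.
move=> Hγ H; split=> [a|a|a u Hu|a|a]; apply: vfhom_eq; rewrite /= ?Hγ.
- exact: lax_p H a.
- exact: lax_z H a.
- apply: (lax_s H) => i; have := vf_hom_eq (Hu i).
  by rewrite /= Hγ.
- exact: lax_l H a.
- exact: lax_c H a.
Qed.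
End LaxVF.

(** * The universal vector field *)

Section UniversalVF.
Variable P : Tangentad Fib.
Local Notation A := (td_str P).
Local Notation YB := (base_tangent P).
Local Notation YT := (tot_tangent P).
Variable tw : forall n, tn A n.+1 ⊚ T_ P ~> T_ P ⊚ tn A n.+1.
Hypothesis twπ : forall n (i : 'I_n.+1),
  (T_ P ◃ tπ A i) ∘ tw n = c_ P ∘ (tπ A i ▹ T_ P).

Definition VF_tangentad : Tangentad Fib := Build_Tangentad (VF_structure twπ).

Lemma VF_forget_strict :
  VF_forget_fib P ⊚ VF_T_fib P = T_ P ⊚ VF_forget_fib P.
Proof. exact: fibmor_eq. Qed.

Definition VF_forget_cell :
  VF_forget_fib P ⊚ VF_T_fib P ~> T_ P ⊚ VF_forget_fib P :=
  eq_hom VF_forget_strict.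

Lemma base_forget_cell M : fc_base VF_forget_cell M = idm (bT YB (vf_ob M)).
Proof. by apply: heq_eq; exact: fc_base_eq_hom. Qed.

Lemma tot_forget_cell E : fc_tot VF_forget_cell E = idm (bT YT (vf_ob E)).
Proof. by apply: heq_eq; exact: fc_tot_eq_hom. Qed.

Lemma base_is_lax_forget : base_is_lax (A := VF_tangentad) VF_forget_cell.
Proof.
rewrite /base_is_lax.
have -> : nt (fc_base VF_forget_cell) = fun M => idm (bT YB (vf_ob M)).
  by apply: functional_extensionality_dep; exact: base_forget_cell.
exact (is_lax_forget (tgB P) (twπB twπ)).
Qed.

Lemma tot_is_lax_forget : tot_is_lax (A := VF_tangentad) VF_forget_cell.
Proof.
rewrite /tot_is_lax.
have -> : nt (fc_tot VF_forget_cell) = fun M => idm (bT YT (vf_ob M)).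
  by apply: functional_extensionality_dep; exact: tot_forget_cell.
exact (is_lax_forget (tgT P) (twπT twπ)).
Qed.

Definition VF_forget_lax : LaxMor VF_tangentad P :=
  lax_of_components base_is_lax_forget tot_is_lax_forget.

Definition VF_tautological_cell :
  VF_forget_fib P ~> T_ P ⊚ VF_forget_fib P.
Proof.
unshelve refine ({| fc_base := _; fc_tot := _ |} : FibCell _ _).
- refine (@Build_NatTrans (VF YB) _ (VF_forget YB) (fcomp (bT YB) (VF_forget YB))
    (fun M => vf (vf_field M)) _).
  by move=> M N f; exact: vf_homP.
- refine (@Build_NatTrans (VF YT) _ (VF_forget YT) (fcomp (bT YT) (VF_forget YT))
    (fun M => vf (vf_field M)) _).
  by move=> M N f; exact: vf_homP.
- by move=> E; exact: heq_sym (VF_proj_fieldE E).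
Defined.

(** The tautological field is a tangent 2-morphism because the vector field on
    [T(M, v)] is [c ∘ Tv], and [c ∘ c = id]. *)
Definition VF_tautological :
  TanHom VF_forget_lax (lax_comp (lax_T P) VF_forget_lax).
Proof.
refine (@Build_TanHom Fib VF_tangentad P VF_forget_lax
  (lax_comp (lax_T P) VF_forget_lax) VF_tautological_cell _).
apply: tanhom_of_components => a.
- have e : fc_base (lm_cell (lax_comp (lax_T P) VF_forget_lax)) a
      = bc YB (vf_ob a).
    refine (etrans (base_lax_comp (lax_T P) VF_forget_lax a) _).
    refine (etrans (f_equal (fun h => bc YB (vf_ob a) ∘ bT YB ◂ h)
      (base_forget_cell a)) _).
    by rewrite fmap_id comp_idr.
  refine (etrans (f_equal (comp _) (base_forget_cell a)) _).
  apply: etrans (comp_idr _) _; apply: esym.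
  refine (etrans (f_equal (fun h => comp h _) e) _).
  refine (etrans (compA _ _ _) _).
  exact (etrans (f_equal (fun h => comp h _) (tg_cc (tgB P) _)) (comp_idl _)).
- have e : fc_tot (lm_cell (lax_comp (lax_T P) VF_forget_lax)) a
      = bc YT (vf_ob a).
    refine (etrans (tot_lax_comp (lax_T P) VF_forget_lax a) _).
    refine (etrans (f_equal (fun h => bc YT (vf_ob a) ∘ bT YT ◂ h)
      (tot_forget_cell a)) _).
    by rewrite fmap_id comp_idr.
  refine (etrans (f_equal (comp _) (tot_forget_cell a)) _).
  apply: etrans (comp_idr _) _; apply: esym.
  refine (etrans (f_equal (fun h => comp h _) e) _).
  refine (etrans (compA _ _ _) _).
  exact (etrans (f_equal (fun h => comp h _) (tg_cc (tgT P) _)) (comp_idl _)).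
Defined.

Definition VF_universal :
  VectorField (Y := HomTan VF_tangentad P) VF_forget_lax.
Proof.
refine (@Build_VectorField (HomTan VF_tangentad P) VF_forget_lax
  VF_tautological _).
apply: tanhom_eq; apply: cell_ext => a.
- refine (etrans (f_equal (fun h => comp h _)
    (base_rw_to_id (p_ P) (VF_forget_fib P) a)) _); exact (vf_sect (vf_field a)).
- refine (etrans (f_equal (fun h => comp h _)
    (tot_rw_to_id (p_ P) (VF_forget_fib P) a)) _); exact (vf_sect (vf_field a)).
Defined.

Lemma VF_forget_is_strict : is_strict VF_forget_lax.
Proof. by exists VF_forget_strict. Qed.

Lemma VF_universal_is_VF : is_VF_tangent_fibration (cl := VF_cleavage P)
  (S := VF_structure twπ) (U := VF_forget_lax) VF_universal.
Proof.
split; [by split | exact: VF_forget_is_strict | by split |].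
by split=> *; exact: heq_refl.
Qed.
End UniversalVF.

(** * The universal property *)

Section Lift.
Variable P : Tangentad Fib.
Local Notation A := (td_str P).
Local Notation YB := (base_tangent P).
Local Notation YT := (tot_tangent P).
Variable X : Tangentad Fib.

Section LiftOb.
Variables (F : LaxMor X P) (w : TanHom F (lax_comp (lax_T P) F)).
Hypothesis w_sect : rw_to_id (p_ P) (lm F) ∘ th w = idm (lm F).

Let FB : Functor (fbase (td_ob X)) YB := fm_base (lm F).
Let FT : Functor (ftot (td_ob X)) YT := fm_tot (lm F).
Let wB : NatTrans FB (fcomp (bT YB) FB) := fc_base (th w).
Let wT : NatTrans FT (fcomp (bT YT) FT) := fc_tot (th w).

Lemma lift_sectB a : bp YB (FB a) ∘ wB a = idm (FB a).
Proof. by have := base_congr a w_sect; rewrite base_comp base_rw_to_id. Qed.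

Lemma lift_sectT x : bp YT (FT x) ∘ wT x = idm (FT x).
Proof. by have := tot_congr x w_sect; rewrite tot_comp tot_rw_to_id. Qed.

Definition lift_mor : Hom1 (td_ob X) (VF_fib P).
Proof.
apply: (@vf_fibmor P (td_ob X) (vf_lift lift_sectB) (vf_lift lift_sectT)).
- by move=> x y f; exact: functor_eq_heq f (fm_comm (lm F)).
- by move=> x; exact: (fc_comm (th w) x).
- by move=> x y φ cart; exact (fibmor_cartesian (F := lm F) cart).
Defined.

(** That [α] commutes with the vector fields is the condition on [w] to be a
    tangent 2-morphism, up to the flip. *)
Lemma lift_cellB_hom a :
  bT YB ◂ fc_base (lm_cell F) a ∘ wB (fm_base (T_ X) a)
  = (bc YB (FB a) ∘ bT YB ◂ wB a) ∘ fc_base (lm_cell F) a.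
Proof.
have := base_congr a (thP w).
rewrite base_comp [RHS]base_comp base_lwhisk base_rwhisk base_lax_comp => e.
rewrite -compA; refine (etrans _ (f_equal (comp (bc YB (FB a))) (esym e))).
refine (esym (etrans (compA _ _ _) _)).
refine (f_equal (fun h => comp h _) _).
refine (etrans (compA _ _ _) _).
exact (etrans (f_equal (fun h => comp h _) (tg_cc (tgB P) _)) (comp_idl _)).
Qed.

Lemma lift_cellT_hom x :
  bT YT ◂ fc_tot (lm_cell F) x ∘ wT (fm_tot (T_ X) x)
  = (bc YT (FT x) ∘ bT YT ◂ wT x) ∘ fc_tot (lm_cell F) x.
Proof.
have := tot_congr x (thP w).
rewrite tot_comp [RHS]tot_comp tot_lwhisk tot_rwhisk tot_lax_comp => e.
rewrite -compA; refine (etrans _ (f_equal (comp (bc YT (FT x))) (esym e))).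
refine (esym (etrans (compA _ _ _) _)).
refine (f_equal (fun h => comp h _) _).
refine (etrans (compA _ _ _) _).
exact (etrans (f_equal (fun h => comp h _) (tg_cc (tgT P) _)) (comp_idl _)).
Qed.

Definition lift_cellB a :
  vf_lift lift_sectB (fm_base (T_ X) a) ~> VF_T YB (vf_lift lift_sectB a) :=
  @Build_VFHom YB (vf_lift lift_sectB (fm_base (T_ X) a))
    (VF_T YB (vf_lift lift_sectB a)) (fc_base (lm_cell F) a) (lift_cellB_hom a).

Definition lift_cellT x :
  vf_lift lift_sectT (fm_tot (T_ X) x) ~> VF_T YT (vf_lift lift_sectT x) :=
  @Build_VFHom YT (vf_lift lift_sectT (fm_tot (T_ X) x))
    (VF_T YT (vf_lift lift_sectT x)) (fc_tot (lm_cell F) x) (lift_cellT_hom x).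

Definition lift_cell : lift_mor ⊚ T_ X ~> VF_T_fib P ⊚ lift_mor.
Proof.
exact (@vf_fibcell P (td_ob X) (lift_mor ⊚ T_ X) (VF_T_fib P ⊚ lift_mor)
  (vf_nat (Y := YB) (F := fcomp (vf_lift lift_sectB) (fm_base (T_ X)))
    (G := fcomp (VF_T YB) (vf_lift lift_sectB)) (α := lift_cellB)
    (fun a b f => nt_nat (fc_base (lm_cell F)) f))
  (vf_nat (Y := YT) (F := fcomp (vf_lift lift_sectT) (fm_tot (T_ X)))
    (G := fcomp (VF_T YT) (vf_lift lift_sectT)) (α := lift_cellT)
    (fun a b f => nt_nat (fc_tot (lm_cell F)) f))
  (fun x => fc_comm (lm_cell F) x)).
Defined.

Variable tw : forall n, tn A n.+1 ⊚ T_ P ~> T_ P ⊚ tn A n.+1.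
Hypothesis twπ : forall n (i : 'I_n.+1),
  (T_ P ◃ tπ A i) ∘ tw n = c_ P ∘ (tπ A i ▹ T_ P).

Definition lift_lax : LaxMor X (VF_tangentad twπ).
Proof.
apply: (@lax_of_components X (VF_tangentad twπ) lift_mor lift_cell).
- exact (is_lax_lift (tgB P) (twπB twπ) (γ := lift_cellB) (fun a => erefl)
    (lax_base F)).
- exact (is_lax_lift (tgT P) (twπT twπ) (γ := lift_cellT) (fun a => erefl)
    (lax_tot F)).
Defined.
End LiftOb.

Variable tw : forall n, tn A n.+1 ⊚ T_ P ~> T_ P ⊚ tn A n.+1.
Hypothesis twπ : forall n (i : 'I_n.+1),
  (T_ P ◃ tπ A i) ∘ tw n = c_ P ∘ (tπ A i ▹ T_ P).
Local Notation V := (VF_tangentad twπ).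

Lemma field_sect (N : VF (HomTan X P)) :
  rw_to_id (p_ P) (lm (vf_ob N)) ∘ th (vf (vf_field N)) = idm (lm (vf_ob N)).
Proof. exact (th_congr (vf_sect (vf_field N))). Qed.

Definition lift_ob (N : VF (HomTan X P)) : TngHom X V :=
  lift_lax (field_sect N) twπ.

Section LiftHom.
Variables (N N' : VF (HomTan X P)) (f : N ~> N').
Let φ : TanHom (vf_ob N) (vf_ob N') := vf_hom f.

Lemma lift_homB a :
  bT YB ◂ fc_base (th φ) a ∘ fc_base (th (vf (vf_field N))) a
  = fc_base (th (vf (vf_field N'))) a ∘ fc_base (th φ) a.
Proof.
exact (base_congr a (th_congr (vf_homP f))).
Qed.

Lemma lift_homT x :
  bT YT ◂ fc_tot (th φ) x ∘ fc_tot (th (vf (vf_field N))) x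
  = fc_tot (th (vf (vf_field N'))) x ∘ fc_tot (th φ) x.
Proof.
exact (tot_congr x (th_congr (vf_homP f))).
Qed.

Definition lift_hom_cell : lift_mor (field_sect N) ~> lift_mor (field_sect N') :=
  @vf_fibcell P (td_ob X) (lift_mor (field_sect N)) (lift_mor (field_sect N'))
  (vf_nat (Y := YB) (F := vf_lift (lift_sectB (field_sect N)))
    (G := vf_lift (lift_sectB (field_sect N')))
    (α := fun a => @Build_VFHom YB (vf_lift (lift_sectB (field_sect N)) a)
      (vf_lift (lift_sectB (field_sect N')) a) (fc_base (th φ) a) (lift_homB a))
    (fun a b g => nt_nat (fc_base (th φ)) g))
  (vf_nat (Y := YT) (F := vf_lift (lift_sectT (field_sect N)))
    (G := vf_lift (lift_sectT (field_sect N')))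
    (α := fun x => @Build_VFHom YT (vf_lift (lift_sectT (field_sect N)) x)
      (vf_lift (lift_sectT (field_sect N')) x) (fc_tot (th φ) x) (lift_homT x))
    (fun x y g => nt_nat (fc_tot (th φ)) g))
  (fun x => fc_comm (th φ) x).

Definition lift_hom : lift_ob N ~> lift_ob N'.
Proof.
refine (@Build_TanHom Fib X V (lift_ob N) (lift_ob N') lift_hom_cell _).
apply: tanhom_of_components => a; apply: vfhom_eq.
- exact: base_congr a (thP φ).
- exact: tot_congr a (thP φ).
Defined.
End LiftHom.

(** The inverse of the comparison functor: a tangent 2-morphism [w : F ⇒ TF]
    which is a section of [p] is a family of vector fields [w_a] on [F a], hence
    a lift of [F] to vector fields. *)
Definition lift_functor : Functor (VF (HomTan X P)) (TngHom X V).
Proof.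
refine {| fob := lift_ob; fmap := lift_hom |}.
- by move=> N; apply: tanhom_eq; apply: cell_ext => a; apply: vfhom_eq.
- by move=> N N' N'' g f; apply: tanhom_eq; apply: cell_ext => a; apply: vfhom_eq.
Defined.
End Lift.

Section GammaInverse.
Variable P : Tangentad Fib.
Local Notation A := (td_str P).
Local Notation YB := (base_tangent P).
Local Notation YT := (tot_tangent P).
Variable X : Tangentad Fib.
Variable tw : forall n, tn A n.+1 ⊚ T_ P ~> T_ P ⊚ tn A n.+1.
Hypothesis twπ : forall n (i : 'I_n.+1),
  (T_ P ◃ tπ A i) ∘ tw n = c_ P ∘ (tπ A i ▹ T_ P).
Local Notation V := (VF_tangentad twπ).
Local Notation U := (VF_forget_lax twπ).
Local Notation v := (VF_universal twπ).
Local Notation Γ := (Gamma v X).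
Local Notation Λ := (lift_functor X twπ).

Lemma base_restrict (H : LaxMor X V) a :
  fc_base (th (vf (vf_restrict v H))) a
  ≈ vf (vf_field (fm_base (lm H) a : VF YB)).
Proof. by apply: heq_idl; exact: fc_base_eq_hom. Qed.

Lemma tot_restrict (H : LaxMor X V) x :
  fc_tot (th (vf (vf_restrict v H))) x
  ≈ vf (vf_field (fm_tot (lm H) x : VF YT)).
Proof. by apply: heq_idl; exact: fc_tot_eq_hom. Qed.

Lemma base_forget_comp (H : LaxMor X V) a :
  fc_base (lm_cell (lax_comp U H)) a = vf_hom (fc_base (lm_cell H) a).
Proof.
rewrite base_lax_comp.
exact (etrans (f_equal (fun h => comp h _) (base_forget_cell _)) (comp_idl _)).
Qed.

Lemma tot_forget_comp (H : LaxMor X V) x :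
  fc_tot (lm_cell (lax_comp U H)) x = vf_hom (fc_tot (lm_cell H) x).
Proof.
rewrite tot_lax_comp.
exact (etrans (f_equal (fun h => comp h _) (tot_forget_cell _)) (comp_idl _)).
Qed.

Lemma base_lift_cell (N : VF (HomTan X P)) a :
  vf_hom (fc_base (lm_cell (Λ N)) a) = fc_base (lm_cell (vf_ob N)) a.
Proof. by []. Qed.

Lemma tot_lift_cell (N : VF (HomTan X P)) x :
  vf_hom (fc_tot (lm_cell (Λ N)) x) = fc_tot (lm_cell (vf_ob N)) x.
Proof. by []. Qed.

Lemma forget_lift_mor (N : VF (HomTan X P)) :
  lm (lax_comp U (Λ N)) = lm (vf_ob N).
Proof. exact: fibmor_eq. Qed.

Lemma forget_lift (N : VF (HomTan X P)) : lax_comp U (Λ N) = vf_ob N.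
Proof.
apply: (laxmor_eq (forget_lift_mor N)).
apply: fibcell_heq.
- exact (f_equal (fun F : Hom1 X P => fib_comp F (T_ X)) (forget_lift_mor N)).
- exact (f_equal (fun F : Hom1 X P => fib_comp (T_ P) F) (forget_lift_mor N)).
- move=> a; apply: heq_of_eq; exact: base_forget_comp.
- move=> x; apply: heq_of_eq; exact: tot_forget_comp.
Qed.

Lemma Gamma_lift_ob (N : VF (HomTan X P)) : Γ (Λ N) = N.
Proof.
apply: vfob_eq; first exact: forget_lift.
apply: (tanhom_heq (forget_lift N)).
  exact (f_equal (bT (HomTan X P)) (forget_lift N)).
apply: fibcell_heq.
- exact: forget_lift_mor.
- exact (f_equal (fun F : Hom1 X P => fib_comp (T_ P) F) (forget_lift_mor N)).
- by move=> a; exact: base_restrict.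
- by move=> x; exact: tot_restrict.
Qed.

Lemma Gamma_lift : fcomp Γ Λ = fid (VF (HomTan X P)).
Proof.
apply: functor_eq => N N' f.
apply: (vfhom_heq (Gamma_lift_ob N) (Gamma_lift_ob N')).
apply: (tanhom_heq (forget_lift N) (forget_lift N')).
apply: fibcell_heq; [exact: forget_lift_mor|exact: forget_lift_mor| |].
- by move=> a; exact: heq_refl.
- by move=> x; exact: heq_refl.
Qed.

Lemma base_lift_Gamma_ob (H : TngHom X V) a :
  fm_base (lm (Λ (Γ H))) a = fm_base (lm H) a.
Proof. apply: vfob_eq; first by []. exact: base_restrict. Qed.

Lemma tot_lift_Gamma_ob (H : TngHom X V) x :
  fm_tot (lm (Λ (Γ H))) x = fm_tot (lm H) x.
Proof. apply: vfob_eq; first by []. exact: tot_restrict. Qed.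

Lemma lift_Gamma_mor (H : TngHom X V) : lm (Λ (Γ H)) = lm H.
Proof.
apply: fibmor_eq => a b f.
- apply: (vfhom_heq (base_lift_Gamma_ob H a) (base_lift_Gamma_ob H b)).
  exact: heq_refl.
- apply: (vfhom_heq (tot_lift_Gamma_ob H a) (tot_lift_Gamma_ob H b)).
  exact: heq_refl.
Qed.

Lemma base_lift_Gamma_cell (H : TngHom X V) a :
  vf_hom (fc_base (lm_cell (Λ (Γ H))) a) ≈ vf_hom (fc_base (lm_cell H) a).
Proof.
have e1 := heq_of_eq (base_lift_cell (Γ H) a).
have e2 := heq_of_eq (base_forget_comp H a).
exact (heq_trans e1 e2).
Qed.

Lemma tot_lift_Gamma_cell (H : TngHom X V) x :
  vf_hom (fc_tot (lm_cell (Λ (Γ H))) x) ≈ vf_hom (fc_tot (lm_cell H) x).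
Proof.
have e1 := heq_of_eq (tot_lift_cell (Γ H) x).
have e2 := heq_of_eq (tot_forget_comp H x).
exact (heq_trans e1 e2).
Qed.

Lemma lift_Gamma_ob (H : TngHom X V) : Λ (Γ H) = H.
Proof.
apply: (laxmor_eq (lift_Gamma_mor H)).
apply: fibcell_heq.
- exact (f_equal (fun F : Hom1 X V => fib_comp F (T_ X)) (lift_Gamma_mor H)).
- exact (f_equal (fun F : Hom1 X V => fib_comp (T_ V) F) (lift_Gamma_mor H)).
- move=> a; apply: vfhom_heq.
  + exact: base_lift_Gamma_ob.
  + exact (f_equal (VF_T YB) (base_lift_Gamma_ob H a)).
  + exact (base_lift_Gamma_cell H a).
- move=> x; apply: vfhom_heq.
  + exact: tot_lift_Gamma_ob.
  + exact (f_equal (VF_T YT) (tot_lift_Gamma_ob H x)).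
  + exact (tot_lift_Gamma_cell H x).
Qed.

Lemma lift_Gamma : fcomp Λ Γ = fid (TngHom X V).
Proof.
apply: functor_eq => H H' φ.
apply: (tanhom_heq (lift_Gamma_ob H) (lift_Gamma_ob H')).
apply: fibcell_heq; [exact: lift_Gamma_mor|exact: lift_Gamma_mor| |].
- move=> a; apply: vfhom_heq; [exact: base_lift_Gamma_ob|
    exact: base_lift_Gamma_ob|exact: heq_refl].
- move=> x; apply: vfhom_heq; [exact: tot_lift_Gamma_ob|
    exact: tot_lift_Gamma_ob|exact: heq_refl].
Qed.

Lemma Gamma_invertible : invertible Γ.
Proof. by exists Λ; split; [exact: lift_Gamma | exact: Gamma_lift]. Qed.
End GammaInverse.

Lemma VF_construction (P : Tangentad Fib) :
  exists (cl : Cleavage (VF_proj P))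
         (S : TangentStructure (VF_fibration cl))
         (U : LaxMor (Build_Tangentad S) P)
         (v : VectorField (Y := HomTan (Build_Tangentad S) P) U),
    is_VF_tangent_fibration v /\ is_universal_vector_field v.
Proof.
have [tw twπ] := tang_distributor (td_str P).
exists (VF_cleavage P), (VF_structure twπ), (VF_forget_lax twπ), (VF_universal twπ).
split; first exact: VF_universal_is_VF.
split; first exact: VF_forget_is_strict.
by move=> X; exact: Gamma_invertible.
Qed.

Theorem theorem5p4 :
  admits_construction_of_vector_fields Fib /\
  forall P : Tangentad Fib,
    exists (cl : Cleavage (VF_proj P))
           (S : TangentStructure (VF_fibration cl))
           (U : LaxMor (Build_Tangentad S) P)
           (v : VectorField (Y := HomTan (Build_Tangentad S) P) U),
      is_VF_tangent_fibration v /\ is_universal_vector_field v.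
Proof.
split; last exact: VF_construction.
move=> P; have [cl [S [U [v [_ H]]]]] := VF_construction P.
by exists (Build_Tangentad S), U, v.
Qed.
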